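(* Assume that $$\alpha > \frac14 \sum_{\nu=1}^N \big\| \chi_Z (S_\nu - \chi_\nu S_\nu)\big\|_{L^2(\Omega)\to L^2(\Omega)}^2 ,$$ and let $\bar u$ denote the solution of the augmented Nash equilibrium problem described in the context. Then the semi-smooth Newton algorithm described in the context has the following properties: a) Let $\|u_0-\bar u\|_{L^2(\Omega)^N}$ be sufficiently small. Then the iterates $u_k$ converge superlinearly to $\bar u$ as $k\to\infty$. b) Let $u_k$ be generated by the algorithm such that its stopping criterion is satisfied. Then $u_k$ is a solution of $$G(u):=u-P_{U_{\mathrm{ad}}}\Big(-\frac1\alpha\tilde F(u)\Big)=0,\qquad \tilde F^\nu(u):=S_\nu^*\big(\chi_\nu(Su-y_d^\nu)+(\mu+\rho(Su-\psi))_+\big),\ \nu=1,\dots,N.$$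
   Context: Let $\Omega\subset\mathbb{R}^n$, $n\in\{1,2,3\}$, be a bounded Lipschitz domain, $N\in\mathbb{N}$, and $U:=L^2(\Omega)^N$ with elements $u=(u^1,\dots,u^N)=(u^\nu,u^{-\nu})$. Given $u_a^\nu,u_b^\nu\in L^2(\Omega)$ with $u_a^\nu\le u_b^\nu$ a.e., set $U_{\mathrm{ad}}^\nu:=\{u^\nu\in L^2(\Omega): u_a^\nu\le u^\nu\le u_b^\nu\text{ a.e. in }\Omega\}$, $U_{\mathrm{ad}}:=U_{\mathrm{ad}}^1\times\dots\times U_{\mathrm{ad}}^N$, $u_a=(u_a^\nu)_\nu$, $u_b=(u_b^\nu)_\nu$, and let $P_{U_{\mathrm{ad}}}$ be the projection onto $U_{\mathrm{ad}}$ in $U$ (componentwise pointwise truncation). Let $y_d^\nu\in L^2(\Omega)$, $\psi\in C(\bar\Omega)$, $\mu\in L^2(\Omega)$ with $\mu\ge0$, $\alpha,\rho>0$, and $(\cdot)_+:=\max(\cdot,0)$ pointwise a.e. Let $Y$ be a state space continuously embedded in $L^q(\Omega)$ for some $q>2$, and let $A:Y\to H^{-1}(\Omega)$ be linear, bounded and continuously invertible (a linear elliptic operator). Set $S_\nu:=A^{-1}:H^{-1}(\Omega)\to Y\hookrightarrow L^q(\Omega)$ for every $\nu$ and $Su:=\sum_{\nu=1}^N S_\nu u^\nu$. Via $L^2(\Omega)\hookrightarrow H^{-1}(\Omega)$ and $L^q(\Omega)\hookrightarrow L^2(\Omega)$, $S_\nu$ is also regarded as a bounded operator on $L^2(\Omega)$,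 with adjoint $S_\nu^*$ (which maps $L^2(\Omega)$ into $H^{-1}(\Omega)^*=H_0^1(\Omega)$). Let $\Omega_\nu\subseteq\Omega$ be measurable with characteristic function $\chi_\nu$, and let $\chi_Z$ be the characteristic function of $Z:=\bigcup_\nu\Omega_\nu$. Augmented Nash equilibrium problem: for each $\nu$, player $\nu$ minimizes over $u^\nu\in U_{\mathrm{ad}}^\nu$ $$f_\nu^{AL}(u):=\tfrac12\|Su-y_d^\nu\|_{L^2(\Omega_\nu)}^2+\tfrac{\alpha}{2}\|u^\nu\|_{L^2(\Omega)}^2+\tfrac{1}{2\rho}\|(\mu+\rho(Su-\psi))_+\|_{L^2(\Omega)}^2 ;$$ a solution is $\bar u\in U_{\mathrm{ad}}$ with $f_\nu^{AL}(\bar u^\nu,\bar u^{-\nu})\le f_\nu^{AL}(v^\nu,\bar u^{-\nu})$ for all $v^\nu\in U_{\mathrm{ad}}^\nu$ and all $\nu$. For an iterate $u_k\in U$ define $\mathcal{A}_k^{\nu,a}:=\{-\frac1\alpha\tilde F^\nu(u_k)\le u_a^\nu\}$, $\mathcal{A}_k^{\nu,b}:=\{-\frac1\alpha\tilde F^\nu(u_k)\ge u_b^\nu\}$, $\mathcal{I}_k^\nu:=\{-\frac1\alpha\tilde F^\nu(u_k)\in(u_a^\nu,u_b^\nu)\}$, $\mathcal{Y}_k:=\{\mu+\rho(Su_k-\psi)>0\}$ (subsets of $\Omega$). Let $\chi_{\mathcal{I}_k}$, $\chi_{\mathcal{A}_k^a}$, $\chi_{\mathcal{A}_k^b}$ be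 the $N$-tuples of characteristic functions of $\mathcal{I}_k^\nu$, $\mathcal{A}_k^{\nu,a}$, $\mathcal{A}_k^{\nu,b}$, $\nu=1,\dots,N$, acting on $U$ by componentwise multiplication. Semi-smooth Newton algorithm: (1) set $k=0$ and choose $u_0\in U$; (2) repeat: (3) determine $\mathcal{A}_k^{\nu,a},\mathcal{A}_k^{\nu,b},\mathcal{I}_k^\nu,\mathcal{Y}_k$; (4) solve for $u_{k+1}^{\mathcal I}\in U$ the linear system $(\mathrm{Id}+\chi_{\mathcal{I}_k}T^k)u_{k+1}^{\mathcal I}=\chi_{\mathcal{I}_k}g_k$, where $$(T^kh)^\nu:=\tfrac1\alpha S_\nu^*(\chi_\nu S+\chi_{\mathcal{Y}_k}\rho S)h,$$ $$(g_k)^\nu:=-\tfrac1\alpha\chi_{\mathcal{I}_k^\nu}\Big(S_\nu^*\big((\chi_\nu S+\chi_{\mathcal{Y}_k}\rho S)(\chi_{\mathcal{A}_k^a}u_a+\chi_{\mathcal{A}_k^b}u_b)-\chi_\nu y_d^\nu+\chi_{\mathcal{Y}_k}(\mu-\rho\psi)\big)\Big);$$ (5) set $u_{k+1}:=u_{k+1}^{\mathcal I}+\chi_{\mathcal{A}_k^a}u_a+\chi_{\mathcal{A}_k^b}u_b$; (6) set $k:=k+1$; (7) until (stopping criterion) $\mathcal{A}_k^{\nu,a}=\mathcal{A}_{k-1}^{\nu,a}$, $\mathcal{A}_k^{\nu,b}=\mathcal{A}_{k-1}^{\nu,b}$, $\mathcal{I}_k^\nu=\mathcal{I}_{k-1}^\nu$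 for all $\nu$ and $\mathcal{Y}_k=\mathcal{Y}_{k-1}$. In part a) the iteration is considered without stopping. Superlinear convergence means $u_k\to\bar u$ and $\|u_{k+1}-\bar u\|_U=o(\|u_k-\bar u\|_U)$.
   Formalization: Where the lower and upper active sets overlap (only where u_a = u_b), the common bound is counted once in χ_{A^a}u_a + χ_{A^b}u_b; read literally, the formula gives 2u_a there and the iteration can fail to converge. *)

(* Defs.v *)
From HB Require Import structures.
From mathcomp Require Import all_boot all_order all_algebra.
From mathcomp Require Import all_classical all_reals all_analysis.
From mathcomp Require Import measurable_realfun ess_sup_inf ring lra.

Set Implicit Arguments.
Unset Strict Implicit.
Unset Printing Implicit Defensive.
Import Order.TTheory GRing.Theory Num.Theory.
Import numFieldNormedType.Exports.
Local Open Scope classical_set_scope.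
Local Open Scope ring_scope.

Definition rV_display : measure_display. Proof. exact. Qed.


Section rV_measurable.
Context (R : realType) (n : nat).

Let coord (i : 'I_n) (x : 'rV[R]_n) : measurableTypeR R := x ord0 i.

Let rV_set0 : g_sigma_preimage coord set0.
Proof. exact: sigma_algebra0. Qed.

Let rV_setC A : g_sigma_preimage coord A -> g_sigma_preimage coord (~` A).
Proof. exact: sigma_algebraC. Qed.

Let rV_bigcup (F : _^nat) : (forall i, g_sigma_preimage coord (F i)) ->
  g_sigma_preimage coord (\bigcup_i (F i)).
Proof. exact: sigma_algebra_bigcup. Qed.

HB.instance Definition _ := @isMeasurable.Build rV_display
  'rV[R]_n (g_sigma_preimage coord) rV_set0 rV_setC rV_bigcup.

Lemma measurable_coord (i : 'I_n) :
  measurable_fun [set: 'rV[R]_n] (fun x : 'rV[R]_n => x ord0 i).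
Proof.
move=> _ Y mY; rewrite setTI; apply: sub_sigma_algebra => /=.
rewrite -bigcup_seq/=; exists i => /=; first by rewrite mem_index_enum.
by exists Y => //; rewrite setTI.
Qed.

Lemma measurable_fun_coordP d (T : measurableType d) (f : T -> 'rV[R]_n) :
  (forall i, measurable_fun [set: T] (fun x => f x ord0 i)) ->
  measurable_fun [set: T] f.
Proof.
move=> mf; apply: (@measurability _ _ _ _ _ _
  (\big[setU/set0]_(i < n) preimage_set_system setT (coord i) measurable)) => //.
move=> _ [C + <-]; rewrite -bigcup_seq => -[i _ [A mA <-]].
by rewrite !setTI -comp_preimage -[X in measurable X]setTI; exact: mf.
Qed.

Lemma open_measurable_rV (U : set 'rV[R]_n) : open U -> measurable U.
Proof.
move=> oU.
pose B (q : 'rV[rat]_n * rat) : set 'rV[R]_n :=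
  [set x | forall i, ball (ratr (q.1 ord0 i) : R) (ratr q.2) (x ord0 i)].
have mB q : measurable (B q).
  have -> : B q = \big[setI/setT]_(i <- enum 'I_n)
      ((fun x : 'rV[R]_n => x ord0 i) @^-1` ball (ratr (q.1 ord0 i) : R) (ratr q.2)).
    rewrite -bigcap_seq; apply/seteqP; split => [x Bx i _|x Bx i]; first exact: Bx.
    by apply: Bx; rewrite /= mem_enum.
  apply: bigsetI_measurable => i _; rewrite -[X in measurable X]setTI.
  by apply: measurable_coord => //; exact: (open_measurable (ball_open _ _)).
have -> : U = \bigcup_(q in [set q | B q `<=` U]) B q.
  apply/seteqP; split => [x Ux|x [q]]; last by move=> /[apply].
  have /nbhs_ballP[e /= e0 xeU] : nbhs x U by exact: open_nbhs_nbhs.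
  have [r /andP[r0 re]] : exists r : rat, (0 : R) < ratr r < e / 2.
    have [r] := @rat_in_itvoo R 0 (e / 2) (divr_gt0 e0 (ltr0n _ 2)).
    by rewrite in_itv/=; exists r.
  have /choice[c xc] : forall i : 'I_n,
      exists c : rat, ball (ratr c : R) (ratr r) (x ord0 i).
    move=> i; have xr : x ord0 i - ratr r < x ord0 i + ratr r by lra.
    have [c] := rat_in_itvoo xr.
    rewrite in_itv/= => /andP[c1 c2]; exists c.
    by rewrite /ball/= ltr_norml; apply/andP; split; lra.
  exists (\row_i c i, r); last by move=> i; rewrite mxE.
  move=> y By; apply: xeU; split=> // i j; rewrite (ord1 i).
  have := By j; rewrite /= mxE => yc.
  apply: (@le_ball _ _ _ (ratr r + ratr r)); first lra.
  exact: ball_triangle (ball_sym (xc j)) yc.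
rewrite bigcup_mkcond; apply: countable_bigcupT_measurable => //.
by move=> q; case: ifP.
Qed.
End rV_measurable.

Section lebesgue_rV.
Context (R : realType).

Definition rV_cons n (x : measurableTypeR R * 'rV[R]_n) : 'rV[R]_n.+1 :=
  \row_i if unlift ord0 i is Some j then x.2 ord0 j else x.1.

Definition rV_uncons n (x : 'rV[R]_n.+1) : measurableTypeR R * 'rV[R]_n :=
  (x ord0 ord0, \row_j x ord0 (lift ord0 j)).

Lemma rV_consK n : cancel (@rV_cons n) (@rV_uncons n).
Proof.
move=> [a x]; rewrite /rV_uncons !mxE unlift_none; congr pair.
by apply/rowP => j; rewrite !mxE liftK.
Qed.

Lemma measurable_rV_cons n : measurable_fun setT (@rV_cons n).
Proof.
apply: measurable_fun_coordP => i; under eq_fun do rewrite mxE.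
case: (unliftP ord0 i) => [j|] _; last exact: measurable_fst.
exact: (measurableT_comp (measurable_coord j) measurable_snd).
Qed.

Lemma measurable_rV_uncons n : measurable_fun setT (@rV_uncons n).
Proof.
apply/measurable_fun_pairP; split; first exact: measurable_coord.
apply: measurable_fun_coordP => i /=; under eq_fun do rewrite mxE.
exact: measurable_coord.
Qed.

Section push.
Variables (n : nat) (m : {sigma_finite_measure set 'rV[R]_n -> \bar R}).

Definition lebesgue_rV_cons :=
  pushforward (lebesgue_measure \x m)%E (@rV_cons n).

Let push : {measure set 'rV[R]_n.+1 -> \bar R} :=
  measure_function_pushforward__canonical__measure_function_Measure
    (lebesgue_measure \x m)%E (@measurable_rV_cons n).

HB.instance Definition _ := @isMeasure.Build _ _ _ lebesgue_rV_cons
  (measure0 push) (measure_ge0 push) (@measure_semi_sigma_additive _ _ _ push).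

Let sigma_finite_rV_cons : sigma_finite setT lebesgue_rV_cons.
Proof.
have /sigma_finiteP[F [TF ndF Foo]] : sigma_finite setT (@lebesgue_measure R).
  exact: sigma_finiteT.
have /sigma_finiteP[G [TG ndG Goo]] := sigma_finiteT m.
exists (fun i => @rV_uncons n @^-1` (F i `*` G i)).
  apply/esym; rewrite -subTset => x _.
  have [i _ Fi] : (\bigcup_i F i) (rV_uncons x).1 by rewrite -TF.
  have [j _ Gj] : (\bigcup_i G i) (rV_uncons x).2 by rewrite -TG.
  exists (maxn i j) => //; split.
    by move: Fi; exact/subsetPset/ndF/leq_maxl.
  by move: Gj; exact/subsetPset/ndG/leq_maxr.
move=> i; have [mF Fy] := Foo i; have [mG Gy] := Goo i; split.
  rewrite -[X in measurable X]setTI; apply: measurable_rV_uncons => //.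
  exact: measurableX.
rewrite /lebesgue_rV_cons /pushforward -comp_preimage.
rewrite (_ : _ \o _ = id); last by apply/funext => x /=; exact: rV_consK.
by rewrite preimage_id product_measure1E// lte_mul_pinfty// ge0_fin_numE.
Qed.

HB.instance Definition _ := @Measure_isSigmaFinite.Build _ _ _
  lebesgue_rV_cons sigma_finite_rV_cons.
End push.

Fixpoint lebesgue_rV n : {sigma_finite_measure set 'rV[R]_n -> \bar R} :=
  if n is n'.+1 then lebesgue_rV_cons (lebesgue_rV n')
  else \d_(0 : 'rV[R]_0).

Lemma measurable_rV_box n (a b : 'rV[R]_n) :
  measurable [set x : 'rV[R]_n | forall i, a ord0 i < x ord0 i <= b ord0 i].
Proof.
have -> : [set x : 'rV[R]_n | forall i, a ord0 i < x ord0 i <= b ord0 i] =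
    \big[setI/setT]_(i <- enum 'I_n)
      ((fun x : 'rV[R]_n => x ord0 i) @^-1` `]a ord0 i, b ord0 i]).
  rewrite -bigcap_seq; apply/seteqP; split => [x abx i _|x abx i].
    by rewrite /= in_itv; exact: abx.
  by have := abx i; rewrite /= in_itv mem_enum; exact.
apply: bigsetI_measurable => i _; rewrite -[X in measurable X]setTI.
exact: measurable_coord.
Qed.

Lemma lebesgue_rV_box n (a b : 'rV[R]_n) :
  (forall i, a ord0 i <= b ord0 i) ->
  lebesgue_rV n [set x | forall i, a ord0 i < x ord0 i <= b ord0 i] =
    (\prod_i (b ord0 i - a ord0 i))%:E.
Proof.
elim: n a b => [|n IH] a b ab.
  by rewrite big_ord0 /= diracE mem_set// => -[].
rewrite /= /lebesgue_rV_cons /pushforward.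
have -> : @rV_cons n @^-1` [set x | forall i, a ord0 i < x ord0 i <= b ord0 i] =
  `]a ord0 ord0, b ord0 ord0]%classic `*`
  [set x : 'rV_n | forall i, (rV_uncons a).2 ord0 i < x ord0 i <= (rV_uncons b).2 ord0 i].
  apply/seteqP; split => [[x y] /= h|[x y] /= [h1 h2] i].
    split; first by have := h ord0; rewrite mxE unlift_none in_itv.
    by move=> i; have := h (lift ord0 i); rewrite !mxE liftK.
  rewrite mxE; case: unliftP => [j|] ->; last by move: h1; rewrite in_itv.
  by have := h2 j; rewrite !mxE.
rewrite product_measure1E//; last exact: measurable_rV_box.
rewrite IH; last by move=> i; rewrite !mxE.
have E := lebesgue_measure_itv `]a ord0 ord0, b ord0 ord0].
rewrite [X in (X * _)%E = _]E /= lte_fin big_ord_recl.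
transitivity ((b ord0 ord0 - a ord0 ord0)%:E *
    (\prod_i ((rV_uncons b).2 ord0 i - (rV_uncons a).2 ord0 i))%:E)%E.
  congr (_ * _)%E; case: ltP => //; have := ab ord0 => ab0 ba0.
  by rewrite (le_anti (introT andP (conj ab0 ba0))) subrr.
rewrite -EFinM; congr (_ * _)%:E; apply: eq_bigr => i _.
by rewrite !mxE.
Qed.
End lebesgue_rV.

Lemma eq_ae_Lnorm d (T : measurableType d) (R : realType)
    (mu : {measure set T -> \bar R}) (p : \bar R) (f g : T -> R) :
  measurable_fun setT f -> measurable_fun setT g ->
  {ae mu, forall x, f x = g x} ->
  'N[mu]_p[EFin \o f]%E = 'N[mu]_p[EFin \o g]%E.
Proof.
move=> mf mg fg; rewrite unlock; case: p => [r| |].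
- congr (_ `^ _)%E; apply: ae_eq_integral => //.
  + apply/measurable_EFinP; apply: (measurableT_comp (measurable_powR _)).
    exact: measurableT_comp.
  + apply/measurable_EFinP; apply: (measurableT_comp (measurable_powR _)).
    exact: measurableT_comp.
  + by apply: filterS fg => x /= -> _.
- by case: ifP => // _; apply: eq_ess_sup; apply: filterS fg => x /= ->.
- by case: ifP => // _; apply: eq_ess_inf; apply: filterS fg => x /= ->.
Qed.

Section Lp_space.
Context d (T : measurableType d) (R : realType).
Variables (mu : {measure set T -> \bar R}) (p : \bar R) (p1 : (1 <= p)%E).

Definition Lfun_ae0 : {pred LfunType mu p1} :=
  fun f => `[< {ae mu, forall x, f x = 0} >].

Lemma Lfun_ae0P (f : LfunType mu p1) :
  reflect {ae mu, forall x, f x = 0} (f \in Lfun_ae0).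
Proof. exact: asboolP. Qed.

Let Lfun_ae0_zmod_closed : zmod_closed Lfun_ae0.
Proof.
split; first by apply/Lfun_ae0P; exact: aeW.
move=> f g /Lfun_ae0P f0 /Lfun_ae0P g0; apply/Lfun_ae0P.
by apply: filterS2 f0 g0 => x /= fx gx; rewrite -[LHS]/(f x - g x) fx gx subr0.
Qed.

HB.instance Definition _ :=
  GRing.isZmodClosed.Build (LfunType mu p1) Lfun_ae0 Lfun_ae0_zmod_closed.

(* The quotient is wrapped in a record so that the coercion of its elements to
   functions also applies to elements of spaces built from it. *)
Record Lp : Type := LpQuot { Lp_quot : {ideal_quot Lfun_ae0} }.

HB.instance Definition _ := [isNew for Lp_quot].
HB.instance Definition _ := [Choice of Lp by <:].

Local Open Scope quotient_scope.

Definition Lp_pi (f : LfunType mu p1) : Lp := LpQuot (\pi_{ideal_quot Lfun_ae0} f).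

Definition Lp_repr (u : Lp) : LfunType mu p1 := repr (Lp_quot u).

Definition Lp_fun (u : Lp) : T -> R := Lp_repr u.
Coercion Lp_fun : Lp >-> Funclass.

Let Lp_add (u v : Lp) := LpQuot (Lp_quot u + Lp_quot v).
Let Lp_opp (u : Lp) := LpQuot (- Lp_quot u).

Let Lp_addA : associative Lp_add.
Proof. by move=> u v w; rewrite /Lp_add addrA. Qed.

Let Lp_addC : commutative Lp_add.
Proof. by move=> u v; rewrite /Lp_add addrC. Qed.

Let Lp_add0 : left_id (LpQuot 0) Lp_add.
Proof. by case=> u; rewrite /Lp_add add0r. Qed.

Let Lp_addN : left_inverse (LpQuot 0) Lp_opp Lp_add.
Proof. by move=> u; rewrite /Lp_add addNr. Qed.

HB.instance Definition _ := GRing.isZmodule.Build Lp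
  Lp_addA Lp_addC Lp_add0 Lp_addN.

Lemma Lp_reprK u : Lp_pi (Lp_repr u) = u.
Proof. by case: u => u; rewrite /Lp_pi reprK. Qed.

Lemma measurable_Lp_fun (u : Lp) : measurable_fun setT u.
Proof. exact: (measurable_funP (Lp_repr u)). Qed.

Lemma Lp_funE (f : LfunType mu p1) : {ae mu, forall x, Lp_pi f x = f x}.
Proof.
have : Lp_repr (Lp_pi f) - f \in Lfun_ae0.
  by rewrite (Quotient.idealrBE Lfun_ae0) reprK.
move=> /Lfun_ae0P; apply: filterS => x h.
by apply/eqP; rewrite -subr_eq0; apply/eqP.
Qed.

Lemma Lp_eqP (u v : Lp) : u = v <-> {ae mu, forall x, u x = v x}.
Proof.
split=> [->|uv]; first exact: aeW.
rewrite -[u]Lp_reprK -[v]Lp_reprK; congr LpQuot; apply/eqP.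
rewrite -(Quotient.idealrBE Lfun_ae0); apply/Lfun_ae0P.
by apply: filterS uv => x /= uv; rewrite -[LHS]/(u x - v x) uv subrr.
Qed.

Lemma Lp_funD (u v : Lp) : {ae mu, forall x, (u + v : Lp) x = u x + v x}.
Proof.
have -> : u + v = Lp_pi (Lp_repr u + Lp_repr v).
  by rewrite /Lp_pi Quotient.pi_add !reprK.
exact: (Lp_funE (Lp_repr u + Lp_repr v)).
Qed.

Definition Lp_scale (a : R) (u : Lp) : Lp := Lp_pi (a *: Lp_repr u).

Lemma Lp_scaleE a u : {ae mu, forall x, (Lp_scale a u) x = a * u x}.
Proof. exact: (Lp_funE (a *: Lp_repr u)). Qed.

Let Lp_scalerA a b u : Lp_scale a (Lp_scale b u) = Lp_scale (a * b) u.
Proof.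
apply/Lp_eqP; move: (Lp_scaleE a (Lp_scale b u)) (Lp_scaleE b u)
  (Lp_scaleE (a * b) u); apply: filterS3 => x -> -> ->.
by rewrite mulrA.
Qed.

Let Lp_scale1r : left_id 1 Lp_scale.
Proof.
by move=> u; apply/Lp_eqP; apply: filterS (Lp_scaleE 1 u) => x ->; rewrite mul1r.
Qed.

Let Lp_scalerDr : right_distributive Lp_scale +%R.
Proof.
move=> a u v; apply/Lp_eqP.
apply: filterS2 (filterI (Lp_scaleE a (u + v)) (Lp_funD u v))
  (filterI (Lp_funD (Lp_scale a u) (Lp_scale a v))
    (filterI (Lp_scaleE a u) (Lp_scaleE a v))) => x [-> ->] [-> [-> ->]].
by rewrite mulrDr.
Qed.

Let Lp_scalerDl u : {morph Lp_scale^~ u : a b / a + b}.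
Proof.
move=> a b; apply/Lp_eqP.
apply: filterS2 (Lp_scaleE (a + b) u)
  (filterI (Lp_funD (Lp_scale a u) (Lp_scale b u))
    (filterI (Lp_scaleE a u) (Lp_scaleE b u))) => x -> [-> [-> ->]].
by rewrite mulrDl.
Qed.

HB.instance Definition _ := GRing.Zmodule_isLmodule.Build R Lp
  Lp_scalerA Lp_scale1r Lp_scalerDr Lp_scalerDl.

Lemma Lp_funZ a (u : Lp) : {ae mu, forall x, (a *: u : Lp) x = a * u x}.
Proof. exact: Lp_scaleE. Qed.

Lemma Lp_fun0 : {ae mu, forall x, (0 : Lp) x = 0}.
Proof.
have := Lp_funZ 0 (0 : Lp); have <- : (0 : Lp) = 0 *: (0 : Lp).
  by rewrite scale0r.
by apply: filterS => x ->; rewrite mul0r.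
Qed.

Definition Lp_norm (u : Lp) : R := fine ('N[mu]_p[EFin \o u]).

Let Lp_normE u : (Lp_norm u)%:E = 'N[mu]_p[EFin \o u]%E.
Proof. exact: (finite_norm_fine (Lp_repr u)). Qed.

Let Lp_normD u v : Lp_norm (u + v) <= Lp_norm u + Lp_norm v.
Proof.
rewrite -lee_fin EFinD !Lp_normE.
rewrite (eq_ae_Lnorm _ _ _ (Lp_funD u v)).
- exact: eminkowski (measurable_Lp_fun u) (measurable_Lp_fun v) p1.
- exact: measurable_Lp_fun.
- by apply: measurable_funD; exact: measurable_Lp_fun.
Qed.

Let Lp_normZ a u : Lp_norm (a *: u) = `|a| * Lp_norm u.
Proof.
apply/EFin_inj; rewrite EFinM !Lp_normE (eq_ae_Lnorm _ _ _ (Lp_funZ a u)).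
- exact: (LnormZ (Lp_repr u) a).
- exact: measurable_Lp_fun.
- by apply: measurable_funM => //; exact: measurable_Lp_fun.
Qed.

Let Lp_norm_eq0 u : Lp_norm u = 0 -> u = 0.
Proof.
move=> /(@fine_Lnormr_eq0 _ _ _ _ _ p1 (Lp_repr u)) u0; apply/Lp_eqP.
by apply: filterS2 Lp_fun0 u0 => x -> /(_ Logic.I).
Qed.

HB.instance Definition _ := Lmodule_isNormed.Build R Lp
  Lp_normD Lp_normZ Lp_norm_eq0.

Lemma Lp_norm_def (u : Lp) : `|u| = fine ('N[mu]_p[EFin \o u]).
Proof. by []. Qed.

Definition Lp_of (f : T -> R) : Lp :=
  if insub f is Some g then Lp_pi g else 0.

Lemma Lp_ofE (f : T -> R) : f \in Lfun mu p ->
  {ae mu, forall x, Lp_of f x = f x}.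
Proof.
rewrite /Lp_of; case: insubP => [g _ <- _|/negbTE ->//].
exact: Lp_funE.
Qed.

End Lp_space.

Section l2sum.
Context (R : realType) (I : finType) (V : normedModType R).

Definition l2sum : Type := {ffun I -> V}.

HB.instance Definition _ := GRing.Lmodule.on l2sum.

Definition l2sum_fun (u : l2sum) : I -> V :=
  fun i => (u : {ffun I -> V}) i.
Coercion l2sum_fun : l2sum >-> Funclass.

Definition l2sum_of (f : I -> V) : l2sum := [ffun i => f i].

Lemma l2sum_ofE f : l2sum_of f =1 f.
Proof. exact: ffunE. Qed.

Lemma l2sumP (u v : l2sum) : u =1 v -> u = v.
Proof. by move=> uv; apply/ffunP. Qed.

Lemma l2sum_fun0 i : (0 : l2sum) i = 0.
Proof. by rewrite /l2sum_fun ffunE. Qed.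

Lemma l2sum_funD (u v : l2sum) i : (u + v : l2sum) i = u i + v i.
Proof. by rewrite /l2sum_fun ffunE. Qed.

Lemma l2sum_funZ a (u : l2sum) i : (a *: u : l2sum) i = a *: u i.
Proof. by rewrite /l2sum_fun ffunE. Qed.

Definition l2sum_norm (u : l2sum) : R := Num.sqrt (\sum_i `|u i| ^+ 2).

Let sum_ge0 (u : l2sum) : 0 <= \sum_i `|u i| ^+ 2.
Proof. by apply: sumr_ge0 => i _; exact: sqr_ge0. Qed.

Let l2sum_norm_eq0 u : l2sum_norm u = 0 -> u = 0.
Proof.
move=> /eqP; rewrite sqrtr_eq0 => u0.
have /eqP : \sum_i `|u i| ^+ 2 = 0 by apply/eqP; rewrite eq_le u0 sum_ge0.
rewrite psumr_eq0; last by move=> i _; exact: sqr_ge0.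
move=> /allP h; apply: l2sumP => i.
by have := h i (mem_index_enum i); rewrite implyTb sqrf_eq0 normr_eq0 l2sum_fun0 => /eqP.
Qed.

Let l2sum_normZ a u : l2sum_norm (a *: u) = `|a| * l2sum_norm u.
Proof.
rewrite /l2sum_norm -[`|a|]sqrtr_sqr -sqrtrM ?sqr_ge0// mulr_sumr.
congr Num.sqrt; apply: eq_bigr => i _.
by rewrite l2sum_funZ normrZ exprMn real_normK// num_real.
Qed.

Let l2sum_normD u v : l2sum_norm (u + v) <= l2sum_norm u + l2sum_norm v.
Proof.
have [u0|u0] := eqVneq (l2sum_norm u) 0.
  by rewrite u0 (l2sum_norm_eq0 u0) !add0r.
have [v0|v0] := eqVneq (l2sum_norm v) 0.
  by rewrite v0 (l2sum_norm_eq0 v0) !addr0.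
have uE : l2sum_norm u ^+ 2 = \sum_i `|u i| ^+ 2 by rewrite sqr_sqrtr.
have vE : l2sum_norm v ^+ 2 = \sum_i `|v i| ^+ 2 by rewrite sqr_sqrtr.
have u_gt0 : 0 < l2sum_norm u by rewrite lt_def u0 sqrtr_ge0.
have v_gt0 : 0 < l2sum_norm v by rewrite lt_def v0 sqrtr_ge0.
set A := l2sum_norm u in uE u_gt0 *; set B := l2sum_norm v in vE v_gt0 *.
have AB0 : 0 <= A + B by rewrite addr_ge0 // ltW.
rewrite -[leRHS]ger0_norm// -sqrtr_sqr; apply: ler_wsqrtr.
rewrite -(ler_pM2l (mulr_gt0 u_gt0 v_gt0)).
have -> : A * B * (A + B) ^+ 2 =
    (A + B) * (B * \sum_i `|u i| ^+ 2 + A * \sum_i `|v i| ^+ 2).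
  by rewrite -uE -vE; ring.
rewrite !mulr_sumr -big_split/= mulr_sumr; apply: ler_sum => i _.
rewrite l2sum_funD; set a := `|u i|; set b := `|v i|.
apply: (@le_trans _ _ (A * B * (a + b) ^+ 2)).
  apply: ler_wpM2l; first by rewrite mulr_ge0 // ltW.
  by apply: lerXn2r; rewrite ?nnegrE ?addr_ge0 ?normr_ge0 // ler_normD.
have := sqr_ge0 (B * a - A * b); nra.
Qed.

HB.instance Definition _ := Lmodule_isNormed.Build R l2sum
  l2sum_normD l2sum_normZ l2sum_norm_eq0.

Lemma l2sum_norm_def (u : l2sum) : `|u| = Num.sqrt (\sum_i `|u i| ^+ 2).
Proof. by []. Qed.

End l2sum.

Section operator_norm.
Context (R : realType) (V W : normedModType R).

Definition opnorm (f : V -> W) : R := sup [set `|f x| | x in [set x | `|x| <= 1]].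

End operator_norm.

Section operator_norm_linear.
Context (R : realType) (V W : normedModType R) (f : {linear V -> W}).
Hypothesis fc : continuous f.

Let opnorm_has_ub : has_ubound [set `|f x| | x in [set x | `|x| <= 1]].
Proof.
have /bounded_funP/(_ 1)[M fM] := (linear_bounded_continuous f).2 fc.
by exists M => _ [x x1 <-]; exact: fM.
Qed.

Lemma ler_opnorm x : `|f x| <= opnorm f * `|x|.
Proof.
have [->|x0] := eqVneq x 0; first by rewrite linear0 !normr0 mulr0.
have x_gt0 : 0 < `|x| by rewrite normr_gt0.
rewrite -ler_pdivrMr//; apply: (ub_le_sup opnorm_has_ub).
exists (`|x|^-1 *: x) => /=.
  by rewrite normrZ gtr0_norm ?invr_gt0// mulVf// gt_eqF.
by rewrite linearZ/= normrZ gtr0_norm ?invr_gt0// mulrC.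
Qed.

Lemma opnorm_ge x : `|x| <= 1 -> `|f x| <= opnorm f.
Proof. by move=> x1; apply: (ub_le_sup opnorm_has_ub); exists x. Qed.

Lemma opnorm_le M : (forall x, `|x| <= 1 -> `|f x| <= M) -> opnorm f <= M.
Proof.
move=> fM; apply: ge_sup; first by exists `|f 0|, 0 => //=; rewrite normr0.
by move=> _ [x x1 <-]; exact: fM.
Qed.

End operator_norm_linear.

Section dual.
Context (R : realType) (V : normedModType R).

Definition dual_pred : {pred V -> R^o} :=
  fun f => `[< linear f /\ continuous f >].

Lemma dual_predP (f : V -> R^o) :
  reflect (linear f /\ continuous f) (f \in dual_pred).
Proof. exact: asboolP. Qed.

Let dual_submod_closed : submod_closed dual_pred.
Proof.
split.
  apply/dual_predP; split; last by move=> x; exact: cvg_cst.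
  by move=> a x y; rewrite scaler0 addr0.
move=> a f g /dual_predP[fl fc] /dual_predP[gl gc]; apply/dual_predP; split.
  move=> b x y; rewrite -[LHS]/(a * f (b *: x + y) + g (b *: x + y)) fl gl.
  rewrite -[RHS]/(b * (a * f x + g x) + (a * f y + g y)).
  by rewrite -[b *: f x]/(b * f x) -[b *: g x]/(b * g x); ring.
move=> x; apply: (@cvgD _ R^o); last exact: gc.
by apply: (@cvgM R V (nbhs x) _ (cst a) f a (f x)); [exact: cvg_cst|exact: fc].
Qed.

HB.instance Definition _ :=
  GRing.isSubmodClosed.Build R (V -> R^o) dual_pred dual_submod_closed.

Record dual : Type := Dual { dual_fun :> V -> R^o; _ : dual_fun \in dual_pred }.

HB.instance Definition _ := [isSub for dual_fun].
HB.instance Definition _ := [Choice of dual by <:].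
HB.instance Definition _ := [SubChoice_isSubLmodule of dual by <:].

Lemma dual_linear (f : dual) : linear f.
Proof. by have /dual_predP[] := valP f. Qed.

Lemma dual_continuous (f : dual) : continuous f.
Proof. by have /dual_predP[] := valP f. Qed.

HB.instance Definition _ (f : dual) :=
  GRing.isLinear.Build R V R^o *:%R f (dual_linear f).

Let dual_norm (f : dual) : R := @opnorm R V R^o f.

Let dual_normP (f : dual) x : `|f x| <= dual_norm f * `|x|.
Proof. exact: (@ler_opnorm R V R^o f (@dual_continuous f)). Qed.

Let dual_norm_le1 (f : dual) x : `|x| <= 1 -> `|f x| <= dual_norm f.
Proof.
exact: (@opnorm_ge R V R^o f (@dual_continuous f)).
Qed.

Let dual_normD f g : dual_norm (f + g) <= dual_norm f + dual_norm g.
Proof.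
apply: (@opnorm_le R V R^o (f + g : dual)) => x x1.
by rewrite (le_trans (ler_normD (f x) (g x)))// lerD// dual_norm_le1.
Qed.

Let dual_normZ_le a f : dual_norm (a *: f) <= `|a| * dual_norm f.
Proof.
apply: (@opnorm_le R V R^o (a *: f : dual)) => x x1.
rewrite [leLHS](normrM a (f x)); apply: ler_wpM2l => //.
exact: dual_norm_le1.
Qed.

Let dual_norm0 : dual_norm 0 = 0.
Proof.
apply/eqP; rewrite eq_le; apply/andP; split.
  by apply: (@opnorm_le R V R^o (0 : dual)) => x _; rewrite normr0.
by have := dual_norm_le1 0 (x := 0); rewrite !normr0 => ->.
Qed.

Let dual_normZ a f : dual_norm (a *: f) = `|a| * dual_norm f.
Proof.
have [->|a0] := eqVneq a 0; first by rewrite scale0r dual_norm0 normr0 mul0r.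
apply/eqP; rewrite eq_le dual_normZ_le/=.
rewrite -ler_pdivlMl ?normr_gt0// -normfV.
by have := dual_normZ_le a^-1 (a *: f); rewrite scalerA mulVf// scale1r.
Qed.

Let dual_norm_eq0 f : dual_norm f = 0 -> f = 0.
Proof.
move=> f0; apply/val_inj/funext => x; apply/eqP.
by have := dual_normP f x; rewrite f0 mul0r normr_le0.
Qed.

HB.instance Definition _ := Lmodule_isNormed.Build R dual
  dual_normD dual_normZ dual_norm_eq0.

Lemma dual_norm_def (f : dual) : `|f| = @opnorm R V R^o f.
Proof. by []. Qed.

End dual.

Section lipschitz_domain.
Context (R : realType) (n : nat).

(* Near x, after an orthogonal change of coordinates, the set is the strict
   epigraph, in the direction of the i-th coordinate, of a Lipschitz function of
   the other n - 1 coordinates. *)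
Definition lipschitz_graph_at (O : set 'rV[R]_n) (x : 'rV[R]_n) : Prop :=
  exists (Q : 'M[R]_n) (i : 'I_n) (g : 'rV[R]_n.-1 -> R) (L r : R),
    [/\ Q *m Q^T = 1%:M, L.-lipschitz g, 0 < r &
        forall y, ball x r y ->
          (O y <-> g (col' i (y *m Q)) < (y *m Q) ord0 i)].

Record lipschitz_domain := LipschitzDomain {
  domain_set :> set 'rV[R]_n;
  domain_nonempty : domain_set !=set0;
  domain_open : open domain_set;
  domain_connected : connected domain_set;
  domain_bounded : bounded_set domain_set;
  domain_lipschitz : forall x, closure domain_set x -> ~ domain_set x ->
    lipschitz_graph_at domain_set x }.

Definition domain_measure (O : lipschitz_domain) : {measure set 'rV[R]_n -> \bar R} :=
  mrestr (lebesgue_rV R n) (open_measurable_rV (@domain_open O)).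

Definition partial (i : 'I_n) (f : 'rV[R]_n -> R) : 'rV[R]_n -> R :=
  fun x => 'D_(delta_mx ord0 i) f x.

Definition smooth (f : 'rV[R]_n -> R) : Prop :=
  forall (s : seq 'I_n) x, differentiable (foldr partial f s) x.

Definition test_function (O : set 'rV[R]_n) (f : 'rV[R]_n -> R) : Prop :=
  let supp := closure [set x | f x != 0] in
  [/\ smooth f, compact supp & supp `<=` O].

Lemma partialZD i a (f g : 'rV[R]_n -> R) :
  (forall x, differentiable f x) -> (forall x, differentiable g x) ->
  partial i (a *: f + g) = a *: partial i f + partial i g.
Proof.
move=> df dg; apply/funext => x; rewrite /partial.
have dfx := @diff_derivable _ _ _ f x (delta_mx ord0 i) (df x).
have dgx := @diff_derivable _ _ _ g x (delta_mx ord0 i) (dg x).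
by rewrite deriveD ?deriveZ//; exact: derivableZ.
Qed.

Lemma foldr_partialZD s a (f g : 'rV[R]_n -> R) : smooth f -> smooth g ->
  foldr partial (a *: f + g) s = a *: foldr partial f s + foldr partial g s.
Proof.
move=> sf sg; elim: s => [//|i s /= ->]; apply: partialZD.
  exact: (sf s).
exact: (sg s).
Qed.

Lemma smoothZD a (f g : 'rV[R]_n -> R) : smooth f -> smooth g -> smooth (a *: f + g).
Proof.
move=> sf sg s x; rewrite foldr_partialZD//.
by apply: differentiableD; [apply: differentiableZ; exact: sf|exact: sg].
Qed.

Lemma test_function0 (O : set 'rV[R]_n) : test_function O (0 : 'rV[R]_n -> R).
Proof.
rewrite /test_function /=; have -> : [set x : 'rV[R]_n | (0 : 'rV[R]_n -> R) x != 0] = set0.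
  by rewrite -subset0 => x /=; rewrite eqxx.
rewrite closure0; split; [|exact: compact0|exact: sub0set].
move=> s x; have -> : foldr partial (0 : 'rV[R]_n -> R) s = cst 0.
  elim: s => [//|i s /= ->]; apply/funext => y.
  by rewrite /partial derive_cst.
exact: differentiable_cst.
Qed.

Lemma test_functionZD (O : set 'rV[R]_n) a f g :
  test_function O f -> test_function O g -> test_function O (a *: f + g).
Proof.
move=> [sf cf fO] [sg cg gO].
have supp : closure [set x | (a *: f + g) x != 0] `<=`
    closure [set x | f x != 0] `|` closure [set x | g x != 0].
  rewrite -closureU; apply: closureS => x /=.
  have [fx|fx _] := eqVneq (f x) 0; last by left.
  by rewrite -[(_ + _) x]/(a * f x + g x) fx mulr0 add0r; right.
split.
- exact: smoothZD.
- by apply: (subclosed_compact _ (compactU cf cg) supp); exact: closed_closure.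
- by apply: subset_trans supp _ => x [/fO|/gO].
Qed.

End lipschitz_domain.

Lemma le1_2e (R : realType) : (1 <= 2%:E :> \bar R)%E.
Proof. by rewrite lee_fin ler1n. Qed.

Notation L2 O := (Lp (domain_measure O) (le1_2e _)).
Notation L2_of O := (Lp_of (domain_measure O) (le1_2e _)).

Section sobolev.
Context (R : realType) (n : nat) (O : lipschitz_domain R n).

Definition L2_inner (u v : L2 O) : R :=
  \int[domain_measure O]_x (u x * v x).

(* The component None of an element of H1_pairs stands for a function, and the
   component Some i for its i-th weak derivative; the norm is the H^1 norm. *)
Lemma L2_Lfun (u : L2 O) : (u : _ -> R) \in Lfun (domain_measure O) 2%:E.
Proof. exact: LfunP (Lp_repr u). Qed.

Lemma L2_inner_integrable (u v : L2 O) :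
  (domain_measure O).-integrable setT (EFin \o (fun x => u x * v x)).
Proof. by apply/Lfun1_integrable; apply: Lfun2_mul_Lfun1; exact: L2_Lfun. Qed.

Lemma L2_innerPr (u : L2 O) a v w :
  L2_inner u (a *: v + w) = a * L2_inner u v + L2_inner u w.
Proof.
rewrite /L2_inner -RintegralZl//; last exact: L2_inner_integrable.
rewrite -RintegralD//; last first.
- exact: L2_inner_integrable.
- exact: (integrableZl measurableT a (L2_inner_integrable u v)).
congr fine; apply: ae_eq_integral => //.
- by apply/measurable_EFinP/measurable_funM; exact: measurable_Lp_fun.
- apply/measurable_EFinP/measurable_funD; last first.
    by apply: measurable_funM; exact: measurable_Lp_fun.
  apply: measurable_funM => //.
  by apply: measurable_funM; exact: measurable_Lp_fun.
apply: filterS2 (Lp_funD (a *: v) w) (Lp_funZ a v) => x /= e1 e2 _.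
by congr EFin; rewrite e1 e2 mulrDr mulrCA.
Qed.

Lemma L2_inner_le (u v : L2 O) : `|L2_inner u v| <= `|u| * `|v|.
Proof.
have mu := measurable_Lp_fun u; have mv := measurable_Lp_fun v.
have half2 : (2^-1 + 2^-1 = 1 :> R) by lra.
have := hoelder (domain_measure O) mu mv (ltr0n R 2) (ltr0n R 2) half2.
rewrite Lnorm1 -(finite_norm_fine (Lp_repr u)) -(finite_norm_fine (Lp_repr v)).
rewrite -EFinM -lee_fin; apply: le_trans.
rewrite EFin_normr_Rintegral//; last exact: L2_inner_integrable.
apply: le_abse_integral => //.
by apply/measurable_EFinP/measurable_funM.
Qed.

Local Notation H1_pairs := (l2sum (option 'I_n) (L2 O)).

Definition H1_test : set H1_pairs :=
  [set w : H1_pairs | exists2 f, test_function O f &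
    {ae domain_measure O, forall x, w None x = f x} /\
    forall i, {ae domain_measure O, forall x, w (Some i) x = partial i f x}].

Definition H10_pred : {pred H1_pairs} := fun w => `[< closure H1_test w >].

Lemma H10_predP (w : H1_pairs) : reflect (closure H1_test w) (w \in H10_pred).
Proof. exact: asboolP. Qed.

Lemma H1_test0 : H1_test 0.
Proof.
exists 0; first exact: test_function0.
split=> [|i].
  by apply: filterS (Lp_fun0 (domain_measure O) (le1_2e R)) => x; rewrite l2sum_fun0.
apply: filterS (Lp_fun0 (domain_measure O) (le1_2e R)) => x; rewrite l2sum_fun0 => h.
by rewrite [LHS]h /partial derive_cst.
Qed.

Lemma H1_testZD a u v : H1_test u -> H1_test v -> H1_test (a *: u + v).
Proof.
move=> [f tf [uf duf]] [g tg [vg dvg]].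
have [[sf _ _] [sg _ _]] := (tf, tg).
exists (a *: f + g); first exact: test_functionZD.
split=> [|i].
  apply: filterS2 (filterI uf vg) (filterI (Lp_funD (a *: u None) (v None))
    (Lp_funZ a (u None))) => x [ufx vgx] [e1 e2].
  rewrite l2sum_funD l2sum_funZ [LHS]e1 [X in X + _]e2.
  by rewrite [X in _ * X + _]ufx [X in _ + X]vgx.
rewrite (partialZD _ _ (sf [::]) (sg [::])).
apply: filterS2 (filterI (duf i) (dvg i)) (filterI (Lp_funD (a *: u (Some i)) (v (Some i)))
  (Lp_funZ a (u (Some i)))) => x [ufx vgx] [e1 e2].
rewrite l2sum_funD l2sum_funZ [LHS]e1 [X in X + _]e2.
by rewrite [X in _ * X + _]ufx [X in _ + X]vgx.
Qed.

Let closure_test (w : H1_pairs) :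
  closure H1_test w <-> forall e, 0 < e -> exists2 z, H1_test z & `|w - z| < e.
Proof.
split=> [cw e e0|h B /nbhs_ballP[e /= e0 eB]].
  have [z [tz wz]] := cw _ (nbhsx_ballx w e e0).
  by exists z => //; move: wz; rewrite -ball_normE.
have [z tz wz] := h e e0; exists z; split => //.
by apply: eB; rewrite -ball_normE.
Qed.

Let H10_submod_closed : submod_closed H10_pred.
Proof.
split; first by apply/H10_predP; apply: subset_closure; exact: H1_test0.
move=> a u v /H10_predP/closure_test cu /H10_predP/closure_test cv.
apply/H10_predP/closure_test => e e0.
have e1 : 0 < e / 2 / (`|a| + 1) by rewrite !divr_gt0// ltr_wpDl.
have e2 : 0 < e / 2 by rewrite divr_gt0.
have [u' tu uu] := cu _ e1; have [v' tv vv] := cv _ e2.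
exists (a *: u' + v'); first exact: H1_testZD.
rewrite opprD addrACA -scalerBr (le_lt_trans (ler_normD _ _))// (splitr e).
apply: ler_ltD => //; rewrite normrZ.
apply: (@le_trans _ _ ((`|a| + 1) * `|u - u'|)).
  by rewrite ler_wpM2r// lerDl.
by rewrite mulrC -ler_pdivlMr ?ltr_wpDl// ltW.
Qed.

HB.instance Definition _ :=
  GRing.isSubmodClosed.Build R H1_pairs H10_pred H10_submod_closed.

Record H10 : Type := MkH10 { H10_val : H1_pairs; _ : H10_val \in H10_pred }.

HB.instance Definition _ := [isSub for H10_val].
HB.instance Definition _ := [Choice of H10 by <:].
HB.instance Definition _ := [SubChoice_isSubLmodule of H10 by <:].

Definition H10_norm (w : H10) : R := `|H10_val w|.

Let H10_normD u v : H10_norm (u + v) <= H10_norm u + H10_norm v.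
Proof. exact: ler_normD. Qed.

Let H10_normZ a u : H10_norm (a *: u) = `|a| * H10_norm u.
Proof. exact: normrZ. Qed.

Let H10_norm_eq0 u : H10_norm u = 0 -> u = 0.
Proof. by move=> /normr0_eq0 u0; exact: val_inj. Qed.

HB.instance Definition _ := Lmodule_isNormed.Build R H10
  H10_normD H10_normZ H10_norm_eq0.

Definition H10_fun (w : H10) : L2 O := H10_val w None.

Definition Hm1 : Type := dual H10.

HB.instance Definition _ := NormedModule.on Hm1.

Lemma L2_to_Hm1_subproof (u : L2 O) :
  (fun w : H10 => L2_inner u (H10_fun w)) \in @dual_pred R H10.
Proof.
pose F := (fun w : H10 => L2_inner u (H10_fun w)) : H10 -> R^o.
have lF : linear F.
  move=> a v w; rewrite /F -[RHS]L2_innerPr; congr L2_inner.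
  by rewrite /H10_fun /= l2sum_funD l2sum_funZ.
apply/dual_predP; split => //.
pose lF' := GRing.isLinear.Build R H10 R^o *:%R F lF.
pose G : {linear H10 -> R^o} := HB.pack F lF'.
apply/(@linear_bounded_continuous R H10 R^o G)/linear_boundedP.
exists `|u|; split; first exact: num_real.
move=> r ur w; rewrite (le_trans (L2_inner_le _ _))// ler_pM//; first exact: ltW.
rewrite [leRHS]l2sum_norm_def -[leLHS]ger0_norm// -sqrtr_sqr; apply: ler_wsqrtr.
rewrite (bigD1 None)//= lerDl; apply: sumr_ge0 => i _; exact: sqr_ge0.
Qed.

Definition L2_to_Hm1 (u : L2 O) : Hm1 := Dual (L2_to_Hm1_subproof u).


End sobolev.

Lemma lt2_le1 (R : realType) (q : \bar R) : (2%:E < q)%E -> (1 <= q)%E.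
Proof. by move=> q2; apply: le_trans (ltW q2); exact: le1_2e. Qed.

Section operators.
Context (R : realType) (n : nat) (O : lipschitz_domain R n).
Implicit Types (u v : L2 O) (E : set 'rV[R]_n).

Definition chi E v : L2 O := L2_of O (fun x => \1_E x * v x).

Definition pos_part v : L2 O := L2_of O (fun x => Num.max (v x) 0).

Definition solution_operator (q : \bar R) (q1 : (1 <= q)%E) (Y : normedModType R)
    (iota : Y -> Lp (domain_measure O) q1) (Ainv : Hm1 O -> Y) v : L2 O :=
  L2_of O (iota (Ainv (L2_to_Hm1 v))).

Definition is_adjoint (S Sadj : L2 O -> L2 O) : Prop :=
  forall u v, L2_inner (S u) v = L2_inner u (Sadj v).

Definition ae_eq_set (E F : set 'rV[R]_n) : Prop :=
  {ae domain_measure O, forall x, E x <-> F x}.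

End operators.

(* Since S_nu = A^-1 for every player nu, a single operator S stands for all the
   S_nu.  Subsets of the domain are defined through representatives of classes of
   functions, hence are relevant up to null sets only. *)
Section augmented_nash_problem.
Context (R : realType) (n : nat) (O : lipschitz_domain R n) (N : nat).
Variables (S Sadj : L2 O -> L2 O).
Variables (Om : 'I_N -> set 'rV[R]_n) (yd ua ub : 'I_N -> L2 O).
Variables (psi mu : L2 O) (alpha rho : R).

Local Notation U := (l2sum 'I_N (L2 O)).
Implicit Types (u h : U) (nu : 'I_N).

Definition state u : L2 O := \sum_nu S (u nu).

Definition multiplier_update u : L2 O := mu + rho *: (state u - psi).

Definition admissible nu (v : L2 O) : Prop :=
  {ae domain_measure O, forall x, ua nu x <= v x <= ub nu x}.

Definition replace_control u nu (v : L2 O) : U :=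
  l2sum_of (fun i => if i == nu then v else u i).

Definition augmented_cost nu u : R :=
  2^-1 * \int[domain_measure O]_(x in Om nu) ((state u - yd nu : L2 O) x ^+ 2)
  + alpha / 2 * `|u nu| ^+ 2
  + (2 * rho)^-1 * `|pos_part (multiplier_update u)| ^+ 2.

Definition nash_equilibrium u : Prop :=
  (forall nu, admissible nu (u nu)) /\
  forall nu (v : L2 O), admissible nu v ->
    augmented_cost nu u <= augmented_cost nu (replace_control u nu v).

Definition Ftilde u : U :=
  l2sum_of (fun nu => Sadj (chi (Om nu) (state u - yd nu)
                            + pos_part (multiplier_update u))).

Definition unconstrained_control u : U := - alpha^-1 *: Ftilde u.

Definition proj_admissible u : U :=
  l2sum_of (fun nu =>
    L2_of O (fun x => Num.min (Num.max (u nu x) (ua nu x)) (ub nu x))).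

Definition residual u : U := u - proj_admissible (unconstrained_control u).

Definition lower_active u nu : set 'rV[R]_n :=
  O `&` [set x | unconstrained_control u nu x <= ua nu x].

Definition upper_active u nu : set 'rV[R]_n :=
  O `&` [set x | unconstrained_control u nu x >= ub nu x].

Definition inactive u nu : set 'rV[R]_n :=
  O `&` [set x | ua nu x < unconstrained_control u nu x < ub nu x].

Definition state_active u : set 'rV[R]_n :=
  O `&` [set x | multiplier_update u x > 0].

(* The function chi_{A^a} u_a + chi_{A^b} u_b.  The two active sets meet only where
   the bounds coincide; there the common value of the bounds is counted once. *)
Definition active_part u : U :=
  l2sum_of (fun nu => chi (lower_active u nu) (ua nu)
    + chi (upper_active u nu `\` lower_active u nu) (ub nu)).

Definition chi_inactive u h : U := l2sum_of (fun nu => chi (inactive u nu) (h nu)).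

(* (chi_nu S + chi_Y rho S) h *)
Definition state_term u nu h : L2 O :=
  chi (Om nu) (state h) + chi (state_active u) (rho *: state h).

Definition newton_op u h : U :=
  l2sum_of (fun nu => alpha^-1 *: Sadj (state_term u nu h)).

Definition newton_rhs u : U :=
  l2sum_of (fun nu => - alpha^-1 *: chi (inactive u nu)
    (Sadj (state_term u nu (active_part u) - chi (Om nu) (yd nu)
           + chi (state_active u) (mu - rho *: psi)))).

Definition newton_step u u' : Prop :=
  exists2 uI : U, uI + chi_inactive u (newton_op u uI) = chi_inactive u (newton_rhs u)
                & u' = uI + active_part u.

Definition newton_iterates (u : nat -> U) : Prop :=
  forall k, newton_step (u k) (u k.+1).

Definition stopping_criterion (u_old u_new : U) : Prop :=
  (forall nu, [/\ ae_eq_set O (lower_active u_new nu) (lower_active u_old nu),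
                  ae_eq_set O (upper_active u_new nu) (upper_active u_old nu) &
                  ae_eq_set O (inactive u_new nu) (inactive u_old nu)]) /\
  ae_eq_set O (state_active u_new) (state_active u_old).

End augmented_nash_problem.

Definition superlinear_convergence (R : realType) (V : normedModType R)
    (u : nat -> V) (l : V) : Prop :=
  u @ \oo --> l /\ (fun k => `|u k.+1 - l|) =o_\oo (fun k => `|u k - l|).

(* Main.v *)
Require Import Defs.
From HB Require Import structures.
From mathcomp Require Import all_boot all_order all_algebra.
From mathcomp Require Import all_classical all_reals all_analysis.
From mathcomp Require Import measurable_realfun ess_sup_inf ring lra.

Set Implicit Arguments.
Unset Strict Implicit.
Unset Printing Implicit Defensive.
Import Order.TTheory GRing.Theory Num.Theory.
Import numFieldNormedType.Exports.
Local Open Scope classical_set_scope.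
Local Open Scope ring_scope.

(** A Newton step from [u] solves the projection equation with all active sets kept
    at [u] ([newton_stepE]). This equation is affine, and an equilibrium [ubar]
    satisfies it up to a residual [r]; subtracting, the error [e = u' - ubar] of
    the new iterate satisfies [(Id + chi_I T) e = r], where [I] and [T] depend on
    the active sets of [u]. The theorem follows from two facts.

    The systems are invertible, with a bound that does not depend on the active
    sets ([cutoff_system_bounded]): the condition on [alpha] makes [Id + T]
    coercive ([linearized_weakly_monotone]). Absorbing the coupling terms in the
    squared norm of the state, by Young's inequality, is where the factor 1/4
    comes from. Coercivity also gives solvability, by the theorem of Lax and
    Milgram ([lax_milgram]), for which the completeness of L^2 is proved along the
    way ([L2_cvg_of_geometric]).

    The residual is of lower order than [u - ubar] ([step_residual_small]). It comes
    from two nonsmooth superpositions, the positive part and the projection, and is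
    supported where the argument of one of them crosses a kink between [u] and
    [ubar]. There the argument at [ubar] differs from the kink by at most the
    perturbation, so that this set has small measure ([crossing_small]). The
    perturbation itself is the image of [u - ubar] under [S], or of a function of
    comparable size under the adjoint of [S], and on a set of small measure such
    images have small norm compared to their arguments ([absolutely_continuous]).
    For [S] this is the embedding of the state space in L^q with [q > 2]. For the
    adjoint it is, by duality, the uniform integrability of squares of functions in
    the unit ball of H^1_0, which an induction on the dimension derives from the
    fundamental theorem of calculus on lines ([energy_absolutely_continuous]).

    Hence one step from the vicinity of [ubar] gains an arbitrarily small factor
    ([newton_step_o]), which is superlinear convergence. That [ubar] solves the
    projection equation is its variational inequality, tested with the projection
    ([nash_projection]). Part b) is algebraic: if the active sets do not change, the
    affine equation just solved is the nonlinear one ([residual_eq0_of_stopping]). *)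

(** * The Hilbert space L^2 of the domain *)

Lemma rV_coord_le_norm (R : realType) (n : nat) (x : 'rV[R]_n) (i : 'I_n) :
  `|x ord0 i| <= `|x|.
Proof.
by rewrite [leRHS]/Num.norm /= mx_normrE; apply/bigmax_geP; right => /=; exists (ord0, i).
Qed.

Section L2_toolkit.
Context (R : realType) (n : nat) (O : lipschitz_domain R n).
Local Notation dm := (domain_measure O).
Implicit Types (u v w : L2 O) (E F : set 'rV[R]_n).

Lemma domain_measure_lty : (dm setT < +oo)%E.
Proof.
have [M [_ OM]] := @domain_bounded _ _ O.
pose B := [set x : 'rV[R]_n | forall i,
  (\row__ - (M + 2)) ord0 i < x ord0 i <= (\row__ (M + 2) : 'rV[R]_n) ord0 i].
have M1 : M < M + 1 by lra.
have OB : (O : set _) `<=` B.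
  move=> x Ox i; rewrite !mxE.
  have := OM _ M1 x Ox => xM.
  have : `|x ord0 i| <= M + 1 := le_trans (rV_coord_le_norm x i) xM.
  by rewrite ler_norml => /andP[? ?]; apply/andP; split; lra.
rewrite /domain_measure /= /mrestr setTI.
apply: (@le_lt_trans _ _ (lebesgue_rV R n B)).
  apply: le_measure => //; rewrite inE; last exact: measurable_rV_box.
  exact: open_measurable_rV (@domain_open _ _ O).
rewrite lebesgue_rV_box ?ltry// => i; rewrite !mxE.
have [x Ox] := @domain_nonempty _ _ O.
by have := le_trans (normr_ge0 x) (OM _ M1 x Ox); lra.
Qed.

Lemma L2_sqr_integral u : (`|u| ^+ 2)%:E = (\int[dm]_x (u x ^+ 2)%:E)%E.
Proof.
have h := @powR_Lnorm _ _ _ dm (EFin \o u) 2 (negbT (pnatr_eq0 R 2)).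
have nE : 'N[dm]_2%:E[EFin \o u]%E = `|u|%:E := esym (finite_norm_fine (Lp_repr u)).
rewrite nE poweR_EFin powR_mulrn// in h; rewrite h; apply: eq_integral => x _ /=.
by rewrite powR_mulrn// real_normK// num_real.
Qed.

Lemma L2_inner_sqr u : L2_inner u u = `|u| ^+ 2.
Proof.
by apply: EFin_inj; rewrite L2_sqr_integral /L2_inner /Rintegral fineK// -L2_sqr_integral.
Qed.

Lemma L2_innerC u v : L2_inner u v = L2_inner v u.
Proof. by apply: eq_Rintegral => x _; rewrite mulrC. Qed.

Lemma L2_inner_linear u : linear (L2_inner u : L2 O -> R^o).
Proof. by move=> a v w; exact: L2_innerPr. Qed.

Let L2_inner_lin u : {linear L2 O -> R^o} :=
  HB.pack (L2_inner u : L2 O -> R^o)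
    (GRing.isLinear.Build R (L2 O) R^o *:%R (L2_inner u : L2 O -> R^o) (L2_inner_linear u)).

Lemma L2_inner0r u : L2_inner u 0 = 0. Proof. exact: (linear0 (L2_inner_lin u)). Qed.
Lemma L2_innerNr u v : L2_inner u (- v) = - L2_inner u v.
Proof. exact: (linearN (L2_inner_lin u)). Qed.
Lemma L2_innerDr u v w : L2_inner u (v + w) = L2_inner u v + L2_inner u w.
Proof. exact: (linearD (L2_inner_lin u)). Qed.
Lemma L2_innerBr u v w : L2_inner u (v - w) = L2_inner u v - L2_inner u w.
Proof. exact: (linearB (L2_inner_lin u)). Qed.
Lemma L2_innerZr u a v : L2_inner u (a *: v) = a * L2_inner u v.
Proof. exact: (linearZ_LR (L2_inner_lin u)). Qed.
Lemma L2_inner_sumr u I (s : seq I) (P : pred I) (F : I -> L2 O) :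
  L2_inner u (\sum_(i <- s | P i) F i) = \sum_(i <- s | P i) L2_inner u (F i).
Proof. exact: (linear_sum (L2_inner_lin u)). Qed.
Lemma L2_innerNl u v : L2_inner (- v) u = - L2_inner v u.
Proof. by rewrite L2_innerC L2_innerNr L2_innerC. Qed.
Lemma L2_innerDl u v w : L2_inner (v + w) u = L2_inner v u + L2_inner w u.
Proof. by rewrite L2_innerC L2_innerDr !(L2_innerC u). Qed.
Lemma L2_innerBl u v w : L2_inner (v - w) u = L2_inner v u - L2_inner w u.
Proof. by rewrite L2_innerC L2_innerBr !(L2_innerC u). Qed.
Lemma L2_innerZl u a v : L2_inner (a *: v) u = a * L2_inner v u.
Proof. by rewrite L2_innerC L2_innerZr L2_innerC. Qed.

Lemma L2_normD_sqr u v : `|u + v| ^+ 2 = `|u| ^+ 2 + 2 * L2_inner u v + `|v| ^+ 2.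
Proof. by rewrite -!L2_inner_sqr L2_innerDl !L2_innerDr (L2_innerC v u); ring. Qed.

Lemma L2_inner_eq u v : (forall w, L2_inner u w = L2_inner v w) -> u = v.
Proof.
move=> uv; apply/eqP; rewrite -subr_eq0 -normr_eq0 -sqrf_eq0 -L2_inner_sqr.
by rewrite L2_innerBl uv subrr.
Qed.

Lemma le_L2_inner_ae u v u' v' :
  {ae dm, forall x, u x * v x <= u' x * v' x} -> L2_inner u v <= L2_inner u' v'.
Proof.
move=> uv; rewrite -subr_ge0 -RintegralB//; [|exact: L2_inner_integrable..].
pose f x := u' x * v' x - u x * v x.
have mf : measurable_fun setT f.
  by apply: measurable_funB; apply: measurable_funM; exact: measurable_Lp_fun.
rewrite (_ : \int[dm]_x _ = \int[dm]_x (Num.max (f x) 0)).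
  by apply: Rintegral_ge0 => x _; rewrite le_max lexx orbT.
congr fine; apply: ae_eq_integral => //; first exact/measurable_EFinP.
  by apply/measurable_EFinP; exact: measurable_maxr.
by apply: filterS uv => x /= uvx _; rewrite max_l// subr_ge0.
Qed.

Lemma le_L2_norm_ae u v : {ae dm, forall x, `|u x| <= `|v x|} -> `|u| <= `|v|.
Proof.
move=> uv; rewrite -(@ler_pXn2r _ 2%N) ?nnegrE ?normr_ge0// -!L2_inner_sqr.
apply: le_L2_inner_ae; apply: filterS uv => x uvx.
by rewrite -!expr2 -(real_normK (num_real (u x))) -(real_normK (num_real (v x))) lerXn2r.
Qed.

Lemma Lfun2_sqr_lty (f : 'rV[R]_n -> R) : measurable_fun setT f ->
  (\int[dm]_x (f x ^+ 2)%:E < +oo)%E -> f \in Lfun dm 2%:E.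
Proof.
move=> mf fy; rewrite inE; apply/andP; split; rewrite inE//=.
rewrite /finite_norm unlock poweR_lty//; move: fy; congr (_ < _)%E.
by apply: eq_integral => x _ /=; rewrite powR_mulrn// real_normK// num_real.
Qed.

Lemma L2_of_dominated (f : 'rV[R]_n -> R) v : measurable_fun setT f ->
  {ae dm, forall x, `|f x| <= `|v x|} -> {ae dm, forall x, L2_of O f x = f x}.
Proof.
move=> mf fv; apply: Lp_ofE; apply: Lfun2_sqr_lty => //.
rewrite (@le_lt_trans _ _ (`|v| ^+ 2)%:E) ?ltry// L2_sqr_integral.
have mv := measurable_Lp_fun v.
apply: ae_ge0_le_integral => //.
- by move=> x _; rewrite lee_fin sqr_ge0.
- by apply/measurable_EFinP; exact: measurable_funX.
- by move=> x _; rewrite lee_fin sqr_ge0.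
- by apply/measurable_EFinP; exact: measurable_funX.
apply: filterS fv => x fvx _; rewrite lee_fin.
by rewrite -(real_normK (num_real (f x))) -(real_normK (num_real (v x))) lerXn2r.
Qed.

Lemma Lp_funN u : {ae dm, forall x, (- u) x = - u x}.
Proof. by rewrite -scaleN1r; apply: filterS (Lp_funZ (-1) u) => x ->; rewrite mulN1r. Qed.

Lemma Lp_funB u v : {ae dm, forall x, (u - v) x = u x - v x}.
Proof. by apply: filterS2 (Lp_funD u (- v)) (Lp_funN v) => x -> ->. Qed.

Section chi.
Variables (E : set 'rV[R]_n) (mE : measurable E).

Lemma chiE v : {ae dm, forall x, chi E v x = \1_E x * v x}.
Proof.
apply: (@L2_of_dominated _ v).
  by apply: measurable_funM => //; exact: measurable_Lp_fun.
apply: aeW => x; rewrite indicE normrM; case: (x \in E) => /=.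
  by rewrite normr1 mul1r.
by rewrite normr0 mul0r.
Qed.

Lemma chi_is_linear : linear (chi E : L2 O -> L2 O).
Proof.
move=> a u v; apply/Lp_eqP.
apply: filter_app (filterI (chiE u) (filterI (chiE v) (chiE (a *: u + v)))).
apply: filter_app (filterI (Lp_funD (a *: u) v) (Lp_funZ a u)).
apply: filter_app (filterI (Lp_funD (a *: chi E u) (chi E v)) (Lp_funZ a (chi E u))).
by apply: aeW => x [-> ->] [e3 e4] [-> [-> ->]]; rewrite e3 e4; ring.
Qed.

Let chi_lin : {linear L2 O -> L2 O} :=
  HB.pack (chi E : L2 O -> L2 O)
    (GRing.isLinear.Build R (L2 O) (L2 O) *:%R (chi E : L2 O -> L2 O) chi_is_linear).

Lemma chi0 : chi E 0 = 0 :> L2 O. Proof. exact: (linear0 chi_lin). Qed.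
Lemma chiD u v : chi E (u + v) = chi E u + chi E v.
Proof. exact: (linearD chi_lin). Qed.
Lemma chiB u v : chi E (u - v) = chi E u - chi E v.
Proof. exact: (linearB chi_lin). Qed.
Lemma chiZ a v : chi E (a *: v) = a *: chi E v.
Proof. exact: (linearZ_LR chi_lin). Qed.

Lemma norm_chi_le v : `|chi E v| <= `|v|.
Proof.
apply: le_L2_norm_ae; apply: filterS (chiE v) => x ->.
rewrite indicE normrM; case: (x \in E) => /=; first by rewrite normr1 mul1r.
by rewrite normr0 mul0r.
Qed.
End chi.

Lemma L2_inner_chi E u v : measurable E -> L2_inner (chi E u) v = L2_inner u (chi E v).
Proof.
move=> mE; apply/eqP; rewrite eq_le; apply/andP; split; apply: le_L2_inner_ae;
apply: filterS2 (chiE mE u) (chiE mE v) => x -> ->; by rewrite mulrA (mulrC (u x)).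
Qed.

Lemma chi_chi E F v : measurable E -> measurable F ->
  chi E (chi F v) = chi (E `&` F) v.
Proof.
move=> mE mF; have mEF := measurableI _ _ mE mF; apply/Lp_eqP.
apply: filter_app (chiE mE (chi F v)); apply: filterS2 (chiE mF v) (chiE mEF v).
by move=> x -> -> ->; rewrite indicI mulrA.
Qed.

Lemma L2_inner_chi_sqr E v : measurable E -> L2_inner (chi E v) v = `|chi E v| ^+ 2.
Proof. by move=> mE; rewrite -L2_inner_sqr -(L2_inner_chi (chi E v))// chi_chi// setIid. Qed.

End L2_toolkit.

(** * Energy and one-dimensional slices *)

Section slices.
Context (R : realType).
Local Notation leb := (@lebesgue_measure R).

(** The fundamental theorem of calculus for [f ^+ 2], started at a point where
    [f] vanishes, and [2 |f f'| <= f^2 + f'^2]: on a line, the energy bounds the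
    function uniformly. *)
Lemma sqr_le_integral_sqrD (f : R -> R) (M : R) :
  (forall x, derivable f x 1) -> continuous f -> continuous (derive1 f) ->
  (forall x, M <= `|x| -> f x = 0) -> forall x,
  ((f x ^+ 2)%:E <= \int[leb]_s (f s ^+ 2 + derive1 f s ^+ 2)%:E)%E.
Proof.
move=> df cf cdf fM x.
(* A point to the left of [x] and of the support of [f]. *)
pose a := - (Num.max M `|x| + 1).
have ax : a < x.
  have : - Num.max M `|x| <= x.
    by rewrite lerNl (le_trans (ler_norm _))// normrN le_max lexx orbT.
  by rewrite /a; lra.
have fa : f a = 0.
  apply: fM; rewrite /a normrN ger0_norm; last first.
    by rewrite addr_ge0// le_max normr_ge0 orbT.
  by rewrite (@le_trans _ _ (Num.max M `|x|))// ?le_max ?lexx// lerDl.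
pose F s := f s ^+ 2; pose dF s := 2 * f s * derive1 f s.
have F' s : is_derive s (1 : R) F (dF s).
  have h := DeriveDef (df s) (esym (derive1E f s)).
  have := is_deriveX 2 h; rewrite /dF => h2.
  by apply: is_derive_eq h2 _; rewrite /GRing.scale /= expr1; ring.
have cdF : continuous dF.
  move=> s; apply: cvgM; last exact: cdf.
  by apply: cvgM; [exact: cvg_cst|exact: cf].
have cF : continuous F by move=> s; apply: cvgM; exact: cf.
have := @continuous_FTC2 R dF F a x ax.
have /[swap]/[apply] : {within `[a, x], continuous dF}.
  by apply: continuous_subspaceT.
have d1 : derivable_oo_LRcontinuous F a x.
  split; first by move=> s _; exact: @ex_derive _ _ _ _ _ _ _ (F' s).
    by apply: cvg_at_right_filter; exact: cF.
  by apply: cvg_at_left_filter; exact: cF.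
move=> /(_ d1); have d2 : {in `]a, x[, derive1 F =1 dF}.
  by move=> s _; rewrite derive1E; exact: (@derive_val _ _ _ _ _ _ _ (F' s)).
move=> /(_ d2); rewrite {2}/F fa expr0n/= sube0 => FE.
rewrite -[(f x ^+ 2)%:E]/(F x)%:E -FE.
have mf : measurable_fun setT f := continuous_measurable_fun cf.
have mdf : measurable_fun setT (derive1 f) := continuous_measurable_fun cdf.
have mdF : measurable_fun setT dF := continuous_measurable_fun cdF.
have mG : measurable_fun setT (fun s => (f s ^+ 2 + derive1 f s ^+ 2)%:E).
  by apply/measurable_EFinP; apply: measurable_funD; exact: measurable_funX.
apply: (@le_trans _ _ (\int[leb]_(s in `[a, x]) `|(dF s)%:E|)%E).
  rewrite (le_trans (lee_abs _))// le_abse_integral//.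
  by apply: measurable_funTS; exact/measurable_EFinP.
apply: (@le_trans _ _ (\int[leb]_(s in `[a, x]) (f s ^+ 2 + derive1 f s ^+ 2)%:E)%E).
  apply: ge0_le_integral => //.
  - by apply: measurableT_comp => //; apply: measurable_funTS; exact/measurable_EFinP.
  - exact: measurable_funTS.
  move=> s _; rewrite /dF /= lee_fin ler_norml.
  have := sqr_ge0 (f s + derive1 f s); have := sqr_ge0 (f s - derive1 f s).
  by move=> h1 h2; apply/andP; split; nra.
apply: ge0_subset_integral => //.
by move=> s _; rewrite lee_fin addr_ge0 ?sqr_ge0.
Qed.

Lemma continuous_rV_measurable n (f : 'rV[R]_n -> R) :
  continuous f -> measurable_fun setT f.
Proof.
move=> /continuousP cf; apply: (measurability _ (RGenOpens.measurableE R)).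
move=> _ [_ [a [b ->] <-]]; rewrite setTI; apply: open_measurable_rV.
exact/cf/interval_open.
Qed.

Lemma integral_rV_cons12 n (g : 'rV[R]_n.+1 -> \bar R) :
  measurable_fun setT g -> (forall x, 0 <= g x)%E ->
  (\int[lebesgue_rV R n.+1]_x g x =
   \int[leb]_s \int[lebesgue_rV R n]_y g (rV_cons (s, y)))%E.
Proof.
move=> mg g0; rewrite /= /lebesgue_rV_cons.
rewrite (ge0_integral_pushforward (@measurable_rV_cons R n))// preimage_setT.
rewrite (@fubini_tonelli1 _ _ _ _ _ leb (lebesgue_rV R n) (g \o @rV_cons R n))//.
  exact: (measurableT_comp mg (@measurable_rV_cons R n)).
by move=> x; exact: g0.
Qed.

Lemma integral_rV_cons21 n (g : 'rV[R]_n.+1 -> \bar R) :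
  measurable_fun setT g -> (forall x, 0 <= g x)%E ->
  (\int[lebesgue_rV R n.+1]_x g x =
   \int[lebesgue_rV R n]_y \int[leb]_s g (rV_cons (s, y)))%E.
Proof.
move=> mg g0; rewrite /= /lebesgue_rV_cons.
rewrite (ge0_integral_pushforward (@measurable_rV_cons R n))// preimage_setT.
rewrite (@fubini_tonelli2 _ _ _ _ _ leb (lebesgue_rV R n) (g \o @rV_cons R n))//.
  exact: (measurableT_comp mg (@measurable_rV_cons R n)).
by move=> x; exact: g0.
Qed.

Lemma measurable_slicer n (g : 'rV[R]_n.+1 -> \bar R) (s : R) :
  measurable_fun setT g -> measurable_fun setT (fun y : 'rV[R]_n => g (rV_cons (s, y))).
Proof.
move=> mg; apply: (measurableT_comp mg).
exact: (measurableT_comp (@measurable_rV_cons R n) (measurable_pair1 s)).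
Qed.

Lemma measurable_slicel n (g : 'rV[R]_n.+1 -> \bar R) (y : 'rV[R]_n) :
  measurable_fun setT g -> measurable_fun setT (fun s : R => g (rV_cons (s, y))).
Proof.
move=> mg; apply: (measurableT_comp mg).
exact: (measurableT_comp (@measurable_rV_cons R n) (measurable_pair2 y)).
Qed.

Lemma measurable_integral_slicer n (g : 'rV[R]_n.+1 -> \bar R) :
  measurable_fun setT g -> (forall x, 0 <= g x)%E ->
  measurable_fun setT (fun s => \int[lebesgue_rV R n]_y g (rV_cons (s, y)))%E.
Proof.
move=> mg g0.
apply: (@measurable_fun_fubini_tonelli_F _ _ _ _ _ (lebesgue_rV R n) (g \o @rV_cons R n)).
  exact: (measurableT_comp mg (@measurable_rV_cons R n)).
by move=> x; exact: g0.
Qed.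

Lemma measurable_integral_slicel n (g : 'rV[R]_n.+1 -> \bar R) :
  measurable_fun setT g -> (forall x, 0 <= g x)%E ->
  measurable_fun setT (fun y => \int[leb]_s g (rV_cons (s, y)))%E.
Proof.
move=> mg g0.
apply: (@measurable_fun_fubini_tonelli_G _ _ _ _ _ leb (g \o @rV_cons R n)).
  exact: (measurableT_comp mg (@measurable_rV_cons R n)).
by move=> x; exact: g0.
Qed.

(** Only the partial derivatives along the axes are recorded, and the support is
    bounded in each coordinate: both survive the restriction to a slice. *)
Definition C1c n (f : 'rV[R]_n -> R) : Prop :=
  [/\ continuous f, forall i, continuous (partial i f),
      forall i x, derivable f x (delta_mx ord0 i) &
      exists M : R, forall (x : 'rV[R]_n) i, M <= `|x ord0 i| -> f x = 0].

(** The integrand of the squared H^1 norm. *)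
Definition energy n (f : 'rV[R]_n -> R) (x : 'rV[R]_n) : R :=
  f x ^+ 2 + \sum_i partial i f x ^+ 2.

Lemma energy_ge0 n (f : 'rV[R]_n -> R) x : 0 <= energy f x.
Proof. by rewrite addr_ge0 ?sqr_ge0// sumr_ge0// => i _; rewrite sqr_ge0. Qed.

Lemma measurable_energy n (f : 'rV[R]_n -> R) : C1c f -> measurable_fun setT (energy f).
Proof.
move=> [cf cdf _ _]; apply: measurable_funD.
  by apply: measurable_funX; exact: continuous_rV_measurable.
apply: measurable_sum => i; apply: measurable_funX.
exact: continuous_rV_measurable.
Qed.

Lemma continuous_rV_consl n (y : 'rV[R]_n) : continuous (fun s : R => rV_cons (s, y)).
Proof.
move=> s; apply/cvg_ballP => e e0; apply: filterS (nbhsx_ballx s e e0) => z sz.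
by split=> // i j; rewrite !mxE; case: unliftP => [k|] _ //=; exact: ballxx.
Qed.

Lemma continuous_rV_consr n (s : R) : continuous (fun y : 'rV[R]_n => rV_cons (s, y)).
Proof.
move=> y B /nbhs_ballP[e e0 eB]; apply/nbhs_ballP; exists e => //= z [_ yz].
apply: eB; split=> // i j; rewrite !mxE; case: unliftP => [k|] _ /=; last exact: ballxx.
exact: (yz ord0 k).
Qed.

(** A directional derivative depends only on the restriction to a line, hence
    passes to the slices of a function. *)
Lemma derive_line (V V' : normedModType R) (f : V -> R) (f' : V' -> R) a v a' v' :
  (forall h : R, f (h *: v + a) = f' (h *: v' + a')) ->
  (derivable f a v -> derivable f' a' v') /\ 'D_v f a = 'D_v' f' a'.
Proof.
move=> ff'; suff E : (fun h : R => h^-1 *: ((f \o shift a) (h *: v) - f a)) =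
    (fun h : R => h^-1 *: ((f' \o shift a') (h *: v') - f' a')).
  by rewrite /derivable /derive E.
have := ff' 0; rewrite !scale0r !add0r => ->.
by apply/funext => h /=; rewrite ff'.
Qed.

Lemma continuous_slicer n (g : 'rV[R]_n.+1 -> R) (s : R) :
  continuous g -> continuous (fun y : 'rV[R]_n => g (rV_cons (s, y))).
Proof.
move=> cg y; apply: (@continuous_comp _ _ _ (fun y => rV_cons (s, y)) g); last exact: cg.
exact: continuous_rV_consr.
Qed.

Lemma continuous_slicel n (g : 'rV[R]_n.+1 -> R) (y : 'rV[R]_n) :
  continuous g -> continuous (fun s : R => g (rV_cons (s, y))).
Proof.
move=> cg s; apply: (@continuous_comp _ _ _ (fun s : R => rV_cons (s, y)) g); last exact: cg.
exact: continuous_rV_consl.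
Qed.

Lemma rV_consDl n (h s : R) (y : 'rV[R]_n) :
  rV_cons (h *: 1 + s, y) = h *: delta_mx ord0 ord0 + rV_cons (s, y).
Proof.
apply/rowP => i; rewrite !mxE; case: unliftP => [j|] -> /=.
  by rewrite /= mulr0 add0r.
by [].
Qed.

Lemma rV_consDr n (h s : R) (y : 'rV[R]_n) i :
  rV_cons (s, h *: delta_mx ord0 i + y) =
  h *: delta_mx ord0 (lift ord0 i) + rV_cons (s, y).
Proof.
apply/rowP => j; rewrite !mxE; case: unliftP => [k|] -> /=.
  by rewrite !mxE (inj_eq (@lift_inj _ _)).
by rewrite /= mulr0 add0r.
Qed.

Section slice_of_C1c.
Variables (n : nat) (f : 'rV[R]_n.+1 -> R).
Hypothesis Cf : C1c f.

Lemma partial_rV_consl (y : 'rV[R]_n) (s : R) :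
  derive1 (fun s => f (rV_cons (s, y))) s = partial ord0 f (rV_cons (s, y)).
Proof.
by rewrite derive1E; apply: (derive_line _).2 => h; rewrite rV_consDl.
Qed.

Lemma partial_rV_consr (s : R) (y : 'rV[R]_n) i :
  partial i (fun y => f (rV_cons (s, y))) y = partial (lift ord0 i) f (rV_cons (s, y)).
Proof.
by apply: (derive_line _).2 => h; rewrite rV_consDr.
Qed.

Lemma C1c_slice (s : R) : C1c (fun y => f (rV_cons (s, y))).
Proof.
have [cf cdf df [M fM]] := Cf; split.
- exact: continuous_slicer.
- move=> i; rewrite (_ : partial i _ = fun y => partial (lift ord0 i) f (rV_cons (s, y))).
    exact: continuous_slicer.
  by apply/funext => y; exact: partial_rV_consr.
- move=> i y; have := df (lift ord0 i) (rV_cons (s, y)).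
  by apply: (derive_line _).1 => h; rewrite rV_consDr.
- exists M => y i My; apply: (fM _ (lift ord0 i)).
  by rewrite mxE liftK.
Qed.

Lemma energy_rV_cons (s : R) (y : 'rV[R]_n) :
  energy f (rV_cons (s, y)) =
  energy (fun y => f (rV_cons (s, y))) y + partial ord0 f (rV_cons (s, y)) ^+ 2.
Proof.
rewrite /energy big_ord_recl addrA addrAC; congr (_ + _ + _).
by apply: eq_bigr => i _; rewrite partial_rV_consr.
Qed.

(** The right-hand side does not depend on [s0], so that it can be integrated over
    a short piece of the line at the price of the length of that piece. *)
Lemma sqr_le_integral_line (s0 : R) (y : 'rV[R]_n) :
  ((f (rV_cons (s0, y)) ^+ 2)%:E <= \int[leb]_s (energy f (rV_cons (s, y)))%:E)%E.
Proof.
have [cf cdf df [M fM]] := Cf.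
pose phi s := f (rV_cons (s, y)).
have dphi : derive1 phi = fun s => partial ord0 f (rV_cons (s, y)).
  by apply/funext => s; exact: partial_rV_consl.
have cphi : continuous phi.
  exact: continuous_slicel.
have cdphi : continuous (derive1 phi).
  rewrite dphi; exact: continuous_slicel.
have dphi1 s : derivable phi s 1.
  have := df ord0 (rV_cons (s, y)).
  by apply: (derive_line _).1 => h; rewrite /phi rV_consDl.
have phiM s : M <= `|s| -> phi s = 0.
  by move=> Ms; apply: (fM _ ord0); rewrite mxE unlift_none.
apply: le_trans (sqr_le_integral_sqrD dphi1 cphi cdphi phiM s0) _.
have mE : measurable_fun setT (fun s => energy f (rV_cons (s, y))).
  apply: measurable_funD; first exact: (measurable_funX 2 (continuous_measurable_fun cphi)).
  apply: measurable_sum => i; apply: measurable_funX.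
  by apply: continuous_measurable_fun; exact: (continuous_slicel (cdf i)).
have mphi : measurable_fun setT (fun s => phi s ^+ 2 + derive1 phi s ^+ 2).
  apply: measurable_funD.
    exact: (measurable_funX 2 (continuous_measurable_fun cphi)).
  exact: (measurable_funX 2 (continuous_measurable_fun cdphi)).
apply: ge0_le_integral => //.
- by move=> s _; rewrite lee_fin addr_ge0 ?sqr_ge0.
- exact/measurable_EFinP.
- exact/measurable_EFinP.
move=> s _; rewrite lee_fin dphi /energy big_ord_recl addrA lerDl.
by apply: sumr_ge0 => i _; exact: sqr_ge0.
Qed.
End slice_of_C1c.

End slices.

Section energy.
Context (R : realType).
Local Notation leb := (@lebesgue_measure R).

(** The squares of functions of bounded energy are uniformly integrable, in every
    dimension. By induction on the dimension, slicing along the first coordinate: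
    the lines that meet [E] in a long piece stand on a set of small measure, and
    there the induction hypothesis applies to the slices orthogonal to them; on
    every other line [f ^+ 2] is at most the energy of the line, and is integrated
    over a short piece only. *)
Lemma energy_absolutely_continuous n (e : R) : 0 < e -> exists2 d : R, 0 < d &
  forall (f : 'rV[R]_n -> R) (E : set 'rV[R]_n), C1c f -> measurable E ->
  (lebesgue_rV R n E <= d%:E)%E ->
  (\int[lebesgue_rV R n]_x (\1_E x * f x ^+ 2)%:E <=
   e%:E * \int[lebesgue_rV R n]_x (energy f x)%:E)%E.
Proof.
elim: n e => [|n IH] e e0.
(* The measure on the one-point space is a Dirac mass: below 1 it is 0. *)
  exists (Num.min e 2^-1); first by rewrite lt_min e0 invr_gt0 ltr0n.
  move=> f E Cf mE /=; rewrite !integral_dirac//=; last 2 first.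
  - by apply/measurable_EFinP; exact: measurable_energy.
  - apply/measurable_EFinP/measurable_funM => //; apply: measurable_funX.
    by case: Cf => cf _ _ _; exact: continuous_rV_measurable.
  rewrite diracE; have [E0|E0] := boolP (0 \in E).
    by rewrite lee_fin le_min => /andP[_ h]; exfalso; move: h => /=; lra.
  rewrite diracT !mul1e indicE (negbTE E0) mul0r -EFinM lee_fin.
  by move=> _; rewrite lee_fin mulr_ge0 ?energy_ge0// ltW.
have e2 : 0 < e / 2 by rewrite divr_gt0.
have [d d0 IHd] := IH _ e2; exists (e / 2 * d); first exact: mulr_gt0.
move=> f E Cf mE Ed.
have [cf cdf df _] := Cf.
have mf : measurable_fun setT f := continuous_rV_measurable cf.
pose F := @rV_cons R n @^-1` E.
have mF : measurable F by rewrite -[F]setTI; exact: measurable_rV_cons.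
pose A := leb \o ysection F.
have mA : measurable_fun setT A := measurable_fun_ysection leb mF.
have A0 y : (0 <= A y)%E by exact: measure_ge0.
(* The feet of the lines with a long piece in [E]; the inequality of Markov makes
   this set small enough for the induction hypothesis. *)
pose E' := [set y : 'rV[R]_n | ((e / 2)%:E <= A y)%E].
have mE' : measurable E'.
  rewrite -[E']setTI; exact: emeasurable_fun_c_infty.
have leb_E : (lebesgue_rV R n.+1 E = \int[lebesgue_rV R n]_y A y)%E.
  rewrite -(setIT E) -integral_indic// integral_rV_cons21//; last exact/measurable_EFinP.
  apply: eq_integral => y _; rewrite /A /= -(setIT (ysection F y)).
  rewrite -integral_indic//; last exact: measurable_ysection.
  by apply: eq_integral => s _; rewrite !indicE mem_ysection.
have E'd : (lebesgue_rV R n E' <= d%:E)%E.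
  have := @le_integral_comp_abse _ _ _ (lebesgue_rV R n) setT measurableT A (e / 2)
    id (@measurable_id _ _ _) (fun r h => h) (fun x y _ _ h => h) mA e2.
  rewrite setTI (_ : [set x | _] = E'); last first.
    by apply/seteqP; split => y /=; rewrite gee0_abs.
  under eq_integral => y _ do rewrite gee0_abs//.
  by rewrite -leb_E => /le_trans/(_ Ed); rewrite (EFinM (e / 2) d) /= lee_pmul2l// lte_fin.
pose tail (x : 'rV[R]_n.+1) := (rV_uncons x).2.
have mtail : measurable_fun setT tail.
  exact: (measurableT_comp measurable_snd (@measurable_rV_uncons R n)).
have tailE s y : tail (rV_cons (s, y)) = y by rewrite /tail rV_consK.
have m1E' : measurable_fun setT (fun x => \1_E' (tail x) : R).
  by apply: (measurableT_comp (f := (\1_E' : _ -> R))).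
have m1E'C : measurable_fun setT (fun x => \1_(~` E') (tail x) : R).
  apply: (measurableT_comp (f := (\1_(~` E') : _ -> R))) => //.
  exact/measurable_indic/measurableC.
have mf2 := measurable_funX 2 mf.
pose h1 x : R := \1_E' (tail x) * f x ^+ 2.
pose h2 x : R := \1_(~` E') (tail x) * (\1_E x * f x ^+ 2).
have mh1 : measurable_fun setT h1 by exact: measurable_funM.
have mh2 : measurable_fun setT h2.
  by apply: measurable_funM => //; apply: measurable_funM.
have h10 x : 0 <= h1 x by rewrite mulr_ge0 ?sqr_ge0.
have h20 x : 0 <= h2 x by apply: mulr_ge0 => //; apply: mulr_ge0 => //; exact: sqr_ge0.
have mEn : measurable_fun setT (energy f) := measurable_energy Cf.
have En0 := energy_ge0 f.
apply: (@le_trans _ _ (\int[lebesgue_rV R n.+1]_x ((h1 x)%:E + (h2 x)%:E)))%E.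
  apply: ge0_le_integral => //.
  - by move=> x _; rewrite lee_fin mulr_ge0 ?sqr_ge0.
  - by apply/measurable_EFinP; apply: measurable_funM.
  - by apply: emeasurable_funD; exact/measurable_EFinP.
  move=> x _; rewrite -EFinD lee_fin /h1 /h2 !indicE in_setC.
  have := sqr_ge0 (f x); case: (tail x \in E'); case: (x \in E) => /=; lra.
rewrite ge0_integralD//; last 4 first.
- by move=> x _; rewrite lee_fin.
- exact/measurable_EFinP.
- by move=> x _; rewrite lee_fin.
- exact/measurable_EFinP.
have -> : e%:E = ((e / 2)%:E + (e / 2)%:E)%E by rewrite -EFinD -splitr.
have intE0 : (0 <= \int[lebesgue_rV R n.+1]_x (energy f x)%:E)%E.
  by apply: integral_ge0 => x _; rewrite lee_fin.
have mEnE : measurable_fun setT (EFin \o energy f) by exact/measurable_EFinP.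
have EnE0 x : (0 <= (EFin \o energy f) x)%E by rewrite lee_fin.
have mh1E : measurable_fun setT (EFin \o h1) by exact/measurable_EFinP.
have mh2E : measurable_fun setT (EFin \o h2) by exact/measurable_EFinP.
have h1E0 x : (0 <= (EFin \o h1) x)%E by rewrite lee_fin.
have h2E0 x : (0 <= (EFin \o h2) x)%E by rewrite lee_fin.
have e20 : (0 <= (e / 2)%:E)%E by rewrite lee_fin ltW.
rewrite ge0_muleDl//; apply: leeD.
  rewrite (integral_rV_cons12 mh1E h1E0) (integral_rV_cons12 mEnE EnE0).
  have mI := measurable_integral_slicer mEnE EnE0.
  have I0 s : (0 <= \int[lebesgue_rV R n]_y (EFin \o energy f) (rV_cons (s, y)))%E.
    by apply: integral_ge0.
  rewrite -ge0_integralZl//.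
  apply: ge0_le_integral => //.
  - by move=> s _; apply: integral_ge0.
  - exact: measurable_integral_slicer.
  - exact: measurable_funeM.
  move=> s _; apply: le_trans.
    under eq_integral => y _ do rewrite /= /h1 tailE.
    exact: (IHd _ _ (C1c_slice Cf s) mE' E'd).
  apply: lee_wpmul2l; first by rewrite lee_fin ltW.
  apply: ge0_le_integral => //.
  - by move=> y _; rewrite lee_fin energy_ge0.
  - by apply/measurable_EFinP; exact: measurable_energy (C1c_slice Cf s).
  - exact: measurable_slicer.
  by move=> y _; rewrite lee_fin energy_rV_cons// lerDl sqr_ge0.
rewrite (integral_rV_cons21 mh2E h2E0) (integral_rV_cons21 mEnE EnE0).
have mI := measurable_integral_slicel mEnE EnE0.
have I0 y : (0 <= \int[leb]_s (EFin \o energy f) (rV_cons (s, y)))%E.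
  by apply: integral_ge0.
rewrite -ge0_integralZl//.
apply: ge0_le_integral => //.
- by move=> y _; apply: integral_ge0.
- exact: measurable_integral_slicel.
- exact: measurable_funeM.
move=> y _; have [yE'|yE'] := boolP (y \in E').
  rewrite integral0_eq; first by rewrite mule_ge0.
  by move=> s _; rewrite /= /h2 tailE indicE in_setC yE' mul0r.
apply: (@le_trans _ _ (\int[leb]_s ((\1_(ysection F y) s)%:E *
    \int[leb]_t (EFin \o energy f) (rV_cons (t, y))))%E).
  apply: ge0_le_integral => //.
  - exact: measurable_slicel.
  - apply: emeasurable_funM => //; apply/measurable_EFinP/measurable_indic.
    exact: measurable_ysection.
  move=> s _; rewrite /= /h2 tailE !indicE in_setC yE' /= mul1r mem_ysection.
  rewrite -[(s, y) \in F]/(rV_cons (s, y) \in E).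
  case: (rV_cons (s, y) \in E); last by rewrite mul0r mul0e.
  by rewrite mul1r mul1e; exact: sqr_le_integral_line.
rewrite ge0_integralZr//; last first.
  by apply/measurable_EFinP/measurable_indic; exact: measurable_ysection.
rewrite integral_indic//; last exact: measurable_ysection.
rewrite setIT; apply: lee_wpmul2r => //.
by move: yE'; rewrite notin_setE /E' /= => /negP; rewrite -ltNge => /ltW.
Qed.

End energy.

(** * Uniform integrability in H^1_0 *)

Lemma l2sum_norm_ge (R : realType) (I : finType) (V : normedModType R) (u : l2sum I V) i :
  `|u i| <= `|u|.
Proof.
rewrite l2sum_norm_def -[leLHS]ger0_norm// -sqrtr_sqr; apply: ler_wsqrtr.
by rewrite (bigD1 i)//= lerDl; apply: sumr_ge0 => j _; exact: sqr_ge0.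
Qed.

Section H10_energy.
Context (R : realType) (n : nat) (O : lipschitz_domain R n).
Local Notation dm := (domain_measure O).
Local Notation leb := (lebesgue_rV R n).

Lemma measurable_domain : measurable (domain_set O).
Proof. exact: open_measurable_rV (@domain_open _ _ O). Qed.

Lemma domain_measureE (E : set 'rV[R]_n) : dm E = leb (E `&` O).
Proof. by []. Qed.

Lemma integral_domain_measure (g : 'rV[R]_n -> \bar R) :
  measurable_fun setT g -> (forall x, 0 <= g x)%E -> (forall x, ~ domain_set O x -> g x = 0%E) ->
  (\int[dm]_x g x = \int[leb]_x g x)%E.
Proof.
move=> mg g0 gO; have mO := measurable_domain.
have mOC : measurable (~` domain_set O) by exact: measurableC.
pose m2 := mrestr leb mOC.
have -> : (\int[leb]_x g x = \int[measure_add dm m2]_x g x)%E.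
  apply: eq_measure_integral => A mA _.
  transitivity (measure_add dm m2 A); last by [].
  rewrite measure_addE /m2 /= /mrestr -measureU.
  - by rewrite -setIUr setUv setIT.
  - exact: measurableI.
  - exact: measurableI.
  - by rewrite setIACA setICr setI0.
rewrite ge0_integral_measure_add// [X in (_ + X)%E](_ : _ = 0%E) ?adde0//.
rewrite (ae_eq_integral (cst 0%E))// ?integral0//.
exists (domain_set O); split => //; first by rewrite /m2 /= /mrestr setICr measure0.
by move=> x /= h; apply: contrapT => Ox; apply: h => _; exact: gO.
Qed.

Lemma C1c_test_function f : test_function O f -> C1c f.
Proof.
move=> [sf cf _]; split.
- by move=> x; exact: differentiable_continuous (sf [::] x).
- by move=> i x; exact: differentiable_continuous (sf [:: i] x).
- by move=> i x; exact: diff_derivable (sf [::] x).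
have [M [_ supM]] := compact_bounded cf.
exists (M + 2) => x i xM; apply: contrapT => /eqP fx.
have := supM (M + 1); rewrite ltrDl ltr01 => /(_ isT x).
have cx : closure [set x | f x != 0] x by exact: subset_closure.
move=> /(_ cx) xM1.
by have := le_trans xM (le_trans (rV_coord_le_norm x i) xM1); lra.
Qed.

Lemma partial_out_support (f : 'rV[R]_n -> R) i x :
  ~ closure [set x | f x != 0] x -> partial i f x = 0.
Proof.
move=> cx; rewrite /partial (@near_eq_derive _ _ _ f (cst 0)) ?derive_cst//.
have : open (~` closure [set x | f x != 0]) by exact/closed_openC/closed_closure.
rewrite openE => /(_ x cx); apply: filterS => y cy.
by apply: contrapT => /eqP fy; apply: cy; exact: subset_closure.
Qed.

Lemma sum_option (F : option 'I_n -> R) : \sum_i F i = F None + \sum_i F (Some i).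
Proof.
rewrite (bigD1 None)//=; congr (_ + _).
rewrite (@reindex_omap _ _ _ _ _ Some id); last by case.
by apply: eq_bigl => i; rewrite /= eqxx.
Qed.

(** A test pair of the definition of H^1_0 carries the energy of its function. *)
Lemma integral_energy (z : l2sum (option 'I_n) (L2 O)) f : C1c f ->
  {ae dm, forall x, z None x = f x} ->
  (forall i, {ae dm, forall x, z (Some i) x = partial i f x}) ->
  (\int[dm]_x (energy f x)%:E = (`|z| ^+ 2)%:E)%E.
Proof.
move=> Cf zf zdf; have [cf cdf _ _] := Cf.
have mp i : measurable_fun setT (fun x => partial i f x ^+ 2).
  exact: (measurable_funX 2 (continuous_rV_measurable (cdf i))).
have mf : measurable_fun setT (fun x => f x ^+ 2).
  exact: (measurable_funX 2 (continuous_rV_measurable cf)).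
have L2E (u : L2 O) (g : 'rV[R]_n -> R) : measurable_fun setT (fun x => g x ^+ 2) ->
    {ae dm, forall x, u x = g x} ->
    (\int[dm]_x (g x ^+ 2)%:E = (`|u| ^+ 2)%:E)%E.
  move=> mg ug; rewrite L2_sqr_integral; apply: ae_eq_integral => //.
  - exact/measurable_EFinP.
  - by apply/measurable_EFinP/measurable_funX; exact: measurable_Lp_fun.
  - by apply: filterS ug => x /= -> _.
rewrite [X in (X ^+ 2)%:E]l2sum_norm_def sqr_sqrtr; last first.
  by apply: sumr_ge0 => i _; exact: sqr_ge0.
rewrite sum_option EFinD -(L2E _ _ mf zf).
rewrite -sumEFin.
under [X in (_ = _ + X)%E]eq_bigr => i _ do rewrite -(L2E _ _ (mp i) (zdf i)).
rewrite -ge0_integral_sum//; last 2 first.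
- by move=> i; exact/measurable_EFinP.
- by move=> i x _; rewrite lee_fin sqr_ge0.
rewrite -ge0_integralD//.
- by apply: eq_integral => x _; rewrite sumEFin -EFinD.
- by move=> x _; rewrite lee_fin sqr_ge0.
- exact/measurable_EFinP.
- by move=> x _; apply: sume_ge0 => i _; rewrite lee_fin sqr_ge0.
- by apply: emeasurable_sum => i; exact/measurable_EFinP.
Qed.

(** For test functions this is the energy estimate, as they extend by zero to the
    whole space. It passes to the closure H^1_0 because [chi E] does not increase
    the norm. *)
Lemma H10_absolutely_continuous (e : R) : 0 < e -> exists2 d : R, 0 < d &
  forall E : set 'rV[R]_n, measurable E -> (dm E <= d%:E)%E ->
  forall w : H10 O, `|chi E (H10_fun w)| <= e * `|w|.
Proof.
move=> e0; have [d d0 hd] := energy_absolutely_continuous n (mulr_gt0 e0 e0).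
exists d => // E mE Ed.
have test (z : l2sum (option 'I_n) (L2 O)) : H1_test z -> `|chi E (z None)| <= e * `|z|.
  move=> [f tf [zf zdf]]; have Cf := C1c_test_function tf.
  have [cf cdf _ _] := Cf; have [_ _ supO] := tf.
  have mf : measurable_fun setT f := continuous_rV_measurable cf.
  have mEO : measurable (E `&` O) by apply: measurableI => //; exact: measurable_domain.
  have fO x : ~ domain_set O x -> f x = 0.
    move=> Ox; apply: contrapT => /eqP fx; apply/Ox/supO.
    exact: subset_closure.
  have EnO x : ~ domain_set O x -> (energy f x)%:E = 0%E.
    move=> Ox; rewrite /energy fO// expr0n add0r big1// => i _.
    by rewrite partial_out_support ?expr0n// => /supO.
  have ez0 : 0 <= e * `|z| by rewrite mulr_ge0// ltW.
  rewrite -(@ler_pXn2r _ 2%N) ?nnegrE// exprMn -lee_fin.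
  rewrite (EFinM (e ^+ 2)) -(integral_energy Cf zf zdf) L2_sqr_integral.
  have mEn := measurable_energy Cf.
  rewrite [X in (_ <= _ * X)%E]integral_domain_measure//; last 2 first.
  - exact/measurable_EFinP.
  - by move=> x; rewrite lee_fin energy_ge0.
  apply: le_trans (hd f _ Cf mEO _); last by rewrite -domain_measureE.
  have m1 : measurable_fun setT (fun x => \1_(E `&` O) x * f x ^+ 2).
    apply: measurable_funM; first exact: measurable_indic.
    exact: measurable_funX.
  rewrite -integral_domain_measure//; last 3 first.
  - exact/measurable_EFinP.
  - by move=> x; rewrite lee_fin mulr_ge0 ?sqr_ge0.
  - by move=> x Ox; rewrite fO// expr0n mulr0.
  apply: ae_ge0_le_integral => //.
  - by move=> x _; rewrite lee_fin sqr_ge0.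
  - by apply/measurable_EFinP/measurable_funX; exact: measurable_Lp_fun.
  - by move=> x _; rewrite lee_fin mulr_ge0 ?sqr_ge0.
  - exact/measurable_EFinP.
  apply: filterS2 zf (chiE mE (z None)) => x zx -> _.
  rewrite zx lee_fin; have [Ox|Ox] := pselect (domain_set O x); last first.
    by rewrite fO// mulr0 expr0n mulr0.
  rewrite indicI /= (@indicE _ _ (domain_set O)) (mem_set Ox) mulr1 exprMn !indicE.
  by case: (x \in E) => /=; rewrite ?expr1n ?expr0n.
move=> w; apply/ler_addgt0Pr => t t0.
have t1 : 0 < t / (1 + e) by rewrite divr_gt0// addr_gt0.
have /H10_predP cw := valP w.
have [z [/= tz]] := cw _ (nbhsx_ballx (H10_val w) _ t1).
rewrite -ball_normE /= => wz.
have -> : H10_fun w = (H10_val w - z) None + z None.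
  by rewrite -l2sum_funD subrK.
rewrite chiD// (le_trans (ler_normD _ _))//.
have h1 : `|chi E ((H10_val w - z) None)| <= t / (1 + e).
  apply: le_trans (ltW wz); apply: le_trans (norm_chi_le mE _) _.
  exact: l2sum_norm_ge.
have h2 : `|z| <= `|w| + t / (1 + e).
  rewrite -[X in `|X|](subrK (H10_val w)) addrC (le_trans (ler_normD _ _))//.
  by rewrite lerD2l distrC ltW.
have h3 := test z tz.
have h4 : e * `|z| <= e * `|w| + e * (t / (1 + e)) by rewrite -mulrDr ler_wpM2l// ltW.
have h5 : t / (1 + e) + e * (t / (1 + e)) = t.
  by field; rewrite gt_eqF// addr_gt0.
lra.
Qed.
End H10_energy.

(** * Absolutely continuous operators on L^2 *)

Section absolutely_continuous.
Context (R : realType) (n : nat) (O : lipschitz_domain R n).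
Local Notation dm := (domain_measure O).

(** The operator norm of [chi E \o T] tends to 0 with the measure of [E]; in other
    words the squares of the images of the unit ball are uniformly integrable.
    This is the smoothing property that superlinear convergence rests on. *)
Definition absolutely_continuous (T : L2 O -> L2 O) : Prop :=
  forall e : R, 0 < e -> exists2 d : R, 0 < d &
    forall E : set 'rV[R]_n, measurable E -> (dm E <= d%:E)%E ->
    forall v, `|chi E (T v)| <= e * `|v|.

Section embedding.
Variables (q : \bar R) (q2 : (2%:E < q)%E).
Local Notation Lq := (Lp dm (lt2_le1 q2)).

Definition Lq_to_L2 (g : Lq) : L2 O := L2_of O g.

Lemma Lq_to_L2E g : {ae dm, forall x, Lq_to_L2 g x = g x}.
Proof.
apply: Lp_ofE; apply: (Lfun_subset (le1_2e R) (lt2_le1 q2)).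
- by rewrite ge0_fin_numE// domain_measure_lty.
- exact: ltW.
exact: LfunP (Lp_repr g).
Qed.

Lemma Lq_to_L2_linear : linear Lq_to_L2.
Proof.
move=> a u v; apply/Lp_eqP.
apply: filter_app (filterI (Lq_to_L2E u) (filterI (Lq_to_L2E v) (Lq_to_L2E (a *: u + v)))).
apply: filter_app (filterI (Lp_funD (a *: u) v) (Lp_funZ a u)).
apply: filter_app (filterI (Lp_funD (a *: Lq_to_L2 u) (Lq_to_L2 v)) (Lp_funZ a (Lq_to_L2 u))).
by apply: aeW => x [-> ->] [e3 e4] [-> [-> ->]]; rewrite e3 e4.
Qed.

(** For finite [q = r], split the values at the height [K] with
    [K ^ (r - 2) = 1 / e]: below it the square is at most [K ^ 2], above it at most
    [e] times the power [r]. For [q = +oo] the function is at most 1. *)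
Lemma Lq_sqr_integral_le (e : R) : 0 < e -> exists2 K : R, 0 <= K &
  forall g : Lq, `|g| <= 1 -> forall E, measurable E ->
  (\int[dm]_x (\1_E x * g x ^+ 2)%:E <= K%:E * dm E + e%:E)%E.
Proof.
move=> e0.
have mgE (g : Lq) E : measurable E -> measurable_fun setT (fun x => \1_E x * g x ^+ 2).
  move=> mE; apply: measurable_funM; first exact: measurable_indic.
  by apply: measurable_funX; exact: measurable_Lp_fun.
have gE0 (g : Lq) (E : set 'rV[R]_n) x : 0 <= \1_E x * g x ^+ 2 by rewrite mulr_ge0 ?sqr_ge0.
have normE (g : Lq) : `|g|%:E = 'N[dm]_q[EFin \o g]%E := finite_norm_fine (Lp_repr g).
case: q q2 mgE gE0 normE => [r| |//] q2' mgE gE0 normE.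
- have r2 : 2 < r by rewrite -lte_fin.
  have r0 : 0 < r by lra.
  pose p := r - 2; have p0 : 0 < p by rewrite /p; lra.
  pose K := (e^-1) `^ p^-1; have K0 : 0 < K by rewrite powR_gt0// invr_gt0.
  have Kp : K `^ p = e^-1.
    by rewrite /K -powRrM mulVf ?gt_eqF// powRr1// invr_ge0 ltW.
  have pt (x : R) : x ^+ 2 <= K ^+ 2 + e * `|x| `^ r.
    have [xK|Kx] := leP `|x| K.
      rewrite -(real_normK (num_real x)).
      have : `|x| ^+ 2 <= K ^+ 2 by rewrite lerXn2r// nnegrE ltW.
      have : 0 <= e * `|x| `^ r by rewrite mulr_ge0 ?powR_ge0// ltW.
      lra.
    have x0 : 0 < `|x| := lt_trans K0 Kx.
    have -> : `|x| `^ r = x ^+ 2 * `|x| `^ p.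
      have -> : r = 2 + p by rewrite /p; lra.
      by rewrite powRD ?(gt_eqF x0) ?implybT// powR_mulrn// real_normK// num_real.
    have : 1 <= e * `|x| `^ p.
      rewrite -ler_pdivrMl// mulr1 -Kp; apply: ge0_ler_powR; rewrite ?nnegrE ?ltW//.
    have := sqr_ge0 x; have := sqr_ge0 K; nra.
  exists (K ^+ 2); first exact: sqr_ge0.
  move=> g g1 E mE.
  have mg : measurable_fun setT g := measurable_Lp_fun g.
  have mgr : measurable_fun setT (fun x => `|g x| `^ r).
    apply: (measurableT_comp (f := fun y => y `^ r)); first exact: measurable_powR.
    exact: measurableT_comp.
  apply: (@le_trans _ _ (\int[dm]_x ((K ^+ 2 * \1_E x)%:E + (e * `|g x| `^ r)%:E))%E).
    apply: ge0_le_integral => //.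
    - by move=> x _; rewrite lee_fin; exact: gE0.
    - by apply/measurable_EFinP; exact: mgE.
    - by apply: emeasurable_funD; apply/measurable_EFinP; apply: measurable_funM.
    move=> x _; rewrite -EFinD lee_fin indicE.
    have := pt (g x); have : 0 <= e * `|g x| `^ r by rewrite mulr_ge0 ?powR_ge0// ltW.
    by case: (x \in E) => /=; lra.
  rewrite ge0_integralD//; last 4 first.
  - by move=> x _; rewrite lee_fin mulr_ge0 ?sqr_ge0.
  - by apply/measurable_EFinP; apply: measurable_funM.
  - by move=> x _; rewrite lee_fin mulr_ge0 ?powR_ge0// ltW.
  - by apply/measurable_EFinP; apply: measurable_funM.
  apply: leeD.
    under eq_integral => x _ do rewrite EFinM.
    rewrite ge0_integralZl ?lee_fin ?sqr_ge0//; last exact/measurable_EFinP/measurable_indic.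
    by rewrite integral_indic// setIT.
  under eq_integral => x _ do rewrite EFinM.
  rewrite ge0_integralZl ?lee_fin ?(ltW e0)//; last exact/measurable_EFinP.
  rewrite -[leRHS]mule1; apply: lee_wpmul2l; first by rewrite lee_fin ltW.
  have := @powR_Lnorm _ _ _ dm (EFin \o g) r (negbT (gt_eqF r0)).
  rewrite -normE => h; apply: (@le_trans _ _ (`|g|%:E `^ r)%E).
    by rewrite h (eq_integral (fun x => (`|g x| `^ r)%:E)).
  rewrite poweR_EFin lee_fin; apply: (@le_trans _ _ (1 `^ r)); last by rewrite powR1.
  apply: ge0_ler_powR => //.
  - exact: ltW.
  - by rewrite nnegrE.
  - by rewrite nnegrE.
- exists 1 => // g g1 E mE.
  have : {ae dm, forall x, `|g x| <= 1}.
    move: (normE g); rewrite unlock; case: ifPn => [_ h|].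
      have : (ess_sup dm (abse \o (EFin \o g)) <= 1%:E)%E by rewrite -h lee_fin.
      by move=> /ess_supP; apply: filterS => x /=; rewrite lee_fin.
    rewrite -leNgt => dm0 _; exists setT; split => //.
    by apply/eqP; rewrite eq_le dm0 measure_ge0.
  move=> g1'; rewrite -[leLHS]adde0 mul1e; apply: leeD; last by rewrite lee_fin ltW.
  rewrite -[X in (_ <= dm X)%E]setIT -integral_indic//.
  apply: ae_ge0_le_integral => //.
  - by move=> x _; rewrite lee_fin; exact: gE0.
  - by apply/measurable_EFinP; exact: mgE.
  - exact/measurable_EFinP/measurable_indic.
  apply: filterS g1' => x gx _; rewrite lee_fin -[leRHS]mulr1 ler_wpM2l//.
  by rewrite -(real_normK (num_real (g x))) expr_le1.
Qed.

End embedding.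
End absolutely_continuous.

(** * The solution operator and its adjoint *)

Lemma linear_bounded_by (R : realType) (V W : normedModType R) (f : {linear V -> W}) :
  continuous f -> exists2 C : R, 0 <= C & forall x, `|f x| <= C * `|x|.
Proof.
move=> fc; exists (opnorm f); last by move=> x; exact: ler_opnorm.
by apply: le_trans (normr_ge0 (f 0)) (opnorm_ge fc _); rewrite normr0.
Qed.

Section embedding_bounds.
Context (R : realType) (n : nat) (O : lipschitz_domain R n).
Local Notation dm := (domain_measure O).
Variables (q : \bar R) (q2 : (2%:E < q)%E).
Local Notation Lq := (Lp dm (lt2_le1 q2)).
Local Notation J := (@Lq_to_L2 R n O q q2).

HB.instance Definition _ := GRing.isLinear.Build R Lq (L2 O) *:%R J (@Lq_to_L2_linear R n O q q2).

Lemma chi_Lq_to_L2_sqr (g : Lq) E : measurable E ->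
  (`|chi E (J g)| ^+ 2)%:E = (\int[dm]_x (\1_E x * g x ^+ 2)%:E)%E.
Proof.
move=> mE; rewrite L2_sqr_integral; apply: ae_eq_integral => //.
- by apply/measurable_EFinP/measurable_funX; exact: measurable_Lp_fun.
- apply/measurable_EFinP/measurable_funM; first exact: measurable_indic.
  by apply: measurable_funX; exact: measurable_Lp_fun.
apply: filterS2 (chiE mE (J g)) (Lq_to_L2E g) => x -> -> _.
by rewrite indicE; case: (x \in E); rewrite /= ?mul1r ?mul0r ?expr0n.
Qed.

Lemma Lq_to_L2_homogeneous (E : set 'rV[R]_n) (e : R) : measurable E ->
  (forall g : Lq, `|g| <= 1 -> `|chi E (J g)| <= e) ->
  forall g : Lq, `|chi E (J g)| <= e * `|g|.
Proof.
move=> mE ge g; have [->|g0] := eqVneq g 0.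
  by rewrite linear0 chi0// !normr0 mulr0.
have gp : 0 < `|g| by rewrite normr_gt0.
rewrite -ler_pdivrMr//; have := ge (`|g|^-1 *: g).
rewrite linearZ/= chiZ// !normrZ gtr0_norm ?invr_gt0// mulVf ?gt_eqF// lexx.
by move=> /(_ isT); rewrite mulrC.
Qed.

Lemma Lq_to_L2_bounded : exists2 C : R, 0 <= C & forall g : Lq, `|J g| <= C * `|g|.
Proof.
have [K K0 hK] := Lq_sqr_integral_le O q2 ltr01.
have dmT : dm setT \is a fin_num by rewrite ge0_fin_numE// domain_measure_lty.
pose C := Num.sqrt (K * fine (dm setT) + 1); exists C; first exact: sqrtr_ge0.
have chiT (v : L2 O) : chi setT v = v.
  by apply/Lp_eqP; apply: filterS (chiE measurableT v) => x ->; rewrite indicT mul1r.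
move=> g; rewrite -[J g]chiT; apply: Lq_to_L2_homogeneous => // {}g g1.
rewrite -[leLHS]ger0_norm// -sqrtr_sqr; apply: ler_wsqrtr.
rewrite -lee_fin chi_Lq_to_L2_sqr// EFinD EFinM fineK//.
exact: hK.
Qed.

Lemma Lq_to_L2_absolutely_continuous (e : R) : 0 < e -> exists2 d : R, 0 < d &
    forall E : set 'rV[R]_n, measurable E -> (dm E <= d%:E)%E ->
    forall g : Lq, `|chi E (J g)| <= e * `|g|.
Proof.
move=> e0; have e20 : 0 < e ^+ 2 / 2 by rewrite divr_gt0// exprn_gt0.
have [K K0 hK] := Lq_sqr_integral_le O q2 e20.
exists (e ^+ 2 / 2 / (K + 1)); first by rewrite divr_gt0// ltr_wpDl.
move=> E mE Ed; apply: Lq_to_L2_homogeneous => // g g1.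
rewrite -(@ler_pXn2r _ 2%N) ?nnegrE ?normr_ge0 ?(ltW e0)//.
rewrite -lee_fin chi_Lq_to_L2_sqr//; apply: le_trans (hK g g1 E mE) _.
rewrite [X in (_ <= X%:E)%E](splitr (e ^+ 2)) EFinD leeD2r//.
apply: (@le_trans _ _ (K%:E * (e ^+ 2 / 2 / (K + 1))%:E)%E).
  by apply: lee_wpmul2l.
have K1 : 0 < K + 1 by rewrite ltr_wpDl.
rewrite -EFinM lee_fin mulrCA; apply: ler_piMr; first exact: ltW.
by rewrite ler_pdivrMr// mul1r lerDl.
Qed.
End embedding_bounds.

Section solution_operator.
Context (R : realType) (n : nat) (O : lipschitz_domain R n).
Local Notation dm := (domain_measure O).

Lemma L2_to_Hm1_linear : linear (@L2_to_Hm1 R n O).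
Proof.
move=> a u v; apply: val_inj; apply/funext => w /=.
by rewrite -[RHS]/(a * L2_inner u (H10_fun w) + L2_inner v (H10_fun w)) L2_innerDl L2_innerZl.
Qed.

Lemma norm_L2_to_Hm1_le (v : L2 O) (K : R) : 0 <= K ->
  (forall w : H10 O, `|L2_inner v (H10_fun w)| <= K * `|w|) -> `|L2_to_Hm1 v| <= K.
Proof.
move=> K0 vK; rewrite dual_norm_def; apply: opnorm_le => w w1.
by apply: le_trans (vK w) _; rewrite ler_piMr.
Qed.

Lemma norm_L2_to_Hm1 (v : L2 O) : `|L2_to_Hm1 v| <= `|v|.
Proof.
apply: norm_L2_to_Hm1_le => // w; apply: le_trans (L2_inner_le _ _) _.
by rewrite ler_wpM2l//; exact: l2sum_norm_ge.
Qed.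

Section bounds.
Variables (q : \bar R) (q2 : (2%:E < q)%E) (Y : normedModType R).
Variables (iota : {linear Y -> Lp dm (lt2_le1 q2)}) (A : {linear Y -> Hm1 O}).
Variable Ainv : Hm1 O -> Y.
Hypotheses (iota_cont : continuous iota) (AK : cancel A Ainv) (AinvK : cancel Ainv A).
Hypothesis Ainv_cont : continuous Ainv.
Local Notation S := (solution_operator iota Ainv).

Lemma inverse_linear : linear Ainv.
Proof. by move=> a f g; apply: (can_inj AK); rewrite AinvK linearP !AinvK. Qed.

HB.instance Definition _ := GRing.isLinear.Build R (Hm1 O) Y *:%R Ainv inverse_linear.

Lemma solution_operator_linear : linear S.
Proof.
move=> a u v; rewrite -[LHS]/(Lq_to_L2 (iota (Ainv (L2_to_Hm1 (a *: u + v))))).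
by rewrite L2_to_Hm1_linear inverse_linear linearP Lq_to_L2_linear.
Qed.

Lemma solution_operator_le_Lq : exists2 C : R, 0 <= C &
  forall v, `|iota (Ainv (L2_to_Hm1 v))| <= C * `|L2_to_Hm1 v|.
Proof.
have [C1 C10 h1] := linear_bounded_by iota_cont.
have [C2 C20 h2] := linear_bounded_by (f := Ainv) Ainv_cont.
exists (C1 * C2) => [|v]; first exact: mulr_ge0.
by apply: le_trans (h1 _) _; rewrite -mulrA ler_wpM2l.
Qed.

(** The norm of H^{-1} on the right, smaller than that of L^2, is what makes the
    adjoint absolutely continuous. *)
Lemma solution_operator_le_Hm1 : exists2 C : R, 0 <= C &
  forall v, `|S v| <= C * `|L2_to_Hm1 v|.
Proof.
have [C1 C10 h1] := solution_operator_le_Lq.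
have [C2 C20 h2] := Lq_to_L2_bounded O q2.
exists (C2 * C1) => [|v]; first exact: mulr_ge0.
by apply: le_trans (h2 _) _; rewrite -mulrA ler_wpM2l.
Qed.

Lemma solution_operator_bounded : exists2 C : R, 0 <= C & forall v, `|S v| <= C * `|v|.
Proof.
have [C C0 h] := solution_operator_le_Hm1; exists C => // v.
by apply: le_trans (h v) _; rewrite ler_wpM2l// norm_L2_to_Hm1.
Qed.

Lemma solution_operator_absolutely_continuous : absolutely_continuous S.
Proof.
move=> e e0; have [C C0 h] := solution_operator_le_Lq.
have C1 : 0 < C + 1 by rewrite ltr_wpDl.
have [d d0 hd] := Lq_to_L2_absolutely_continuous O q2 (divr_gt0 e0 C1).
exists d => // E mE Ed v; apply: le_trans (hd E mE Ed _) _.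
rewrite -mulrA ler_wpM2l ?(ltW e0)// ler_pdivrMl//.
apply: le_trans (h v) _; apply: ler_pM => //; first by rewrite lerDl.
exact: norm_L2_to_Hm1.
Qed.
End bounds.

Section adjoint.
Variables (S Sadj : L2 O -> L2 O).
Hypotheses (S_linear : linear S) (S_adj : is_adjoint S Sadj).

Lemma adjoint_linear : linear Sadj.
Proof.
move=> a u v; apply: L2_inner_eq => w.
rewrite L2_innerDl L2_innerZl !(L2_innerC (Sadj _)) -!S_adj.
by rewrite L2_innerDr L2_innerZr.
Qed.

Lemma adjoint_bounded (C : R) : 0 <= C -> (forall v, `|S v| <= C * `|v|) ->
  forall v, `|Sadj v| <= C * `|v|.
Proof.
move=> C0 SC v; have [v0|v0] := eqVneq `|Sadj v| 0; first by rewrite v0 mulr_ge0.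
have vp : 0 < `|Sadj v| by rewrite lt_def v0 normr_ge0.
rewrite -(ler_pM2l vp) -expr2 -L2_inner_sqr -S_adj.
apply: le_trans (ler_norm _) _; apply: le_trans (L2_inner_le _ _) _.
by rewrite mulrA (mulrC `|Sadj v|) ler_wpM2r.
Qed.

(** Duality. With [z = chi E (Sadj v)] one has [|z|^2 = <S z, v>], and since [z]
    lives on [E] its H^{-1} norm is small: it is tested against functions of H^1_0,
    of which only the restriction to [E] matters. *)
Lemma adjoint_absolutely_continuous (C : R) : 0 <= C ->
  (forall v, `|S v| <= C * `|L2_to_Hm1 v|) -> absolutely_continuous Sadj.
Proof.
move=> C0 SC e e0; have C1 : 0 < C + 1 by rewrite ltr_wpDl.
have [d d0 hd] := H10_absolutely_continuous O (divr_gt0 e0 C1).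
exists d => // E mE Ed v; set z := chi E (Sadj v).
have [z0|z0] := eqVneq `|z| 0; first by rewrite z0 mulr_ge0// ltW.
have zp : 0 < `|z| by rewrite lt_def z0 normr_ge0.
have zE : chi E z = z by rewrite /z chi_chi// setIid.
have zH : `|L2_to_Hm1 z| <= e / (C + 1) * `|z|.
  apply: norm_L2_to_Hm1_le => [|w]; first by rewrite mulr_ge0// divr_ge0// ltW.
  rewrite -zE L2_inner_chi// zE.
  apply: le_trans (L2_inner_le _ _) _; rewrite mulrAC mulrC.
  by apply: ler_wpM2r => //; exact: hd.
have zz : L2_inner z z = L2_inner (S z) v.
  by rewrite {1}/z L2_inner_chi// zE L2_innerC -S_adj.
rewrite -(ler_pM2l zp) -expr2 -L2_inner_sqr zz.
apply: le_trans (ler_norm _) _; apply: le_trans (L2_inner_le _ _) _.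
rewrite mulrA; apply: ler_wpM2r => //; apply: le_trans (SC z) _.
apply: (@le_trans _ _ (C * (e / (C + 1) * `|z|))); first exact: ler_wpM2l.
rewrite mulrA mulrC ler_wpM2l// mulrA ler_pdivrMr// mulrC ler_wpM2l ?(ltW e0)//.
by rewrite lerDl.
Qed.
End adjoint.
End solution_operator.

(** * Convergence of geometric sequences in L^2 *)

Lemma geometric_sum_le (R : realType) (r : R) m : 0 <= r < 1 ->
  \sum_(0 <= k < m) r ^+ k <= (1 - r)^-1.
Proof.
move=> /andP[r0 r1]; have r1' : 0 < 1 - r by lra.
rewrite -[leRHS]mul1r ler_pdivlMr//.
suff -> : (\sum_(0 <= k < m) r ^+ k) * (1 - r) = 1 - r ^+ m.
  by have := exprn_ge0 m r0; lra.
elim: m => [|m IH]; first by rewrite big_geq// mul0r expr0 subrr.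
by rewrite big_nat_recr//= mulrDl IH exprS; ring.
Qed.

Lemma cvg_of_geometric (R : realType) (a : nat -> R) (K r : R) : 0 < r < 1 ->
  (forall k, `|a k.+1 - a k| <= K * r ^+ k) ->
  cvgn a /\ forall k, `|limn a - a k| <= K / (1 - r) * r ^+ k.
Proof.
move=> /andP[r0 r1] ar; have r1' : 0 < 1 - r by lra.
have K0 : 0 <= K by have := le_trans (normr_ge0 _) (ar 0%N); rewrite expr0 mulr1.
have aK k m : `|a (k + m)%N - a k| <= K / (1 - r) * r ^+ k.
  have -> : a (k + m)%N - a k = \sum_(0 <= i < m) (a (k + i).+1 - a (k + i)%N).
    elim: m => [|m IH]; first by rewrite big_geq// addn0 subrr.
    by rewrite big_nat_recr//= -IH addnS; ring.
  apply: le_trans (ler_norm_sum _ _ _) _.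
  apply: (@le_trans _ _ (\sum_(0 <= i < m) (K * r ^+ k) * r ^+ i)).
    by apply: ler_sum => i _; rewrite -mulrA -exprD; exact: ar.
  rewrite -mulr_sumr (_ : K / (1 - r) * r ^+ k = K * r ^+ k * (1 - r)^-1); last by ring.
  apply: ler_wpM2l; first by rewrite mulr_ge0// exprn_ge0// ltW.
  by apply: geometric_sum_le; rewrite (ltW r0).
have ca : cvgn a.
  have -> : a = (fun=> a 0%N) + series (telescope a).
    by apply/funext => k; rewrite {1}eq_sum_telescope.
  apply: is_cvgD; first exact: is_cvg_cst.
  apply: normed_cvg; apply: (series_le_cvg _ _ ar) => //.
  - by move=> k; rewrite mulr_ge0// exprn_ge0// ltW.
  - by apply: is_cvg_geometric_series; rewrite ger0_norm// ltW.
split=> // k; rewrite ler_distl; apply/andP; split.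
  apply: limr_ge => //; exists k => // m /= km.
  by have := aK k (m - k)%N; rewrite subnKC// ler_distl => /andP[].
apply: limr_le => //; exists k => // m /= km.
by have := aK k (m - k)%N; rewrite subnKC// ler_distl => /andP[].
Qed.

Section riesz_fischer.
Context (R : realType) (n : nat) (O : lipschitz_domain R n).
Local Notation dm := (domain_measure O).

(** The part of the Riesz-Fischer theorem needed for contractions. Fix [r] between
    [th] and 1. The sum [G] of the weighted squares [r^(-2k) (u_(k+1) - u_k)^2] has
    a finite integral, hence is finite almost everywhere; there the increments are
    at most [sqrt G * r ^ k], so that the sequence converges pointwise, at a
    geometric rate whose constant is square integrable. *)
Lemma L2_cvg_of_geometric (u : nat -> L2 O) (C th : R) : 0 <= th < 1 ->
  (forall k, `|u k.+1 - u k| <= C * th ^+ k) -> exists l : L2 O, u @ \oo --> l.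
Proof.
move=> /andP[th0 th1] uC.
have C0 : 0 <= C by have := le_trans (normr_ge0 _) (uC 0%N); rewrite expr0 mulr1.
pose r := (1 + th) / 2; have r0 : 0 < r by rewrite /r; lra.
have r1 : r < 1 by rewrite /r; lra.
have thr : th < r by rewrite /r; lra.
pose d k x := u k.+1 x - u k x.
have mu k : measurable_fun setT (u k) := measurable_Lp_fun (u k).
have md k : measurable_fun setT (d k) by exact: measurable_funB.
pose rho := (th / r) ^+ 2.
have thr0 : 0 <= th / r by rewrite divr_ge0// ltW.
have rho1 : 0 <= rho < 1.
  rewrite /rho exprn_ge0//= expr_lt1//.
  by rewrite ltr_pdivrMr// mul1r.
pose g k x := ((r ^+ k)^-1 * d k x) ^+ 2.
have mg k : measurable_fun setT (g k).
  by apply: measurable_funX; apply: measurable_funM.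
have g0 k x : (0 <= (g k x)%:E)%E by rewrite lee_fin sqr_ge0.
pose G x := (\sum_(k <oo) (g k x)%:E)%E.
have mG : measurable_fun setT G.
  by apply: ge0_emeasurable_sum => // k _; exact/measurable_EFinP.
have G0 x : (0 <= G x)%E by apply: nneseries_ge0.
have IG : (\int[dm]_x G x <= (C ^+ 2 / (1 - rho))%:E)%E.
  rewrite integral_nneseries//; last by move=> k; exact/measurable_EFinP.
  apply: lime_le.
    by apply: is_cvg_nneseries => k _ _; apply: integral_ge0.
  apply: nearW => m.
  apply: (@le_trans _ _ (\sum_(0 <= k < m) (C ^+ 2 * rho ^+ k)%:E)%E).
    apply: lee_sum => k _.
    have -> : (\int[dm]_x (g k x)%:E = (((r ^+ k)^-1 * `|u k.+1 - u k|) ^+ 2)%:E)%E.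
      rewrite exprMn EFinM L2_sqr_integral -ge0_integralZl ?lee_fin ?sqr_ge0//; last 2 first.
      - by apply/measurable_EFinP/measurable_funX; exact: measurable_Lp_fun.
      - by move=> x _; rewrite lee_fin sqr_ge0.
      apply: ae_eq_integral => //.
      - exact/measurable_EFinP.
      - apply: emeasurable_funM => //.
        by apply/measurable_EFinP/measurable_funX; exact: measurable_Lp_fun.
      by apply: filterS (Lp_funB (u k.+1) (u k)) => x -> _; rewrite -EFinM -exprMn.
    rewrite lee_fin /rho -exprM mulnC exprM -exprMn.
    have e0 : 0 <= (r ^+ k)^-1 by rewrite invr_ge0 exprn_ge0// ltW.
    apply: lerXn2r; rewrite ?nnegrE ?mulr_ge0 ?exprn_ge0//.
    by rewrite (expr_div_n th r k) [leRHS]mulrA [leRHS]mulrC ler_wpM2l.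
  rewrite sumEFin lee_fin -mulr_sumr ler_wpM2l ?sqr_ge0//.
  exact: geometric_sum_le.
have Gfin : {ae dm, forall x, G x \is a fin_num}.
  have : dm.-integrable setT G.
    apply/integrableP; split => //.
    under eq_integral => x _ do rewrite gee0_abs//.
    by apply: le_lt_trans IG _; rewrite ltry.
  by move/(integrable_ae measurableT); apply: filterS => x; exact.
pose M x := Num.sqrt (fine (G x)).
have dM x : G x \is a fin_num -> forall k, `|u k.+1 x - u k x| <= M x * r ^+ k.
  move=> Gx k; have rk : 0 < r ^+ k by rewrite exprn_gt0.
  rewrite -ler_pdivrMr// -[leLHS]ger0_norm ?divr_ge0 ?(ltW rk)//.
  rewrite -sqrtr_sqr; apply: ler_wsqrtr; rewrite -lee_fin fineK//.
  apply: le_trans (nneseries_lim_ge k.+1 _) => //.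
  rewrite big_nat_recr//= -[leLHS]add0e; apply: leeD; first exact: sume_ge0.
  have rkV : 0 < (r ^+ k)^-1 by rewrite invr_gt0.
  by rewrite lee_fin /g !exprMn real_normK ?num_real// mulrC.
pose D := [set x | G x \is a fin_num].
have mD : measurable D.
  by rewrite -[D]setTI; exact: emeasurable_fin_num.
have r01 : 0 < r < 1 by rewrite r0.
have cv x (Dx : D x) := cvg_of_geometric r01 (dM x Dx).
pose v k x := \1_D x * (u k x - u 0%N x).
have mv k : measurable_fun setT (v k).
  by apply: measurable_funM; [exact: measurable_indic|exact: measurable_funB].
have vD x : D x -> v ^~ x = fun k => u k x - u 0%N x.
  by move=> Dx; apply/funext => k; rewrite /v indicE mem_set// mul1r.
pose f x := limn (v ^~ x).
have mf : measurable_fun setT f.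
  apply: (measurable_fun_cvg mv) => x _.
  have [Dx|Dx] := pselect (D x).
    rewrite /f vD//; apply: is_cvgB; first exact: (cv x Dx).1.
    exact: is_cvg_cst.
  rewrite /f (_ : v ^~ x = cst 0); last first.
    by apply/funext => k; rewrite /v indicE memNset// mul0r.
  exact: is_cvg_cst.
have fM x : D x -> forall k, `|f x + u 0%N x - u k x| <= M x / (1 - r) * r ^+ k.
  move=> Dx k; rewrite /f vD//.
  rewrite (_ : limn _ = limn (fun k => u k x) - u 0%N x).
    by rewrite subrK; exact: (cv x Dx).2.
  by apply: cvg_lim => //; apply: cvgB; [exact: (cv x Dx).1|exact: cvg_cst].
have MG x : D x -> (M x ^+ 2)%:E = G x.
  by move=> Dx; rewrite sqr_sqrtr ?fineK// fine_ge0.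
pose c := (1 - r)^-1.
have c0 : 0 < c by rewrite /c invr_gt0; lra.
have Lint (h : 'rV[R]_n -> R) k : measurable_fun setT h ->
    {ae dm, forall x, `|h x| <= M x / (1 - r) * r ^+ k} ->
    (\int[dm]_x (h x ^+ 2)%:E <= ((c * r ^+ k) ^+ 2 * (C ^+ 2 / (1 - rho)))%:E)%E.
  move=> mh hM; apply: (@le_trans _ _ (\int[dm]_x (((c * r ^+ k) ^+ 2)%:E * G x))%E).
    apply: ae_ge0_le_integral => //.
    - by move=> x _; rewrite lee_fin sqr_ge0.
    - by apply/measurable_EFinP; exact: measurable_funX.
    - by move=> x _; rewrite mule_ge0// lee_fin sqr_ge0.
    - exact: measurable_funeM.
    apply: filterS2 Gfin hM => x Gx hx _.
    rewrite -(MG _ Gx) -EFinM lee_fin -exprMn -(real_normK (num_real (h x))).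
    have hx' : `|h x| <= c * r ^+ k * M x by rewrite /c mulrC mulrA.
    by rewrite ler_pXn2r// ?nnegrE// (le_trans _ hx').
  rewrite ge0_integralZl ?lee_fin ?sqr_ge0//.
  by rewrite [leRHS]EFinM; apply: lee_wpmul2l; rewrite ?lee_fin ?sqr_ge0.
have f0 : {ae dm, forall x, L2_of O f x = f x}.
  apply: Lp_ofE; apply: Lfun2_sqr_lty => //.
  apply: le_lt_trans (Lint f 0%N mf _) _; last exact: ltry.
  by apply: filterS Gfin => x Gx; have := fM x Gx 0%N; rewrite addrK.
pose l := L2_of O f + u 0%N.
have lu k : `|l - u k| <= Num.sqrt (c ^+ 2 * (C ^+ 2 / (1 - rho))) * r ^+ k.
  have rk : 0 <= r ^+ k by rewrite exprn_ge0// ltW.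
  have -> : r ^+ k = Num.sqrt ((r ^+ k) ^+ 2) by rewrite sqrtr_sqr ger0_norm.
  rewrite -sqrtrM; last first.
    rewrite mulr_ge0 ?sqr_ge0// divr_ge0 ?sqr_ge0// subr_ge0.
    by case/andP: rho1 => _ /ltW.
  rewrite -[leLHS]ger0_norm// -sqrtr_sqr; apply: ler_wsqrtr.
  rewrite -lee_fin L2_sqr_integral mulrAC -exprMn; apply: Lint.
    exact: measurable_Lp_fun.
  apply: filter_app (filterI (Lp_funB l (u k)) (Lp_funD (L2_of O f) (u 0%N))).
  apply: filterS2 Gfin f0 => x Gx fx [-> ->]; rewrite fx.
  exact: fM.
exists l; apply/cvgrPdist_le => e e0.
have := cvg_geometric (Num.sqrt (c ^+ 2 * (C ^+ 2 / (1 - rho)))) (z := r).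
rewrite ger0_norm ?(ltW r0)// => /(_ r1)/cvgrPdist_le/(_ e e0).
apply: filterS => k; rewrite sub0r normrN => ke.
by apply: le_trans (lu k) _; apply: le_trans ke; exact: ler_norm.
Qed.

End riesz_fischer.

(** * The theorem of Lax and Milgram *)

Section l2sum_convergence.
Context (R : realType) (I : finType) (V : normedModType R).

Lemma l2sum_norm_le_sum (u : l2sum I V) : `|u| <= \sum_i `|u i|.
Proof.
have s0 : 0 <= \sum_i `|u i| by apply: sumr_ge0.
rewrite l2sum_norm_def -[leRHS]ger0_norm// -sqrtr_sqr; apply: ler_wsqrtr.
rewrite expr2 mulr_sumr; apply: ler_sum => i _.
rewrite mulrC expr2 ler_wpM2l// (bigD1 i)//= lerDl.
exact: sumr_ge0.
Qed.

Lemma l2sum_funN (u : l2sum I V) i : (- u : l2sum I V) i = - u i.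
Proof. by rewrite -(scaleN1r u) l2sum_funZ scaleN1r. Qed.

Lemma l2sum_funB (u v : l2sum I V) i : (u - v : l2sum I V) i = u i - v i.
Proof. by rewrite l2sum_funD l2sum_funN. Qed.

Lemma l2sum_cvg (u : nat -> l2sum I V) (l : I -> V) :
  (forall i, (fun k => u k i) @ \oo --> l i) -> u @ \oo --> l2sum_of l.
Proof.
move=> ul; apply/cvgrPdist_le => e e0.
pose e' := e / (#|I|%:R + 1); have I0 : 0 < #|I|%:R + 1 :> R by rewrite ltr_wpDl.
have e'0 : 0 < e' by rewrite divr_gt0.
have near_le i : \forall k \near \oo, `|l i - u k i| <= e'.
  by move/cvgrPdist_le : (ul i); apply.
apply: filterS (filter_forall _ near_le) => k uk; apply: le_trans (l2sum_norm_le_sum _) _.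
apply: (@le_trans _ _ (\sum_(i : I) e')).
  by apply: ler_sum => i _; rewrite l2sum_funB l2sum_ofE.
rewrite sumr_const -mulr_natr /e' mulrAC ler_pdivrMr// ler_wpM2l ?(ltW e0)//.
by rewrite lerDl.
Qed.
End l2sum_convergence.

Section lax_milgram.
Context (R : realType) (n : nat) (O : lipschitz_domain R n) (I : finType).
Local Notation U := (l2sum I (L2 O)).
Implicit Types h g : U.

Definition l2sum_inner h g : R := \sum_i L2_inner (h i) (g i).

Lemma l2sum_inner_sqr h : l2sum_inner h h = `|h| ^+ 2.
Proof.
rewrite [in RHS]l2sum_norm_def sqr_sqrtr.
  by apply: eq_bigr => i _; exact: L2_inner_sqr.
by apply: sumr_ge0 => i _; exact: sqr_ge0.
Qed.

Lemma l2sum_innerC h g : l2sum_inner h g = l2sum_inner g h.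
Proof. by apply: eq_bigr => i _; exact: L2_innerC. Qed.

Lemma l2sum_innerDr h g g' : l2sum_inner h (g + g') = l2sum_inner h g + l2sum_inner h g'.
Proof. by rewrite -big_split; apply: eq_bigr => i _; rewrite l2sum_funD L2_innerDr. Qed.

Lemma l2sum_innerDl h g g' : l2sum_inner (g + g') h = l2sum_inner g h + l2sum_inner g' h.
Proof. by rewrite l2sum_innerC l2sum_innerDr !(l2sum_innerC h). Qed.

Lemma l2sum_innerZr h a g : l2sum_inner h (a *: g) = a * l2sum_inner h g.
Proof. by rewrite mulr_sumr; apply: eq_bigr => i _; rewrite l2sum_funZ L2_innerZr. Qed.

Lemma l2sum_normD_sqr h g : `|h + g| ^+ 2 = `|h| ^+ 2 + 2 * l2sum_inner h g + `|g| ^+ 2.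
Proof.
rewrite -!l2sum_inner_sqr l2sum_innerDl !l2sum_innerDr (l2sum_innerC g h).
by ring.
Qed.

Lemma l2sum_inner_le h g : l2sum_inner h g <= `|h| * `|g|.
Proof.
have [g0|g0] := eqVneq `|g| 0.
  have /normr0_eq0 -> := g0.
  rewrite normr0 mulr0 /l2sum_inner big1// => i _.
  by rewrite l2sum_fun0 L2_inner0r.
have gp : 0 < `|g| by rewrite lt_def g0 normr_ge0.
pose ng : R := `|g|; pose nh : R := `|h|; have := sqr_ge0 `|ng *: h + (- nh) *: g|.
rewrite l2sum_normD_sqr !normrZ l2sum_innerZr l2sum_innerC l2sum_innerZr normrN /ng /nh !normr_id.
rewrite (l2sum_innerC g h); set x := l2sum_inner h g; move=> hx.
have [h0|h0] := eqVneq `|h| 0.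
  rewrite h0 mul0r /x; have /normr0_eq0 -> := h0.
  by rewrite l2sum_innerC /l2sum_inner big1// => i _; rewrite l2sum_fun0 L2_inner0r.
have hp : 0 < `|h| by rewrite lt_def h0 normr_ge0.
rewrite -(ler_pM2l (mulr_gt0 gp hp)); nra.
Qed.

(** The map [h |-> h - t (B h - g)] with [t = c / K'^2] contracts with the factor
    [sqrt (1 - (c / K')^2)]. *)
Lemma lax_milgram (B : U -> U) (K c : R) : 0 < c ->
  (forall h g, B (h - g) = B h - B g) -> (forall h, `|B h| <= K * `|h|) ->
  (forall h, c * `|h| ^+ 2 <= l2sum_inner h (B h)) -> forall g, exists h, B h = g.
Proof.
move=> c0 BB BK Bc g.
(* A bound of [B] that is also larger than [c], to keep the square root real. *)
pose K' := `|K| + c + 1; have K'0 : 0 < K' by rewrite /K'; have := normr_ge0 K; lra.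
have cK' : c < K' by rewrite /K'; have := normr_ge0 K; lra.
have BK' h : `|B h| <= K' * `|h|.
  apply: le_trans (BK h) _; apply: ler_wpM2r => //.
  by have := ler_norm K; rewrite /K'; lra.
pose t := c / K' ^+ 2; have t0 : 0 < t by rewrite divr_gt0// exprn_gt0.
pose th2 := 1 - (c / K') ^+ 2.
have cK1 : (c / K') ^+ 2 < 1.
  by rewrite expr_lt1 ?divr_ge0 ?(ltW c0) ?(ltW K'0)// ltr_pdivrMr// mul1r.
have cK0 : 0 < (c / K') ^+ 2 by rewrite exprn_gt0// divr_gt0.
pose th := Num.sqrt th2.
have th01 : 0 <= th < 1.
  rewrite sqrtr_ge0 -[ltRHS]sqrtr1 ltr_sqrt ?ltr01//.
  by rewrite /th2; lra.
have contr h : `|h - t *: B h| <= th * `|h|.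
  have thh : 0 <= th * `|h| by rewrite mulr_ge0//; case/andP: th01.
  have th2E : th ^+ 2 = th2 by rewrite sqr_sqrtr// /th2 subr_ge0 ltW.
  rewrite -(@ler_pXn2r _ 2%N) ?nnegrE// exprMn th2E.
  rewrite -scaleNr l2sum_normD_sqr l2sum_innerZr normrZ normrN (gtr0_norm t0).
  have tK : t * K' ^+ 2 = c by rewrite /t divfK// gt_eqF// exprn_gt0.
  have e1 : (t * `|B h|) ^+ 2 <= t * c * `|h| ^+ 2.
    have -> : t * c * `|h| ^+ 2 = (t * (K' * `|h|)) ^+ 2.
      by rewrite -tK; ring.
    have tB : t * `|B h| <= t * (K' * `|h|) by rewrite ler_wpM2l ?(ltW t0).
    by apply: lerXn2r => //; rewrite nnegrE mulr_ge0// ?(ltW t0)// mulr_ge0// ltW.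
  have e2 : t * (c * `|h| ^+ 2) <= t * l2sum_inner h (B h) by rewrite ler_wpM2l ?(ltW t0).
  have e3 : th2 = 1 - t * c by rewrite /th2 /t; field; rewrite gt_eqF.
  rewrite e3; nra.
pose x := fix x k : U := if k is k'.+1 then x k' - t *: (B (x k') - g) else 0.
have xS k : x k.+1 - x k = - (t *: (B (x k) - g)).
  by rewrite /= addrC addrA addNr sub0r.
have xC k : `|x k.+1 - x k| <= `|x 1%N - x 0%N| * th ^+ k.
  elim: k => [|k IH]; first by rewrite expr0 mulr1.
  have -> : x k.+2 - x k.+1 = (x k.+1 - x k) - t *: B (x k.+1 - x k).
    rewrite BB xS [in RHS]xS -opprD -scalerDr; congr (- (_ *: _)).
    by rewrite [RHS]addrC addrA subrK.
  apply: le_trans (contr _) _; rewrite exprS mulrCA.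
  by apply: ler_wpM2l => //; case/andP: th01.
have /choice[l xl] : forall i, exists l : L2 O, (fun k => x k i) @ \oo --> l.
  move=> i; apply: (L2_cvg_of_geometric th01 (C := `|x 1%N - x 0%N|)) => k.
  by rewrite -l2sum_funB; apply: le_trans (xC k); exact: l2sum_norm_ge.
have /cvgrPdist_le xcvg := l2sum_cvg xl.
exists (l2sum_of l); apply/eqP; rewrite -subr_eq0 -normr_le0; apply/ler_addgt0Pr => e e0.
rewrite add0r.
pose e' := e / (K' + t^-1 * 2).
have e'0 : 0 < e' by rewrite divr_gt0// addr_gt0// mulr_gt0// invr_gt0.
have [k _ hk] := xcvg e' e'0.
have h1 := hk k (leqnn k); have h2 := hk k.+1 (leqnSn k).
have -> : B (l2sum_of l) - g = B (l2sum_of l - x k) + (B (x k) - g).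
  by rewrite BB addrA subrK.
apply: le_trans (ler_normD _ _) _.
have h3 : `|B (l2sum_of l - x k)| <= K' * e'.
  by apply: le_trans (BK' _) _; rewrite ler_wpM2l// ltW.
have h4 : `|B (x k) - g| <= t^-1 * (2 * e').
  rewrite ler_pdivlMl// -[X in X * _](gtr0_norm t0) -normrZ -normrN -xS.
  rewrite -[x k.+1](subrK (l2sum_of l)) -addrA (le_trans (ler_normD _ _))//.
  have -> : 2 * e' = e' + e' by ring.
  by rewrite lerD// distrC.
apply: le_trans (lerD h3 h4) _.
rewrite (_ : _ + _ = e / (K' + t^-1 * 2) * (K' + t^-1 * 2)); last by rewrite /e'; ring.
by rewrite divfK// gt_eqF// addr_gt0// mulr_gt0// invr_gt0.
Qed.

End lax_milgram.

(** * The equation solved by a Newton step *)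

Section L2_truncations.
Context (R : realType) (n : nat) (O : lipschitz_domain R n).
Local Notation dm := (domain_measure O).

Lemma measurable_bool_set (b : 'rV[R]_n -> bool) :
  measurable_fun setT b -> measurable [set x | b x].
Proof.
move=> mb; rewrite (_ : [set x | b x] = setT `&` b @^-1` [set true]); first exact: mb.
by apply/seteqP; split => x //= [].
Qed.

Lemma measurable_le_set (f g : 'rV[R]_n -> R) :
  measurable_fun setT f -> measurable_fun setT g -> measurable [set x | f x <= g x].
Proof. by move=> mf mg; apply: measurable_bool_set; exact: measurable_fun_ler. Qed.

Lemma measurable_lt_set (f g : 'rV[R]_n -> R) :
  measurable_fun setT f -> measurable_fun setT g -> measurable [set x | f x < g x].
Proof. by move=> mf mg; apply: measurable_bool_set; exact: measurable_fun_ltr. Qed.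

Lemma ae_domain : {ae dm, forall x, domain_set O x}.
Proof.
have mO := measurable_domain O.
exists (~` domain_set O); split; first exact: measurableC.
  by rewrite domain_measureE setICl measure0.
by move=> x.
Qed.

Lemma L2_of_ae_eq (f : 'rV[R]_n -> R) (v : L2 O) : measurable_fun setT f ->
  {ae dm, forall x, f x = v x} -> L2_of O f = v.
Proof.
move=> mf fv; apply/Lp_eqP.
have fv' : {ae dm, forall x, `|f x| <= `|v x|} by apply: filterS fv => x ->.
by apply: filterS2 (L2_of_dominated mf fv') fv => x -> ->.
Qed.

Lemma pos_partE (v : L2 O) : {ae dm, forall x, pos_part v x = Num.max (v x) 0}.
Proof.
apply: (@L2_of_dominated _ _ _ _ v).
  by apply: measurable_maxr => //; exact: measurable_Lp_fun.
by apply: aeW => x; case: (leP (v x) 0) => // _; rewrite normr0.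
Qed.

Lemma chi_ae_eq (E F : set 'rV[R]_n) (v : L2 O) : measurable E -> measurable F ->
  ae_eq_set O E F -> chi E v = chi F v.
Proof.
move=> mE mF EF; apply/Lp_eqP.
apply: filter_app (chiE mE v); apply: filterS2 (chiE mF v) EF => x -> EFx ->.
congr (_ * _); rewrite !indicE; congr (_%:R).
by have [Ex|Ex] := pselect (E x); [rewrite !mem_set//; exact/EFx|
  rewrite !memNset// => Fx; apply/Ex/EFx].
Qed.

Lemma ae_eq_setD (E E' F F' : set 'rV[R]_n) :
  ae_eq_set O E F -> ae_eq_set O E' F' -> ae_eq_set O (E `\` E') (F `\` F').
Proof.
rewrite /ae_eq_set => EF EF'; apply: filterS2 EF EF' => x [h1 h2] [h3 h4].
by split=> -[hE hE']; split; auto.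
Qed.

End L2_truncations.

Section newton_step.
Context (R : realType) (n : nat) (O : lipschitz_domain R n) (N : nat).
Local Notation dm := (domain_measure O).
Variables (S Sadj : L2 O -> L2 O) (Om : 'I_N -> set 'rV[R]_n).
Variables (yd ua ub : 'I_N -> L2 O) (psi mu : L2 O) (alpha rho : R).
Hypotheses (S_linear : linear S) (Sadj_linear : linear Sadj).
Hypothesis Om_meas : forall nu, measurable (Om nu).
Hypothesis ua_le_ub : forall nu, {ae dm, forall x, ua nu x <= ub nu x}.
Local Notation U := (l2sum 'I_N (L2 O)).
Implicit Types (u v h : U) (nu : 'I_N).

Local Notation unconstrained u := (unconstrained_control S Sadj Om yd psi mu alpha rho u).
Local Notation lower u := (lower_active S Sadj Om yd ua psi mu alpha rho u).
Local Notation upper u := (upper_active S Sadj Om yd ub psi mu alpha rho u).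
Local Notation inact u := (inactive S Sadj Om yd ua ub psi mu alpha rho u).
Local Notation sactive u := (state_active S psi mu rho u).
Local Notation active u := (active_part S Sadj Om yd ua ub psi mu alpha rho u).
Local Notation mult u := (multiplier_update S psi mu rho u).

Let SL : {linear L2 O -> L2 O} :=
  HB.pack S (GRing.isLinear.Build R (L2 O) (L2 O) *:%R S S_linear).
Let SadjL : {linear L2 O -> L2 O} :=
  HB.pack Sadj (GRing.isLinear.Build R (L2 O) (L2 O) *:%R Sadj Sadj_linear).

Let SadjD (v w : L2 O) : Sadj (v + w) = Sadj v + Sadj w.
Proof. exact: (linearD SadjL). Qed.

Lemma state_sum u : state S u = S (\sum_nu u nu).
Proof. by apply/esym; exact: (linear_sum SL). Qed.

Lemma state_linear : linear (state S : U -> L2 O).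
Proof.
move=> a u v; rewrite /state scaler_sumr -big_split; apply: eq_bigr => nu _.
by rewrite l2sum_funD l2sum_funZ S_linear.
Qed.

Let stateL : {linear U -> L2 O} :=
  HB.pack (state S : U -> L2 O)
    (GRing.isLinear.Build R U (L2 O) *:%R (state S : U -> L2 O) state_linear).

Lemma stateD u v : state S (u + v) = state S u + state S v.
Proof. exact: (linearD stateL). Qed.
Lemma stateB u v : state S (u - v) = state S u - state S v.
Proof. exact: (linearB stateL). Qed.

Lemma measurable_lower u nu : measurable (lower u nu).
Proof.
apply: measurableI; first exact: measurable_domain.
by apply: measurable_le_set; exact: measurable_Lp_fun.
Qed.

Lemma measurable_upper u nu : measurable (upper u nu).
Proof.
apply: measurableI; first exact: measurable_domain.
by apply: measurable_le_set; exact: measurable_Lp_fun.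
Qed.

Lemma measurable_inactive u nu : measurable (inact u nu).
Proof.
apply: measurableI; first exact: measurable_domain.
rewrite (_ : [set x | _] = [set x | ua nu x < unconstrained u nu x] `&`
    [set x | unconstrained u nu x < ub nu x]).
  by apply: measurableI; apply: measurable_lt_set; exact: measurable_Lp_fun.
by apply/seteqP; split => x /= => [/andP|[-> ->]].
Qed.

Lemma measurable_state_active u : measurable (sactive u).
Proof.
apply: measurableI; first exact: measurable_domain.
by apply: measurable_lt_set => //; exact: measurable_Lp_fun.
Qed.

Lemma chi_state_active u : chi (sactive u) (mult u) = pos_part (mult u).
Proof.
apply/Lp_eqP; apply: filter_app (chiE (measurable_state_active u) (mult u)).
apply: filterS2 (@ae_domain R n O) (pos_partE (mult u)) => x Ox -> ->.
rewrite indicE in_setI (mem_set Ox) /=; have [m0|m0] := ltP 0 (mult u x).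
  by rewrite mem_set// mul1r.
by rewrite memNset ?mul0r//=; apply/negP; rewrite -leNgt.
Qed.

(** Truncation in terms of the active sets: the form in which the projection is
    compared with a Newton step. *)
Lemma proj_unconstrained u :
  proj_admissible ua ub (unconstrained u) =
  chi_inactive S Sadj Om yd ua ub psi mu alpha rho u (unconstrained u) + active u.
Proof.
move: (erefl (unconstrained u)); move: {1 3 4}(unconstrained u) => W WE.
apply: l2sumP => nu; rewrite l2sum_funD !l2sum_ofE; set w := W nu.
have mA := measurable_lower u nu; have mB := measurable_upper u nu.
have mI := measurable_inactive u nu; have mBA := measurableD mB mA.
apply: L2_of_ae_eq.
  apply: measurable_minr; last exact: measurable_Lp_fun.
  by apply: measurable_maxr; exact: measurable_Lp_fun.
apply: filter_app (filterI (chiE mI w) (filterI (chiE mA (ua nu)) (chiE mBA (ub nu)))).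
apply: filter_app (Lp_funD (chi (inact u nu) w) (chi (lower u nu) (ua nu)
  + chi (upper u nu `\` lower u nu) (ub nu))).
apply: filter_app (Lp_funD (chi (lower u nu) (ua nu))
  (chi (upper u nu `\` lower u nu) (ub nu))).
apply: filterS2 (@ae_domain R n O) (ua_le_ub nu) => x Ox ab -> -> [-> [-> ->]].
rewrite !indicE in_setD !in_setI (mem_set Ox) /=.
have inset (b : 'rV[R]_n -> bool) : (x \in [set y | b y]) = b x.
  by apply/idP/idP; rewrite inE.
rewrite !inset -WE -/w; case: (leP (w x) (ua nu x)) => [wa|aw] /=.
  rewrite andbF /= !mul0r mul1r add0r addr0.
  by case: (leP (ua nu x) (ub nu x)) ab.
rewrite andbT /= mul0r add0r; case: (ltP (w x) (ub nu x)) => wb /=.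
  by rewrite mul1r mul0r addr0.
by rewrite mul0r add0r mul1r.
Qed.

(** The unconstrained control at [v], except that the positive part is replaced by
    the multiplication with the characteristic function of the set where it is
    active at [u]. It is affine in [v]. *)
Definition newton_control u (v : U) nu : L2 O :=
  - alpha^-1 *: Sadj (chi (Om nu) (state S v - yd nu)
                      + chi (sactive u) (mult v)).

Lemma newton_control_self u nu : newton_control u u nu = unconstrained u nu.
Proof. by rewrite /newton_control chi_state_active l2sum_funZ l2sum_ofE. Qed.

Lemma newton_controlD u v h nu : newton_control u (v + h) nu =
  newton_control u v nu - newton_op S Sadj Om psi mu alpha rho u h nu.
Proof.
have mY := measurable_state_active u.
rewrite /newton_op l2sum_ofE /state_term /newton_control /multiplier_update stateD.
rewrite -scaleNr -scalerDr -SadjD; congr (_ *: Sadj _).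
rewrite addrACA -chiD// -chiD//; congr (chi _ _ + chi _ _).
  by rewrite addrAC.
by rewrite -[RHS]addrA -scalerDr addrAC.
Qed.

(** A step solves the projection equation with all active sets kept at [u]. *)
Lemma newton_stepE u u' :
  newton_step S Sadj Om yd ua ub psi mu alpha rho u u' ->
  forall nu, u' nu = chi (inact u nu) (newton_control u u' nu) + active u nu.
Proof.
move=> [uI uIE ->] nu; rewrite l2sum_funD; congr (_ + _).
have mY := measurable_state_active u; have mI := measurable_inactive u nu.
have /(congr1 (fun h : U => h nu)) := uIE.
rewrite l2sum_funD !l2sum_ofE => /eqP; rewrite -subr_eq0 -addrA addr_eq0 => /eqP ->.
rewrite opprB chiZ// chi_chi// setIid -chiZ// -chiB//; congr (chi _ _).
rewrite [in RHS]addrC newton_controlD /newton_op l2sum_ofE; congr (_ - _).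
rewrite /newton_control; congr (_ *: Sadj _).
rewrite /state_term /multiplier_update [chi (Om nu) (_ - _)]chiB// -!addrA.
congr (_ + _); rewrite addrCA -chiD//; congr (_ + chi _ _).
by rewrite scalerBr addrCA.
Qed.

(** When the active sets of [u] and [u'] agree, the equation solved by the step is
    the projection equation at [u'] itself. *)
Lemma residual_eq0_of_stopping u u' :
  newton_step S Sadj Om yd ua ub psi mu alpha rho u u' ->
  stopping_criterion S Sadj Om yd ua ub psi mu alpha rho u u' ->
  residual S Sadj Om yd ua ub psi mu alpha rho u' = 0.
Proof.
move=> step [stopA stopY]; apply/eqP; rewrite subr_eq0; apply/eqP.
rewrite proj_unconstrained; apply: l2sumP => nu; rewrite (newton_stepE step nu).
have [eqA eqB eqI] := stopA nu.
have mA u := measurable_lower u nu; have mB u := measurable_upper u nu.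
have EA v : active v nu = chi (lower v nu) (ua nu)
    + chi (upper v nu `\` lower v nu) (ub nu) by exact: l2sum_ofE.
have EI : chi_inactive S Sadj Om yd ua ub psi mu alpha rho u' (unconstrained u') nu =
    chi (inact u' nu) (newton_control u' u' nu).
  by rewrite newton_control_self; exact: l2sum_ofE.
apply: etrans (esym (l2sum_funD _ _ _)).
apply: etrans (esym (congr2 +%R EI (EA u'))).
apply: (etrans (congr1 (+%R _) (EA u))).
apply: (congr2 +%R); last apply: (congr2 +%R).
- rewrite (chi_ae_eq _ (measurable_inactive u' nu) (measurable_inactive u nu) eqI).
  congr (chi _ (_ *: Sadj (_ + _))); apply/esym.
  exact: (chi_ae_eq _ (measurable_state_active u') (measurable_state_active u) stopY).
- by apply/esym; exact: (chi_ae_eq _ (mA u') (mA u) eqA).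
- apply/esym/chi_ae_eq; [exact: measurableD|exact: measurableD|].
  exact: ae_eq_setD.
Qed.

End newton_step.

(** * Uniform invertibility of the linearized systems *)

Lemma ler_opnorm_bounded (R : realType) (V W : normedModType R) (f : V -> W) (K : R) :
  linear f -> (forall x, `|f x| <= K * `|x|) -> forall x, `|f x| <= opnorm f * `|x|.
Proof.
move=> lf fK.
pose g : {linear V -> W} := HB.pack f (GRing.isLinear.Build R V W *:%R f lf).
apply: (@ler_opnorm R V W g); apply/(@linear_bounded_continuous R V W g)/linear_boundedP.
exists `|K|; split; first exact: num_real.
move=> r Kr x; apply: le_trans (fK x) _; apply: ler_wpM2r => //.
by apply: le_trans (ler_norm _) (ltW Kr).
Qed.

Section linearized_operator.
Context (R : realType) (n : nat) (O : lipschitz_domain R n) (N : nat).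
Variables (S Sadj : L2 O -> L2 O) (Om : 'I_N -> set 'rV[R]_n).
Variables (alpha rho C : R).
Hypotheses (S_linear : linear S) (Sadj_linear : linear Sadj).
Hypothesis S_adj : is_adjoint S Sadj.
Hypothesis Om_meas : forall nu, measurable (Om nu).
Hypotheses (alpha_gt0 : 0 < alpha) (rho_gt0 : 0 < rho) (C_ge0 : 0 <= C).
Hypothesis S_le : forall v, `|S v| <= C * `|v|.
Hypothesis Sadj_le : forall v, `|Sadj v| <= C * `|v|.
Local Notation U := (l2sum 'I_N (L2 O)).
Implicit Types (u v h g : U) (nu : 'I_N).

Let SadjL : {linear L2 O -> L2 O} :=
  HB.pack Sadj (GRing.isLinear.Build R (L2 O) (L2 O) *:%R Sadj Sadj_linear).
Let Sadj_B (v w : L2 O) : Sadj (v - w) = Sadj v - Sadj w.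
Proof. exact: (linearB SadjL). Qed.

Let funB (h g : U) nu : (h - g : U) nu = h nu - g nu. Proof. exact: l2sum_funB. Qed.

Let Z := \bigcup_nu Om nu.

Let measurable_Z : measurable Z.
Proof. by apply: fin_bigcup_measurable => //. Qed.

(** The operators whose norms enter the lower bound on [alpha]. *)
Definition coupling nu (v : L2 O) : L2 O := chi Z (S v - chi (Om nu) (S v)).

Lemma coupling_le nu (w : L2 O) : `|coupling nu w| <= opnorm (coupling nu) * `|w|.
Proof.
apply: (@ler_opnorm_bounded _ _ _ (coupling nu) (C + C)).
  move=> a x y; rewrite /coupling S_linear (chi_is_linear (Om_meas nu)).
  rewrite -[RHS](chi_is_linear measurable_Z) scalerBr opprD; congr (chi Z _).
  by rewrite addrACA.
move=> x; apply: le_trans (norm_chi_le measurable_Z _) _.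
apply: le_trans (ler_normB _ _) _; rewrite mulrDl; apply: lerD => //.
exact: le_trans (norm_chi_le (Om_meas nu) _) (S_le x).
Qed.

Definition coupling_sqr : R := \sum_nu opnorm (coupling nu) ^+ 2.

Lemma coupling_sqr_ge0 : 0 <= coupling_sqr.
Proof. by apply: sumr_ge0 => nu _; exact: sqr_ge0. Qed.

(** The linear part of a Newton step, for an arbitrary active set [Y] of the state
    constraint. All estimates below are uniform in [Y]. *)
Definition linearized (Y : set 'rV[R]_n) h : U :=
  l2sum_of (fun nu => alpha^-1 *: Sadj (chi (Om nu) (state S h) + chi Y (rho *: state S h))).

Lemma linearizedE (Y : set 'rV[R]_n) h nu : linearized Y h nu =
  alpha^-1 *: Sadj (chi (Om nu) (state S h) + chi Y (rho *: state S h)).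
Proof. exact: l2sum_ofE. Qed.

(** The sum over [nu] of [(b nu * t - B / 2 * x nu)^2 >= 0], divided by [B]. This
    is the source of the factor 1/4 in the condition on [alpha]. *)
Lemma young_sum (b x : 'I_N -> R) (t : R) :
  (\sum_nu b nu * x nu) * t <=
  t ^+ 2 + 4^-1 * (\sum_nu b nu ^+ 2) * (\sum_nu x nu ^+ 2).
Proof.
set B := \sum_nu b nu ^+ 2; set X := \sum_nu x nu ^+ 2.
have [B0|B0] := eqVneq B 0.
  have b0 nu : b nu = 0.
    have /eqP := B0; rewrite psumr_eq0 => [|i _]; last exact: sqr_ge0.
    by move=> /allP/(_ nu (mem_index_enum nu)); rewrite implyTb sqrf_eq0 => /eqP.
  rewrite big1 => [|nu _]; last by rewrite b0 mul0r.
  by rewrite B0 mul0r mulr0 mul0r addr0 sqr_ge0.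
have Bp : 0 < B by rewrite lt_def B0 sumr_ge0// => nu _; exact: sqr_ge0.
rewrite -(ler_pM2l Bp) mulr_suml mulr_sumr.
have -> : B * (t ^+ 2 + 4^-1 * B * X) =
    \sum_nu (b nu ^+ 2 * t ^+ 2 + 4^-1 * B ^+ 2 * x nu ^+ 2).
  by rewrite big_split /= -mulr_suml -mulr_sumr -/B -/X; ring.
apply: ler_sum => nu _; have := sqr_ge0 (b nu * t - 2^-1 * B * x nu).
by lra.
Qed.

(** With [s = state S g], the pairings [<chi_nu S g_nu, s>] sum up to [|chi_Z s|^2]
    minus the pairings of the coupling operators with [chi_Z s]. The latter are
    absorbed by the square through Young's inequality; the state constraint
    contributes [rho |chi_Y s|^2 >= 0]. *)
Lemma linearized_weakly_monotone (Y : set 'rV[R]_n) g : measurable Y ->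
  - (4^-1 * coupling_sqr * `|g| ^+ 2) <= alpha * l2sum_inner g (linearized Y g).
Proof.
move=> mY; set s := state S g; set t := `|chi Z s|.
have -> : alpha * l2sum_inner g (linearized Y g) =
    \sum_nu L2_inner (chi (Om nu) (S (g nu))) s + rho * `|chi Y s| ^+ 2.
  rewrite /l2sum_inner mulr_sumr.
  under eq_bigr => nu _.
    rewrite linearizedE L2_innerZr mulVKf ?gt_eqF// -S_adj L2_innerDr.
    rewrite -L2_inner_chi//; over.
  rewrite big_split /=; congr (_ + _).
  transitivity (L2_inner s (chi Y (rho *: s))).
    rewrite L2_innerC L2_inner_sumr; apply: eq_bigr => nu _.
    by rewrite L2_innerC.
  by rewrite chiZ// L2_innerZr L2_innerC L2_inner_chi_sqr.
have hs : - (4^-1 * coupling_sqr * `|g| ^+ 2) <=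
    \sum_nu L2_inner (chi (Om nu) (S (g nu))) s.
  have E nu : L2_inner (chi (Om nu) (S (g nu))) s =
      L2_inner (chi Z (S (g nu))) s - L2_inner (coupling nu (g nu)) (chi Z s).
    rewrite -L2_inner_chi// /coupling chi_chi// setIid -L2_innerBl -chiB//.
    by rewrite subKr chi_chi// setIidr//; exact: bigcup_sup.
  under eq_bigr => nu _ do rewrite E.
  rewrite sumrB (_ : \sum_nu L2_inner (chi Z (S (g nu))) s = t ^+ 2); last first.
    under eq_bigr => nu _ do rewrite L2_inner_chi// L2_innerC.
    by rewrite -L2_inner_sumr L2_inner_chi_sqr.
  have h1 : \sum_nu L2_inner (coupling nu (g nu)) (chi Z s) <=
      (\sum_nu opnorm (coupling nu) * `|g nu|) * t.
    rewrite mulr_suml; apply: ler_sum => nu _.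
    apply: le_trans (ler_norm _) _; apply: le_trans (L2_inner_le _ _) _.
    by apply: ler_wpM2r => //; exact: coupling_le.
  have := young_sum (fun nu => opnorm (coupling nu)) (fun nu => `|g nu|) t.
  rewrite -/coupling_sqr (_ : \sum_nu `|g nu| ^+ 2 = `|g| ^+ 2); last first.
    by rewrite [in RHS]l2sum_norm_def sqr_sqrtr// sumr_ge0// => nu _; exact: sqr_ge0.
  lra.
by have := mulr_ge0 (ltW rho_gt0) (sqr_ge0 `|chi Y s|); lra.
Qed.

Lemma norm_state_le h : `|state S h| <= C * N%:R * `|h|.
Proof.
apply: le_trans (ler_norm_sum _ _ _) _.
apply: (@le_trans _ _ (\sum_(nu < N) C * `|h|)).
  apply: ler_sum => nu _; apply: le_trans (S_le _) _; apply: ler_wpM2l => //.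
  exact: l2sum_norm_ge.
by rewrite sumr_const card_ord -[leLHS]mulr_natr mulrAC.
Qed.

Definition linearized_bound : R := N%:R * (alpha^-1 * (C * ((1 + rho) * (C * N%:R)))).

Lemma linearized_bound_ge0 : 0 <= linearized_bound.
Proof.
have a0 : 0 <= alpha^-1 by rewrite invr_ge0 ltW.
have r0 : 0 <= 1 + rho by rewrite addr_ge0// ltW.
by rewrite /linearized_bound; do !(apply: mulr_ge0 => //).
Qed.

Lemma norm_linearized_le (Y : set 'rV[R]_n) h : measurable Y ->
  `|linearized Y h| <= linearized_bound * `|h|.
Proof.
move=> mY; apply: le_trans (l2sum_norm_le_sum _) _.
apply: (@le_trans _ _ (\sum_(nu < N) alpha^-1 * (C * ((1 + rho) * (C * N%:R * `|h|))))).
  apply: ler_sum => nu _; rewrite linearizedE normrZ gtr0_norm ?invr_gt0//.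
  apply: ler_wpM2l; first by rewrite invr_ge0 ltW.
  apply: le_trans (Sadj_le _) _; apply: ler_wpM2l => //.
  apply: le_trans (ler_normD _ _) _; rewrite mulrDl mul1r; apply: lerD.
    exact: le_trans (norm_chi_le (Om_meas nu) _) (norm_state_le h).
  apply: le_trans (norm_chi_le mY _) _; rewrite normrZ gtr0_norm//.
  by apply: ler_wpM2l; [exact: ltW|exact: norm_state_le].
rewrite sumr_const card_ord -[leLHS]mulr_natl /linearized_bound.
by rewrite le_eqVlt; apply/orP; left; apply/eqP; ring.
Qed.

Section cutoff.
Variables (Y : set 'rV[R]_n) (I : 'I_N -> set 'rV[R]_n).
Hypotheses (mY : measurable Y) (mI : forall nu, measurable (I nu)).

Definition cutoff h : U := l2sum_of (fun nu => chi (I nu) (h nu)).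

Lemma cutoffE h nu : cutoff h nu = chi (I nu) (h nu).
Proof. exact: l2sum_ofE. Qed.

Lemma cutoffB h g : cutoff (h - g) = cutoff h - cutoff g.
Proof.
apply: l2sumP => nu; apply: etrans (esym (funB _ _ _)).
by rewrite (cutoffE (h - g)) funB chiB// (cutoffE h) (cutoffE g).
Qed.

Lemma cutoffD h g : cutoff (h + g) = cutoff h + cutoff g.
Proof. by apply/eqP; rewrite -subr_eq -cutoffB addrK. Qed.

Lemma cutoffK h : cutoff (cutoff h) = cutoff h.
Proof. by apply: l2sumP => nu; rewrite !cutoffE chi_chi// setIid. Qed.

Lemma norm_cutoff_le h : `|cutoff h| <= `|h|.
Proof.
rewrite !l2sum_norm_def; apply: ler_wsqrtr; apply: ler_sum => nu _.
by apply: lerXn2r; rewrite ?nnegrE// cutoffE; exact: norm_chi_le.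
Qed.

Lemma l2sum_inner_cutoff h g : l2sum_inner (cutoff h) g = l2sum_inner h (cutoff g).
Proof. by apply: eq_bigr => nu _; rewrite !cutoffE L2_inner_chi. Qed.

Lemma linearizedB h g : linearized Y (h - g) = linearized Y h - linearized Y g.
Proof.
apply: l2sumP => nu; apply: etrans (esym (funB _ _ _)).
rewrite (linearizedE Y (h - g)) (linearizedE Y h) (linearizedE Y g) -scalerBr -Sadj_B.
rewrite stateB// scalerBr !chiB//; congr (_ *: Sadj _).
by rewrite opprD addrACA.
Qed.

Hypothesis alpha_big : alpha > 4^-1 * coupling_sqr.

Definition coercivity : R := 1 - 4^-1 * coupling_sqr / alpha.

Lemma coercivity_gt0 : 0 < coercivity.
Proof. by rewrite subr_gt0 ltr_pdivrMr// mul1r. Qed.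

Lemma linearized_coercive g :
  coercivity * `|g| ^+ 2 <= `|g| ^+ 2 + l2sum_inner g (linearized Y g).
Proof.
have := linearized_weakly_monotone g mY.
rewrite -ler_pdivrMl// => h; rewrite /coercivity mulrBl mul1r lerD2l.
apply: le_trans h; rewrite le_eqVlt; apply/orP; left; apply/eqP.
by ring.
Qed.

(** The operator [Id + chi_I T] is not coercive, but [Id + chi_I T chi_I] is; its
    solution is supported in [I] as the right-hand side is, and then both
    operators agree on it. *)
Lemma cutoff_system_solvable r : cutoff r = r ->
  exists h, h + cutoff (linearized Y h) = r.
Proof.
move=> rr; have cp := coercivity_gt0.
have K0 := linearized_bound_ge0.
pose B h := h + cutoff (linearized Y (cutoff h)).
have [h Bh] : exists h, B h = r.
  apply: (@lax_milgram _ _ _ _ B (1 + linearized_bound) coercivity) => //.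
  - move=> h g; rewrite /B cutoffB linearizedB cutoffB opprD addrACA.
    by congr (_ + _); rewrite addrC.
  - move=> h; apply: le_trans (ler_normD _ _) _; rewrite mulrDl mul1r lerD2l.
    apply: le_trans (norm_cutoff_le _) _; apply: le_trans (norm_linearized_le _ mY) _.
    by apply: ler_wpM2l => //; exact: norm_cutoff_le.
  - move=> h; rewrite /B l2sum_innerDr l2sum_inner_sqr -l2sum_inner_cutoff.
    have := linearized_coercive (cutoff h).
    have : `|cutoff h| ^+ 2 <= `|h| ^+ 2.
      by apply: lerXn2r; rewrite ?nnegrE//; exact: norm_cutoff_le.
    have c1 : coercivity <= 1.
      by rewrite gerBl divr_ge0 ?(ltW alpha_gt0)// mulr_ge0 ?invr_ge0 ?coupling_sqr_ge0.
    nra.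
exists h; rewrite -{1}Bh /B.
have hh : cutoff h = h.
  have -> : h = r - cutoff (linearized Y (cutoff h)) by rewrite -Bh addrK.
  by rewrite cutoffB cutoffK rr.
by rewrite hh.
Qed.

(** The part outside [I] contributes 2, the part inside [I] the quotient. *)
Definition inverse_bound : R := 2 + (1 + linearized_bound * 2) / coercivity.

Lemma inverse_bound_ge0 : 0 <= inverse_bound.
Proof.
apply: addr_ge0 => //; apply: divr_ge0; last exact: ltW coercivity_gt0.
by apply: addr_ge0 => //; apply: mulr_ge0 => //; exact: linearized_bound_ge0.
Qed.

(** Outside [I] the unknown equals the right-hand side, and is moved to the right;
    inside, the equation is tested with [g = cutoff e] itself. *)
Lemma cutoff_system_bounded e r : e + cutoff (linearized Y e) = r ->
  `|e| <= inverse_bound * `|r|.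
Proof.
move=> er; have cp := coercivity_gt0; have K0 := linearized_bound_ge0.
pose g := cutoff e; pose r' := r - cutoff r.
have gE : g + cutoff (linearized Y e) = cutoff r by rewrite -er cutoffD cutoffK.
have e_g : e - g = r' by rewrite /r' -gE -er opprD addrACA subrr addr0.
have r'2 : `|r'| <= 2 * `|r|.
  by apply: le_trans (ler_normB _ _) _; have := norm_cutoff_le r; lra.
have gg : cutoff g = g by rewrite /g cutoffK.
have test : `|g| ^+ 2 + l2sum_inner g (linearized Y g) =
    l2sum_inner g (cutoff r - linearized Y r').
  have -> : cutoff r - linearized Y r' = g + (cutoff (linearized Y e) - linearized Y e)
      + linearized Y g.
    by rewrite -e_g linearizedB -gE opprB addrA (addrA g) [RHS]addrAC.
  rewrite 2!l2sum_innerDr l2sum_inner_sqr.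
  have -> : l2sum_inner g (cutoff (linearized Y e) - linearized Y e) = 0.
    rewrite -{1}gg l2sum_inner_cutoff cutoffB cutoffK subrr.
    by rewrite /l2sum_inner big1// => nu _; rewrite l2sum_fun0 L2_inner0r.
  by rewrite addr0.
have bound : coercivity * `|g| ^+ 2 <= `|g| * ((1 + linearized_bound * 2) * `|r|).
  apply: le_trans (linearized_coercive g) _; rewrite test.
  apply: le_trans (l2sum_inner_le _ _) _; apply: ler_wpM2l => //.
  apply: le_trans (ler_normB _ _) _; rewrite mulrDl mul1r; apply: lerD.
    exact: norm_cutoff_le.
  apply: le_trans (norm_linearized_le _ mY) _.
  by rewrite -mulrA; apply: ler_wpM2l.
have g_le : `|g| <= (1 + linearized_bound * 2) / coercivity * `|r|.
  rewrite mulrAC ler_pdivlMr// mulrC.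
  have [g0|g0] := eqVneq `|g| 0.
    by rewrite g0 mulr0 mulr_ge0// addr_ge0// mulr_ge0.
  by rewrite -(@ler_pM2l _ `|g|) ?lt_def ?g0 ?normr_ge0// mulrCA -expr2.
rewrite -(subrK g e) e_g /inverse_bound mulrDl.
by apply: le_trans (ler_normD _ _) _; apply: lerD.
Qed.

End cutoff.
End linearized_operator.

(** * Sets where a kink is crossed *)

Section crossing.
Context (R : realType) (n : nat) (O : lipschitz_domain R n).
Local Notation dm := (domain_measure O).

(** If [z] and [z + g] do not have the same sign at [x], then [x] is here or
    [z x = 0]: the set where a kink may be crossed in a perturbation by [g]. *)
Definition crossing (z g : L2 O) : set 'rV[R]_n := [set x | 0 < `|z x| <= `|g x|].

Lemma measurable_crossing z g : measurable (crossing z g).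
Proof.
have mz := measurable_Lp_fun z; have mg := measurable_Lp_fun g.
rewrite (_ : crossing z g = [set x | 0 < `|z x|] `&` [set x | `|z x| <= `|g x|]).
  apply: measurableI; first by apply: measurable_lt_set => //; exact: measurableT_comp.
  by apply: measurable_le_set; exact: measurableT_comp.
by apply/seteqP; split => x /= h; exact/andP.
Qed.

(** The sets where [0 < |z| < t] shrink to the empty set with [t], and the set where
    [|g| >= t] has measure at most [|g|^2 / t^2]. *)
Lemma crossing_small (z : L2 O) (d : R) : 0 < d -> exists2 eta : R, 0 < eta &
  forall g : L2 O, `|g| <= eta -> (dm (crossing z g) <= d%:E)%E.
Proof.
move=> d0; have d2 : 0 < d / 2 by rewrite divr_gt0.
pose F k := [set x | 0 < `|z x|] `&` [set x | `|z x| < k.+1%:R^-1].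
have mz := measurable_Lp_fun z.
have mF k : measurable (F k).
  apply: measurableI; first by apply: measurable_lt_set => //; exact: measurableT_comp.
  by apply: measurable_lt_set => //; exact: measurableT_comp.
have Ffin k : dm (F k) \is a fin_num.
  rewrite ge0_fin_numE//; apply: le_lt_trans (domain_measure_lty O).
  by apply: le_measure; rewrite ?inE.
have capF : \bigcap_k F k = set0.
  rewrite -subset0 => x Fx; have [x0 _] := Fx 0%N I.
  have [_ /=] := Fx (Num.truncn (`|z x|^-1)) I.
  rewrite -[ltLHS]invrK ltf_pV2 ?posrE ?invr_gt0// => h.
  by have := truncnS_gt `|z x|^-1; rewrite ltNge (ltW h).
have Fcvg : dm \o F @ \oo --> 0%E.
  rewrite -(measure0 dm) -capF; apply: nonincreasing_cvg_mu => //.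
  - by rewrite -ge0_fin_numE.
  - by rewrite capF.
  - move=> i j ij; apply/subsetPset => x [x0 xj]; split => //.
    apply: lt_le_trans xj _; rewrite lef_pV2 ?posrE//.
    by rewrite ler_nat.
have [k Fk] : exists k, (dm (F k) <= (d / 2)%:E)%E.
  move/fine_cvg/cvgrPdist_le : Fcvg => /(_ _ d2)[k _ /(_ k (leqnn k))] /=.
  rewrite sub0r normrN => h; exists k; rewrite -(fineK (Ffin k)) lee_fin.
  exact: le_trans (ler_norm _) h.
pose t : R := k.+1%:R^-1; have t0 : 0 < t by rewrite invr_gt0.
exists (t * Num.sqrt (d / 2)); first by rewrite mulr_gt0// sqrtr_gt0.
move=> g geta; have mg := measurable_Lp_fun g.
pose G := [set x | t <= `|g x|].
have mG : measurable G.
  by apply: measurable_le_set => //; exact: measurableT_comp.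
have sub : crossing z g `<=` F k `|` G.
  move=> x /andP[x0 xg]; have [xt|tx] := ltP `|z x| t; first by left.
  by right; exact: le_trans xg.
apply: le_trans (le_measure _ _ _ sub) _; rewrite ?inE//.
- exact: measurable_crossing.
- exact: measurableU.
apply: le_trans (measureU2 _ _ _) _ => //.
rewrite [d]splitr EFinD; apply: leeD => //.
have mg2 : measurable_fun setT (fun x => (g x ^+ 2)%:E).
  by apply/measurable_EFinP; exact: measurable_funX.
have := @le_integral_comp_abse _ _ _ dm setT measurableT _ (t ^+ 2) id
  (@measurable_id _ _ _) (fun r h => h) (fun x y _ _ h => h) mg2 (exprn_gt0 2 t0).
rewrite setTI /=; under eq_integral => x _ do rewrite ger0_norm ?sqr_ge0//.
rewrite -L2_sqr_integral (_ : [set x | _] = G); last first.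
  apply/seteqP; split => x /=; rewrite lee_fin ger0_norm ?sqr_ge0//.
    by rewrite -(real_normK (num_real (g x))) ler_pXn2r// ?nnegrE// ltW.
  by move=> h; rewrite -(real_normK (num_real (g x))) ler_pXn2r// ?nnegrE// ltW.
move=> h; rewrite -(@lee_pmul2l _ (t ^+ 2)%:E) ?lte_fin ?exprn_gt0//.
apply: le_trans h _; rewrite -EFinM lee_fin.
have -> : t ^+ 2 * (d / 2) = (t * Num.sqrt (d / 2)) ^+ 2.
  by rewrite exprMn sqr_sqrtr// ltW.
by apply: lerXn2r; rewrite ?nnegrE//; exact: le_trans geta.
Qed.

(** The mechanism of semi-smoothness: an error that is at most [|T h|], and lives on
    a crossing set of [T h], is of lower order than [h], because the crossing set
    is small and [T] is absolutely continuous. Two kinks are allowed, as for the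
    truncation between two bounds. *)
Lemma crossing_o (T : L2 O -> L2 O) (C : R) (z1 z2 : L2 O) :
  absolutely_continuous T -> 0 <= C -> (forall v, `|T v| <= C * `|v|) ->
  forall e : R, 0 < e -> exists2 eta : R, 0 < eta & forall h v : L2 O, `|h| <= eta ->
  {ae dm, forall x, v x != 0 -> [/\ `|v x| <= `|T h x| &
     0 < `|z1 x| <= `|T h x| \/ 0 < `|z2 x| <= `|T h x|]} ->
  `|v| <= e * `|h|.
Proof.
move=> Tac C0 TC e e0; have [d d0 hd] := Tac e e0.
have d2 : 0 < d / 2 by rewrite divr_gt0.
have [eta1 eta10 h1] := crossing_small z1 d2.
have [eta2 eta20 h2] := crossing_small z2 d2.
have C1 : 0 < C + 1 by rewrite ltr_wpDl.
exists (Num.min eta1 eta2 / (C + 1)).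
  by rewrite divr_gt0// lt_min eta10.
move=> h v; rewrite ler_pdivlMr// le_min => /andP[he1 he2] vT.
have Th : `|T h| <= `|h| * (C + 1).
  by apply: le_trans (TC h) _; rewrite mulrC ler_wpM2l// lerDl.
pose E := crossing z1 (T h) `|` crossing z2 (T h).
have mE : measurable E by apply: measurableU; exact: measurable_crossing.
have Ed : (dm E <= d%:E)%E.
  apply: le_trans (measureU2 _ _ _) _; try exact: measurable_crossing.
  rewrite [d]splitr EFinD; apply: leeD.
    exact: h1 (le_trans Th he1).
  exact: h2 (le_trans Th he2).
apply: le_trans (hd E mE Ed h); apply: le_L2_norm_ae.
apply: filterS2 vT (chiE mE (T h)) => x vx ->.
have [->|v0] := eqVneq (v x) 0; first by rewrite normr0.
have [vTx xE] := vx v0; rewrite indicE mem_set ?mul1r//.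
Qed.

End crossing.

(** * The error equation of a Newton step *)

(** Truncating [w'] according to the position of another value [w] with respect to
    [a] and [b] goes wrong only if one of the bounds is crossed between [w] and
    [w'], and then by at most [|w - w'|]. *)
Lemma truncation_crossing (R : realDomainType) (a b w w' : R) : a <= b ->
  let v := (if w <= a then a else if b <= w then b else w')
           - Num.min (Num.max w' a) b in
  v != 0 -> `|v| <= `|w - w'| /\
    (0 < `|w' - a| <= `|w - w'| \/ 0 < `|w' - b| <= `|w - w'|).
Proof.
move=> ab /=.
have xabs (x y : R) : x <= y -> `|x - y| = y - x.
  by move=> xy; rewrite distrC ger0_norm// subr_ge0.
have [wa|aw] := leP w a; [|have [bw|wb] := leP b w].
- have [wa'|aw'] := leP w' a; first by rewrite min_l// subrr eqxx.
  have h1 : a <= Num.min w' b by rewrite le_min (ltW aw').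
  have h2 : Num.min w' b <= w' by rewrite ge_min lexx.
  move=> _; split; last left.
    by rewrite !xabs//; lra.
  by rewrite ger0_norm ?xabs; [apply/andP; split| |]; lra.
- have [bw'|wb'] := leP b w'.
    by rewrite min_r ?subrr ?eqxx// le_max bw'.
  move=> _; have h1 : w' <= Num.min (Num.max w' a) b.
    by rewrite le_min le_max lexx/= ltW.
  have h2 : Num.min (Num.max w' a) b <= b by rewrite ge_min lexx orbT.
  split; last right.
    by rewrite !ger0_norm; lra.
  by rewrite xabs ?(ltW wb')// ger0_norm; [apply/andP; split|]; lra.
- have [wa'|aw'] := leP w' a.
    rewrite min_l// => h; have w'a : w' < a by rewrite lt_neqAle wa' -subr_eq0 h.
    split; last left.
      by rewrite xabs// ger0_norm; lra.
    by rewrite xabs// ger0_norm; [apply/andP; split|]; lra.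
  have [bw'|wb'] := leP w' b; first by rewrite subrr eqxx.
  move=> _; split; last right.
    by rewrite ger0_norm ?xabs; lra.
  by rewrite ger0_norm ?xabs; [apply/andP; split| |]; lra.
Qed.

Lemma pos_part_crossing (R : realDomainType) (m m' : R) :
  let v := (if 0 < m then m' else 0) - Num.max m' 0 in
  v != 0 -> `|v| <= `|m - m'| /\ 0 < `|m'| <= `|m - m'|.
Proof.
move=> /=; have [m0|m0] := ltP 0 m; have [m'0|m'0] := leP m' 0.
- rewrite subr0 => h; have m'n : m' < 0 by rewrite lt_neqAle h.
  rewrite ler0_norm// ger0_norm; last by lra.
  by split; [|apply/andP; split]; lra.
- by rewrite subrr eqxx.
- by rewrite subrr eqxx.
- move=> _; rewrite sub0r normrN (gtr0_norm m'0) ler0_norm; last by lra.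
  by split; [|apply/andP; split]; lra.
Qed.

Section newton_convergence.
Context (R : realType) (n : nat) (O : lipschitz_domain R n) (N : nat).
Variables (S Sadj : L2 O -> L2 O) (Om : 'I_N -> set 'rV[R]_n).
Variables (yd ua ub : 'I_N -> L2 O) (psi mu : L2 O) (alpha rho C : R).
Hypotheses (S_linear : linear S) (Sadj_linear : linear Sadj).
Hypothesis S_adj : is_adjoint S Sadj.
Hypothesis Om_meas : forall nu, measurable (Om nu).
Hypotheses (alpha_gt0 : 0 < alpha) (rho_gt0 : 0 < rho) (C_ge0 : 0 <= C).
Hypothesis S_le : forall v, `|S v| <= C * `|v|.
Hypothesis Sadj_le : forall v, `|Sadj v| <= C * `|v|.
Hypothesis alpha_big : alpha > 4^-1 * coupling_sqr S Om.
Local Notation U := (l2sum 'I_N (L2 O)).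
Implicit Types (u v ubar : U) (nu : 'I_N).

Local Notation inact u := (inactive S Sadj Om yd ua ub psi mu alpha rho u).
Local Notation sactive u := (state_active S psi mu rho u).
Local Notation active u := (active_part S Sadj Om yd ua ub psi mu alpha rho u).
Local Notation mult u := (multiplier_update S psi mu rho u).
Local Notation control_at u v := (newton_control S Sadj Om yd psi mu alpha rho u v).
Local Notation step u u' := (newton_step S Sadj Om yd ua ub psi mu alpha rho u u').

Let funB (h g : U) nu : (h - g : U) nu = h nu - g nu. Proof. exact: l2sum_funB. Qed.
Let funD (h g : U) nu : (h + g : U) nu = h nu + g nu. Proof. exact: l2sum_funD. Qed.

Lemma newton_step_exists u : exists u', step u u'.
Proof.
have mY := measurable_state_active S psi mu rho u.
have mI nu := measurable_inactive S Sadj Om yd ua ub psi mu alpha rho u nu.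
pose r : U := cutoff (inact u) (newton_rhs S Sadj Om yd ua ub psi mu alpha rho u).
have rr : cutoff (inact u) r = r by apply: cutoffK.
have [h hr] := cutoff_system_solvable S_linear Sadj_linear S_adj Om_meas alpha_gt0
  rho_gt0 C_ge0 S_le Sadj_le mY mI alpha_big rr.
by exists (h + active u), h.
Qed.

Lemma mult_sub u v : mult u - mult v = rho *: state S (u - v).
Proof.
rewrite /multiplier_update opprD addrACA subrr add0r -scalerBr stateB//.
by congr (_ *: _); rewrite opprB addrA subrK.
Qed.

(** The defect of [ubar] in the equation that a Newton step from [u] solves. *)
Definition step_residual ubar u : U :=
  l2sum_of (fun nu => chi (inact u nu) (control_at u ubar nu) + active u nu - ubar nu).

(** The error [u' - ubar] solves the linearized system with the residual of [ubar]
    as its right-hand side. *)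
Lemma newton_step_bounded ubar u u' : step u u' ->
  `|u' - ubar| <= inverse_bound S Om alpha rho C * `|step_residual ubar u|.
Proof.
move=> uu'.
have mY := measurable_state_active S psi mu rho u.
have mI nu := measurable_inactive S Sadj Om yd ua ub psi mu alpha rho u nu.
apply: (cutoff_system_bounded S_linear Sadj_linear S_adj Om_meas alpha_gt0
  rho_gt0 C_ge0 S_le Sadj_le mY mI alpha_big).
apply: l2sumP => nu; apply: etrans (esym (l2sum_ofE _ _)).
apply: (etrans (funD _ _ _)).
rewrite (cutoffE (inact u)) -[linearized _ _ _ _ _ _ _ nu]/(newton_op S Sadj Om psi mu alpha
  rho u (u' - ubar) nu).
have -> : newton_op S Sadj Om psi mu alpha rho u (u' - ubar) nu =
    control_at u ubar nu - control_at u u' nu.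
  have := newton_controlD yd psi mu alpha rho S_linear Sadj_linear Om_meas
    u ubar (u' - ubar) nu.
  by rewrite addrCA subrr addr0 => ->; rewrite subKr.
rewrite chiB// funB (newton_stepE S_linear Sadj_linear Om_meas uu' nu).
by rewrite [LHS]addrC !addrA subrK.
Qed.

End newton_convergence.

(** * The residual is of lower order *)

Lemma L2_truncationE (R : realType) (n : nat) (O : lipschitz_domain R n) (w a b : L2 O) :
  {ae domain_measure O, forall x,
    L2_of O (fun x => Num.min (Num.max (w x) (a x)) (b x)) x =
    Num.min (Num.max (w x) (a x)) (b x)}.
Proof.
pose abs (v : L2 O) : L2 O := L2_of O (fun x => `|v x|).
have absE v : {ae domain_measure O, forall x, abs v x = `|v x|}.
  apply: (@L2_of_dominated _ _ _ _ v).
    by apply: measurableT_comp => //; exact: measurable_Lp_fun.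
  by apply: aeW => x; rewrite normr_id.
apply: (@L2_of_dominated _ _ _ _ (abs w + abs a + abs b)).
  apply: measurable_minr; last exact: measurable_Lp_fun.
  by apply: measurable_maxr; exact: measurable_Lp_fun.
apply: filter_app (filterI (absE w) (filterI (absE a) (absE b))).
apply: filterS2 (Lp_funD (abs w + abs a) (abs b)) (Lp_funD (abs w) (abs a)) => x -> ->.
move=> [-> [-> ->]]; rewrite [leRHS]ger0_norm ?addr_ge0//.
have := normr_ge0 (w x); have := normr_ge0 (a x); have := normr_ge0 (b x).
by case: (leP (w x) (a x)) => _; [case: (leP (a x) (b x))|case: (leP (w x) (b x))] => _; lra.
Qed.

Section newton_superlinear.
Context (R : realType) (n : nat) (O : lipschitz_domain R n) (N : nat).
Local Notation dm := (domain_measure O).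
Variables (S Sadj : L2 O -> L2 O) (Om : 'I_N -> set 'rV[R]_n).
Variables (yd ua ub : 'I_N -> L2 O) (psi mu : L2 O) (alpha rho C : R).
Hypotheses (S_linear : linear S) (Sadj_linear : linear Sadj).
Hypothesis S_adj : is_adjoint S Sadj.
Hypothesis Om_meas : forall nu, measurable (Om nu).
Hypothesis ua_le_ub : forall nu, {ae dm, forall x, ua nu x <= ub nu x}.
Hypotheses (alpha_gt0 : 0 < alpha) (rho_gt0 : 0 < rho) (C_ge0 : 0 <= C).
Hypothesis S_le : forall v, `|S v| <= C * `|v|.
Hypothesis Sadj_le : forall v, `|Sadj v| <= C * `|v|.
Hypotheses (S_ac : absolutely_continuous S) (Sadj_ac : absolutely_continuous Sadj).
Local Notation U := (l2sum 'I_N (L2 O)).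
Implicit Types (u h : U) (nu : 'I_N).

Local Notation unconstrained u := (unconstrained_control S Sadj Om yd psi mu alpha rho u).
Local Notation lower u := (lower_active S Sadj Om yd ua psi mu alpha rho u).
Local Notation upper u := (upper_active S Sadj Om yd ub psi mu alpha rho u).
Local Notation inact u := (inactive S Sadj Om yd ua ub psi mu alpha rho u).
Local Notation sactive u := (state_active S psi mu rho u).
Local Notation active u := (active_part S Sadj Om yd ua ub psi mu alpha rho u).
Local Notation mult u := (multiplier_update S psi mu rho u).
Local Notation control_at u v := (newton_control S Sadj Om yd psi mu alpha rho u v).
Local Notation step u u' := (newton_step S Sadj Om yd ua ub psi mu alpha rho u u').

Let SL : {linear L2 O -> L2 O} :=
  HB.pack S (GRing.isLinear.Build R (L2 O) (L2 O) *:%R S S_linear).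
Let SadjL : {linear L2 O -> L2 O} :=
  HB.pack Sadj (GRing.isLinear.Build R (L2 O) (L2 O) *:%R Sadj Sadj_linear).
Let SadjB (v w : L2 O) : Sadj (v - w) = Sadj v - Sadj w.
Proof. exact: (linearB SadjL). Qed.
Let SadjZ a (v : L2 O) : Sadj (a *: v) = a *: Sadj v.
Proof. exact: (linearZ_LR SadjL). Qed.
Let SZ a (v : L2 O) : S (a *: v) = a *: S v.
Proof. exact: (linearZ_LR SL). Qed.
Let funB (h g : U) nu : (h - g : U) nu = h nu - g nu. Proof. exact: l2sum_funB. Qed.

(** The kink of the positive part: the perturbation [mult u - mult ubar] is in the
    range of [S]. *)
Lemma chi_state_active_small (ubar : U) (e : R) : 0 < e ->
  exists2 d : R, 0 < d & forall u, `|u - ubar| <= d ->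
  `|chi (sactive u) (mult ubar) - pos_part (mult ubar)| <= e * `|u - ubar|.
Proof.
move=> e0; pose k : R := rho * N%:R + 1.
have k0 : 0 < k by rewrite /k ltr_wpDl// mulr_ge0// ltW.
have [eta eta0 small] := crossing_o (mult ubar) (mult ubar) S_ac C_ge0 S_le (divr_gt0 e0 k0).
exists (eta / k); first exact: divr_gt0.
move=> u; rewrite ler_pdivlMr// => ud.
pose h : L2 O := rho *: \sum_nu (u - ubar) nu.
have hle : `|h| <= `|u - ubar| * k.
  rewrite normrZ (gtr0_norm rho_gt0) mulrC /k mulrDr mulr1.
  rewrite (@le_trans _ _ (`|u - ubar| * (rho * N%:R)))// ?lerDl//.
  rewrite mulrCA mulrC; apply: ler_wpM2l; first exact: ltW.
  apply: le_trans (ler_norm_sum _ _ _) _.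
  apply: (@le_trans _ _ (\sum_(nu < N) `|u - ubar|)).
    by apply: ler_sum => nu _; exact: l2sum_norm_ge.
  by rewrite sumr_const card_ord -[leLHS]mulr_natr.
have Sh : S h = mult u - mult ubar.
  by rewrite mult_sub// state_sum// SZ.
apply: (@le_trans _ _ (e / k * `|h|)); last first.
  rewrite -mulrA; apply: ler_wpM2l; first exact: ltW.
  by rewrite ler_pdivrMl// mulrC.
apply: small; first exact: le_trans ud.
have mY := measurable_state_active S psi mu rho u; rewrite Sh.
set m := mult u; set m' := mult ubar.
apply: filter_app (Lp_funB (chi (sactive u) m') (pos_part m')).
apply: filter_app (Lp_funB m m').
apply: filter_app (chiE mY m').
apply: filterS2 (@ae_domain R n O) (pos_partE m') => x Ox -> -> -> -> h0.
have E : \1_(sactive u) x * m' x = if 0 < m x then m' x else 0.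
  rewrite indicE in_setI (mem_set Ox) /=; case: ifPn => mx.
    by rewrite mem_set// mul1r.
  by rewrite memNset ?mul0r//; exact/negP.
rewrite E in h0 *; have [h1 h2] := pos_part_crossing h0.
by split => //; left.
Qed.

Lemma norm_pos_partB (v w : L2 O) : `|pos_part v - pos_part w| <= `|v - w|.
Proof.
apply: le_L2_norm_ae.
apply: filter_app (Lp_funB (pos_part v) (pos_part w)); apply: filter_app (Lp_funB v w).
apply: filterS2 (pos_partE v) (pos_partE w) => x -> -> -> ->.
case: (leP (v x) 0) => v0; case: (leP (w x) 0) => w0; rewrite ?subrr ?normr0 ?subr0 ?sub0r//.
  by rewrite normrN (gtr0_norm w0) ler0_norm; lra.
by rewrite (gtr0_norm v0) ger0_norm; lra.
Qed.

(** The Lipschitz constant of the argument of [Sadj] in the unconstrained control. *)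
Definition control_bound : R := alpha^-1 * (C * N%:R * (1 + rho)).

Lemma unconstrained_control_sub u v nu : exists2 h : L2 O,
  Sadj h = unconstrained u nu - unconstrained v nu & `|h| <= control_bound * `|u - v|.
Proof.
have sle := norm_state_le C_ge0 S_le (u - v).
exists (- alpha^-1 *: ((chi (Om nu) (state S u - yd nu) + pos_part (mult u))
    - (chi (Om nu) (state S v - yd nu) + pos_part (mult v)))).
  rewrite -!newton_control_self /newton_control !chi_state_active SadjZ SadjB.
  by rewrite scalerBr.
rewrite normrZ normrN gtr0_norm ?invr_gt0// /control_bound -[leRHS]mulrA.
apply: ler_wpM2l; first by rewrite invr_ge0 ltW.
rewrite opprD addrACA -chiB//.
apply: le_trans (ler_normD _ _) _; rewrite mulrAC mulrDr mulr1; apply: lerD.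
  apply: le_trans (norm_chi_le (Om_meas nu) _) _.
  by rewrite opprB addrA subrK -stateB.
apply: le_trans (norm_pos_partB _ _) _; rewrite mult_sub// normrZ (gtr0_norm rho_gt0) mulrC.
by apply: ler_wpM2r => //; exact: ltW.
Qed.

Lemma control_bound_ge0 : 0 <= control_bound.
Proof.
have a0 : 0 <= alpha^-1 by rewrite invr_ge0 ltW.
have r0 : 0 <= 1 + rho by rewrite addr_ge0// ltW.
by rewrite /control_bound; do !(apply: mulr_ge0 => //).
Qed.

Section at_solution.
Variable ubar : U.
Hypothesis ubarE : ubar = proj_admissible ua ub (unconstrained ubar).

(** The kinks of the projection: the perturbation of the unconstrained control is in
    the range of [Sadj]. *)
Lemma active_part_small nu (e : R) : 0 < e ->
  exists2 d : R, 0 < d & forall u, `|u - ubar| <= d ->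
  `|chi (inact u nu) (unconstrained ubar nu) + active u nu - ubar nu| <= e * `|u - ubar|.
Proof.
move=> e0; pose k := control_bound + 1.
have k0 : 0 < k by rewrite /k ltr_wpDl// control_bound_ge0.
set w' := unconstrained ubar nu.
have [eta eta0 small] := crossing_o (w' - ua nu) (w' - ub nu) Sadj_ac C_ge0 Sadj_le
  (divr_gt0 e0 k0).
exists (eta / k); first exact: divr_gt0.
move=> u; rewrite ler_pdivlMr// => ud.
have [h hE hle'] := unconstrained_control_sub u ubar nu.
have hle : `|h| <= `|u - ubar| * k.
  by apply: le_trans hle' _; rewrite mulrC; apply: ler_wpM2l => //; rewrite /k lerDl.
apply: (@le_trans _ _ (e / k * `|h|)); last first.
  rewrite -mulrA; apply: ler_wpM2l; first exact: ltW.
  by rewrite ler_pdivrMl// mulrC.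
apply: small; first exact: le_trans ud.
rewrite hE -/w'; set w := unconstrained u nu.
have mA := measurable_lower S Sadj Om yd ua psi mu alpha rho u nu.
have mB := measurable_upper S Sadj Om yd ub psi mu alpha rho u nu.
have mI := measurable_inactive S Sadj Om yd ua ub psi mu alpha rho u nu.
have mBA := measurableD mB mA.
pose a := chi (lower u nu) (ua nu); pose b := chi (upper u nu `\` lower u nu) (ub nu).
have actE : active u nu = a + b by exact: l2sum_ofE.
rewrite actE; set c := chi (inact u nu) w'.
have ubarx : {ae dm, forall x, ubar nu x = Num.min (Num.max (w' x) (ua nu x)) (ub nu x)}.
  have E : ubar nu = L2_of O (fun x => Num.min (Num.max (w' x) (ua nu x)) (ub nu x)).
    by apply: (etrans (congr1 (fun h : U => h nu) ubarE)); exact: l2sum_ofE.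
  by apply: filterS (L2_truncationE w' (ua nu) (ub nu)) => x <-; rewrite -E.
apply: filter_app (filterI (chiE mI w') (filterI (chiE mA (ua nu)) (chiE mBA (ub nu)))).
apply: filter_app (filterI (Lp_funB (c + (a + b)) (ubar nu))
  (filterI (Lp_funD c (a + b)) (Lp_funD a b))).
apply: filter_app (filterI (Lp_funB w w') (filterI (Lp_funB w' (ua nu)) (Lp_funB w' (ub nu)))).
apply: filter_app (filterI (@ae_domain R n O) ubarx).
apply: filterS (ua_le_ub nu) => x ab [Ox ux] [-> [-> ->]] [-> [-> ->]] [cE [aE bE]].
rewrite [c x]cE [a x]aE [b x]bE ux.
set s := \1_(inact u nu) x * w' x + _.
have -> : s = if w x <= ua nu x then ua nu x else if ub nu x <= w x then ub nu x else w' x.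
  rewrite /s !indicE in_setD !in_setI (mem_set Ox) /=.
  have inset (p : 'rV[R]_n -> bool) : (x \in [set y | p y]) = p x.
    by apply/idP/idP; rewrite inE.
  rewrite !inset -/w; case: (leP (w x) (ua nu x)) => [wa|aw] /=.
    by rewrite andbF /= !mul0r mul1r add0r addr0.
  rewrite andbT /= mul0r add0r; case: (ltP (w x) (ub nu x)) => wb /=.
    by rewrite mul1r mul0r addr0.
  by rewrite mul0r add0r mul1r.
by move=> v0; have [h1 h2] := truncation_crossing ab v0.
Qed.

Lemma step_residual_small (e : R) : 0 < e ->
  exists2 d : R, 0 < d & forall u, `|u - ubar| <= d ->
  `|step_residual S Sadj Om yd ua ub psi mu alpha rho ubar u| <= e * `|u - ubar|.
Proof.
move=> e0; pose k : R := N%:R * (alpha^-1 * C + 1) + 1.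
have aC : 0 <= alpha^-1 * C by rewrite mulr_ge0// invr_ge0 ltW.
have k0 : 0 < k by rewrite /k ltr_wpDl// mulr_ge0// addr_ge0.
have ek0 : 0 < e / k by rewrite divr_gt0.
have [d1 d10 h1] := chi_state_active_small ubar ek0.
have /choice[d2 h2] : forall nu, exists d : R, 0 < d /\ forall u, `|u - ubar| <= d ->
    `|chi (inact u nu) (unconstrained ubar nu) + active u nu - ubar nu| <= e / k * `|u - ubar|.
  by move=> nu; have [d d0 hd] := active_part_small nu ek0; exists d.
pose d := \big[Num.min/d1]_nu d2 nu; exists d.
  by apply: lt_bigmin => // nu _; have [] := h2 nu.
move=> u ud.
have ud1 : `|u - ubar| <= d1 by apply: le_trans ud _; exact: bigmin_le_id.
have ud2 nu : `|u - ubar| <= d2 nu by apply: le_trans ud _; exact: bigmin_le.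
have mI nu := measurable_inactive S Sadj Om yd ua ub psi mu alpha rho u nu.
apply: le_trans (l2sum_norm_le_sum _) _.
apply: (@le_trans _ _ (\sum_(nu < N) (alpha^-1 * C + 1) * (e / k * `|u - ubar|))).
  apply: ler_sum => nu _.
  have -> : step_residual S Sadj Om yd ua ub psi mu alpha rho ubar u nu =
      chi (inact u nu) (control_at u ubar nu - unconstrained ubar nu) +
      (chi (inact u nu) (unconstrained ubar nu) + active u nu - ubar nu).
    apply: (etrans (l2sum_ofE _ _)); rewrite chiB// !addrA; congr (_ + _ - _).
    by rewrite subrK.
  apply: le_trans (ler_normD _ _) _; rewrite mulrDl mul1r; apply: lerD; last first.
    exact: (h2 nu).2.
  apply: le_trans (norm_chi_le (mI nu) _) _.
  rewrite -newton_control_self /newton_control -scalerBr -SadjB normrZ normrN.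
  rewrite gtr0_norm ?invr_gt0// -mulrA; apply: ler_wpM2l; first by rewrite invr_ge0 ltW.
  apply: le_trans (Sadj_le _) _; apply: ler_wpM2l => //.
  by rewrite opprD addrACA subrr add0r (chi_state_active _ _ _ _ ubar); exact: h1.
rewrite sumr_const card_ord -[leLHS]mulr_natl.
rewrite (_ : N%:R * _ = N%:R * (alpha^-1 * C + 1) / k * e * `|u - ubar|); last by ring.
apply: ler_wpM2r => //; apply: ler_piMl; first exact: ltW.
by rewrite ler_pdivrMr// mul1r /k lerDl.
Qed.

Hypothesis alpha_big : alpha > 4^-1 * coupling_sqr S Om.

Lemma newton_step_o (e : R) : 0 < e ->
  exists2 d : R, 0 < d & forall u u', `|u - ubar| <= d -> step u u' ->
  `|u' - ubar| <= e * `|u - ubar|.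
Proof.
move=> e0; pose K := inverse_bound S Om alpha rho C.
have K0 : 0 <= K by apply: inverse_bound_ge0.
have K1 : 0 < K + 1 by rewrite ltr_wpDl.
have [d d0 hd] := step_residual_small (divr_gt0 e0 K1).
exists d => // u u' ud uu'.
apply: le_trans (newton_step_bounded S_linear Sadj_linear S_adj Om_meas alpha_gt0
  rho_gt0 C_ge0 S_le Sadj_le alpha_big _ uu') _.
apply: le_trans (ler_wpM2l K0 (hd u ud)) _.
rewrite mulrA; apply: ler_wpM2r => //.
by rewrite mulrA ler_pdivrMr// mulrC ler_wpM2l ?(ltW e0)// lerDl.
Qed.

End at_solution.
End newton_superlinear.

(** * Optimality of a Nash equilibrium *)

Section nash_optimality.
Context (R : realType) (n : nat) (O : lipschitz_domain R n) (N : nat).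
Local Notation dm := (domain_measure O).
Variables (S Sadj : L2 O -> L2 O) (Om : 'I_N -> set 'rV[R]_n).
Variables (yd ua ub : 'I_N -> L2 O) (psi mu : L2 O) (alpha rho : R).
Hypothesis S_linear : linear S.
Hypothesis S_adj : is_adjoint S Sadj.
Hypothesis Om_meas : forall nu, measurable (Om nu).
Hypothesis ua_le_ub : forall nu, {ae dm, forall x, ua nu x <= ub nu x}.
Hypotheses (alpha_gt0 : 0 < alpha) (rho_gt0 : 0 < rho).
Local Notation U := (l2sum 'I_N (L2 O)).
Implicit Types (u : U) (v d : L2 O) (nu : 'I_N).
Local Notation unconstrained u := (unconstrained_control S Sadj Om yd psi mu alpha rho u).
Local Notation mult u := (multiplier_update S psi mu rho u).
Local Notation cost := (augmented_cost S Om yd psi mu alpha rho).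

Let SL : {linear L2 O -> L2 O} :=
  HB.pack S (GRing.isLinear.Build R (L2 O) (L2 O) *:%R S S_linear).
Let SZ a v : S (a *: v) = a *: S v. Proof. exact: (linearZ_LR SL). Qed.
Let SB (v w : L2 O) : S (v - w) = S v - S w. Proof. exact: (linearB SL). Qed.

Lemma Rintegral_chi_sqr E v : measurable E ->
  \int[dm]_(x in E) (v x ^+ 2) = `|chi E v| ^+ 2.
Proof.
move=> mE; rewrite -L2_inner_sqr Rintegral_mkcond; congr fine.
have mv := measurable_Lp_fun v; have mc := measurable_Lp_fun (chi E v).
apply: ae_eq_integral => //.
- apply/measurable_EFinP; apply/(measurable_restrictT _ _).1 => //.
  by apply: measurable_funTS; exact: measurable_funX.
- by apply/measurable_EFinP; exact: measurable_funM.
apply: filterS (chiE mE v) => x /= -> _; congr EFin.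
by rewrite patchE indicE; case: (x \in E); rewrite /= ?mul1r ?mul0r -?expr2.
Qed.

Lemma augmented_costE nu u : cost nu u =
  2^-1 * `|chi (Om nu) (state S u - yd nu)| ^+ 2 + alpha / 2 * `|u nu| ^+ 2
  + (2 * rho)^-1 * `|pos_part (mult u)| ^+ 2.
Proof. by rewrite /augmented_cost Rintegral_chi_sqr. Qed.

Lemma replace_controlE u nu v i :
  replace_control u nu v i = if i == nu then v else u i.
Proof. exact: l2sum_ofE. Qed.

Lemma state_replace u nu v : state S (replace_control u nu v) = state S u + S (v - u nu).
Proof.
rewrite /state (bigD1 nu)//= [in RHS](bigD1 nu)//= replace_controlE eqxx SB.
rewrite (eq_bigr (fun i => S (u i))) => [|i /negbTE inu]; last by rewrite replace_controlE inu.
by rewrite addrAC [_ + (S v - _)]addrC subrK.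
Qed.

(** Pointwise [(a + b)_+^2 <= (a_+ + b)^2]: a quadratic majorant of the penalty that
    touches it at [v], and so replaces its derivative. *)
Lemma norm_pos_partD_sqr_le v d :
  `|pos_part (v + d)| ^+ 2 <= `|pos_part v| ^+ 2 + 2 * L2_inner (pos_part v) d + `|d| ^+ 2.
Proof.
rewrite -L2_normD_sqr -!L2_inner_sqr; apply: le_L2_inner_ae.
apply: filter_app (Lp_funD (pos_part v) d); apply: filter_app (Lp_funD v d).
apply: filterS2 (pos_partE (v + d)) (pos_partE v) => x -> -> -> ->.
by case: (leP (v x + d x) 0) => h1; case: (leP (v x) 0) => h2; nra.
Qed.

Lemma admissible_segment nu v w (t : R) : 0 <= t <= 1 ->
  admissible ua ub nu v -> admissible ua ub nu w ->
  admissible ua ub nu (v + t *: (w - v)).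
Proof.
move=> /andP[t0 t1] av aw; rewrite /admissible in av aw *.
apply: filter_app (filterI (Lp_funD v (t *: (w - v))) (Lp_funZ t (w - v))).
apply: filter_app (Lp_funB w v).
apply: filterS2 av aw => x /andP[v1 v2] /andP[w1 w2] e [-> ->].
by rewrite e; apply/andP; split; nra.
Qed.

(** First-order optimality, by comparing the costs along the segment from
    [ubar nu] to [v]: at distance [t] their difference is at most [t (L + t Q)],
    where [L] is [alpha] times the pairing in question. *)
Lemma nash_variational (ubar : U) : nash_equilibrium S Om yd ua ub psi mu alpha rho ubar ->
  forall nu v, admissible ua ub nu v ->
  0 <= L2_inner (ubar nu - unconstrained ubar nu) (v - ubar nu).
Proof.
move=> [adm opt] nu v av; set d := v - ubar nu; set m := mult ubar.
set s := state S ubar - yd nu.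
pose L := L2_inner (chi (Om nu) s + pos_part m) (S d) + alpha * L2_inner (ubar nu) d.
pose Q := 2^-1 * `|chi (Om nu) (S d)| ^+ 2 + alpha / 2 * `|d| ^+ 2 + rho / 2 * `|S d| ^+ 2.
have Q0 : 0 <= Q.
  by rewrite /Q !addr_ge0// mulr_ge0 ?sqr_ge0 ?divr_ge0 ?(ltW alpha_gt0) ?(ltW rho_gt0).
have step (t : R) : 0 < t <= 1 -> 0 <= L + t * Q.
  move=> /andP[t0 t1]; rewrite -(pmulr_rge0 _ t0).
  have := opt nu _ (admissible_segment _ (adm nu) av (t := t)).
  rewrite (ltW t0) t1 => /(_ isT); rewrite !augmented_costE -subr_ge0 => h.
  apply: le_trans h _.
  rewrite replace_controlE eqxx -/d.
  have rE : state S (replace_control ubar nu (ubar nu + t *: d)) = state S ubar + t *: S d.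
    by rewrite state_replace addrAC subrr add0r SZ.
  have -> : mult (replace_control ubar nu (ubar nu + t *: d)) = m + (rho * t) *: S d.
    by rewrite /multiplier_update rE addrAC scalerDr addrA scalerA.
  have -> : state S (replace_control ubar nu (ubar nu + t *: d)) - yd nu = s + t *: S d.
    by rewrite rE addrAC.
  rewrite chiD// chiZ//.
  have h3 := norm_pos_partD_sqr_le m ((rho * t) *: S d).
  rewrite normrZ L2_innerZr (gtr0_norm (mulr_gt0 rho_gt0 t0)) in h3.
  rewrite -/s -/m !L2_normD_sqr !normrZ !L2_innerZr (gtr0_norm t0).
  have h4 : (2 * rho)^-1 * `|pos_part (m + (rho * t) *: S d)| ^+ 2 <=
      (2 * rho)^-1 * `|pos_part m| ^+ 2 + t * L2_inner (pos_part m) (S d)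
      + t ^+ 2 * (rho / 2 * `|S d| ^+ 2).
    have r2 : 0 < (2 * rho)^-1 by rewrite invr_gt0 mulr_gt0.
    apply: le_trans (ler_wpM2l (ltW r2) h3) _.
    rewrite le_eqVlt; apply/orP; left; apply/eqP; field.
    by rewrite gt_eqF.
  have h5 : L2_inner (chi (Om nu) s) (chi (Om nu) (S d)) = L2_inner (chi (Om nu) s) (S d).
    by rewrite -L2_inner_chi// chi_chi// setIid.
  rewrite h5 /L /Q L2_innerDl; lra.
have L0 : 0 <= L.
  rewrite leNgt; apply/negP => L0.
(* Small enough for [t * Q < - L]. *)
  pose t := Num.min 1 (- L / (2 * (Q + 1))).
  have Q1 : 0 < 2 * (Q + 1) by rewrite mulr_gt0// ltr_wpDl.
  have t0 : 0 < t by rewrite lt_min ltr01 divr_gt0// oppr_gt0.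
  have t1 : t <= 1 by rewrite ge_min lexx.
  have t2 : t * (2 * (Q + 1)) <= - L by rewrite -ler_pdivlMr// ge_min lexx orbT.
  have := step t; rewrite t0 t1 => /(_ isT); nra.
suff E : alpha * L2_inner (ubar nu - unconstrained ubar nu) d = L.
  by rewrite -(pmulr_rge0 _ alpha_gt0) E.
have wE : unconstrained ubar nu = - alpha^-1 *: Sadj (chi (Om nu) s + pos_part m).
  by apply: (etrans (l2sum_funZ _ _ _)); congr (_ *: _); exact: l2sum_ofE.
rewrite L2_innerBl wE L2_innerZl /L [in RHS]L2_innerC S_adj [in RHS]L2_innerC.
by field; rewrite gt_eqF.
Qed.

(** Tested with the projection [p] of [w] itself, the variational inequality gives
    [0 <= - |p - ubar nu|^2]: pointwise [(ubar - w) (p - ubar) <= - (p - ubar)^2],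
    as [ubar nu] lies between the bounds. *)
Lemma nash_projection (ubar : U) : nash_equilibrium S Om yd ua ub psi mu alpha rho ubar ->
  ubar = proj_admissible ua ub (unconstrained ubar).
Proof.
move=> nash; have [adm _] := nash; apply: l2sumP => nu.
set w := unconstrained ubar nu; set p := proj_admissible _ _ _ nu.
have pE : {ae dm, forall x, p x = Num.min (Num.max (w x) (ua nu x)) (ub nu x)}.
  have E : p = L2_of O (fun x => Num.min (Num.max (w x) (ua nu x)) (ub nu x)).
    exact: l2sum_ofE.
  by apply: filterS (L2_truncationE w (ua nu) (ub nu)) => x <-; rewrite E.
have ap : admissible ua ub nu p.
  rewrite /admissible; apply: filterS2 pE (ua_le_ub nu) => x -> ab.
  by rewrite le_min le_max lexx orbT ab ge_min lexx orbT.
have h1 := nash_variational nash ap.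
have h2 : L2_inner (ubar nu - w) (p - ubar nu) <= L2_inner (- (p - ubar nu)) (p - ubar nu).
  apply: le_L2_inner_ae.
  apply: filter_app (filterI (Lp_funB (ubar nu) w)
    (filterI (Lp_funB p (ubar nu)) (Lp_funN (p - ubar nu)))).
  have admx := adm nu; rewrite /admissible in admx.
  apply: filter_app (ua_le_ub nu).
  apply: filterS2 pE admx => x px /andP[ax bx] ab [-> [pu ->]]; rewrite pu px.
  by case: (leP (w x) (ua nu x)) => wa; [case: (leP (ua nu x) (ub nu x))|
    case: (leP (w x) (ub nu x))] => wb; nra.
rewrite L2_innerNl L2_inner_sqr in h2.
have : `|p - ubar nu| ^+ 2 = 0.
  by apply/eqP; rewrite eq_le sqr_ge0 andbT; have := le_trans h1 h2; lra.
by move=> /eqP; rewrite sqrf_eq0 normr_eq0 subr_eq0 => /eqP.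
Qed.

End nash_optimality.

(** * Superlinear convergence *)

(** With [e = 1/2] the estimate makes a ball invariant and the errors decay
    geometrically; then every [e] becomes available. *)
Lemma superlinear_convergence_of_step_o (R : realType) (V : normedModType R)
    (step : V -> V -> Prop) (l : V) :
  (forall e : R, 0 < e -> exists2 d : R, 0 < d & forall u u', `|u - l| <= d -> step u u' ->
    `|u' - l| <= e * `|u - l|) ->
  exists2 d : R, 0 < d & forall u : nat -> V, `|u 0%N - l| < d ->
    (forall k, step (u k) (u k.+1)) -> superlinear_convergence u l.
Proof.
move=> step_o; have [d d0 hd] := step_o 2^-1 (ltac:(by rewrite invr_gt0 ltr0n)).
exists d => // u u0 us.
have geo k : `|u k - l| <= 2^-1 ^+ k * d.
  elim: k => [|k IH]; first by rewrite expr0 mul1r ltW.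
  have kd : `|u k - l| <= d.
    by apply: le_trans IH _; rewrite ler_piMl ?(ltW d0)// exprn_ile1// invf_le1// ler1n.
  by apply: le_trans (hd _ _ kd (us k)) _; rewrite exprS -mulrA ler_wpM2l.
have near_l (e : R) : 0 < e -> \forall k \near \oo, `|u k - l| <= e.
  move=> e0; have half1 : `|2^-1 : R| < 1 by rewrite ger0_norm// invf_lt1// ltr1n.
  have /cvgrPdist_le/(_ e e0) := cvg_geometric d half1.
  apply: filterS => k; rewrite sub0r normrN => ke; apply: le_trans (geo k) _.
  by rewrite mulrC; apply: le_trans (ler_norm _) ke.
split.
  apply/cvgrPdist_le => e /near_l; apply: filterS => k.
  by rewrite distrC.
apply/eqoP => e e0; have [de de0 hde] := step_o e e0.
apply: filterS (near_l de de0) => k kd.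
by rewrite !normr_id; exact: hde.
Qed.

Theorem theorem4p4 (R : realType) (n : nat) (hn : (0 < n <= 3)%N)
    (O : lipschitz_domain R n) (N : nat)
    (q : \bar R) (hq : (2%:E < q)%E)
    (Y : normedModType R)
    (iota : {linear Y -> Lp (domain_measure O) (lt2_le1 hq)})
    (iota_inj : injective iota) (iota_cont : continuous iota)
    (A : {linear Y -> Hm1 O}) (A_cont : continuous A)
    (Ainv : Hm1 O -> Y) (AK : cancel A Ainv) (AinvK : cancel Ainv A)
    (Ainv_cont : continuous Ainv)
    (S Sadj : L2 O -> L2 O) (S_def : S = solution_operator iota Ainv)
    (S_adj : is_adjoint S Sadj)
    (Om : 'I_N -> set 'rV[R]_n) (Om_meas : forall nu, measurable (Om nu))
    (Om_sub : forall nu, Om nu `<=` O)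
    (yd ua ub : 'I_N -> L2 O)
    (ua_le_ub : forall nu, {ae domain_measure O, forall x, ua nu x <= ub nu x})
    (psi : 'rV[R]_n -> R) (psi_cont : {within closure O, continuous psi})
    (mu : L2 O) (mu_ge0 : {ae domain_measure O, forall x, 0 <= mu x})
    (alpha rho : R) (alpha_gt0 : 0 < alpha) (rho_gt0 : 0 < rho) :
  let psiL2 := L2_of O (fun x => \1_O x * psi x) in
  let Z := \bigcup_nu Om nu in
  alpha > 4^-1 * \sum_nu
    opnorm (fun v : L2 O => chi Z (S v - chi (Om nu) (S v))) ^+ 2 ->
  (forall ubar : l2sum 'I_N (L2 O),
    nash_equilibrium S Om yd ua ub psiL2 mu alpha rho ubar ->
    exists2 delta : R, 0 < delta &
      forall u0 : l2sum 'I_N (L2 O), `|u0 - ubar| < delta ->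
        (exists u : nat -> l2sum 'I_N (L2 O), u 0%N = u0 /\
          newton_iterates S Sadj Om yd ua ub psiL2 mu alpha rho u) /\
        (forall u : nat -> l2sum 'I_N (L2 O), u 0%N = u0 ->
          newton_iterates S Sadj Om yd ua ub psiL2 mu alpha rho u ->
          superlinear_convergence u ubar)) /\
  (forall (u : nat -> l2sum 'I_N (L2 O)) (k : nat),
    (forall j, (j <= k)%N ->
      newton_step S Sadj Om yd ua ub psiL2 mu alpha rho (u j) (u j.+1)) ->
    stopping_criterion S Sadj Om yd ua ub psiL2 mu alpha rho (u k) (u k.+1) ->
    residual S Sadj Om yd ua ub psiL2 mu alpha rho (u k.+1) = 0).
Proof.
move=> psiL2 Z alpha_big.
have S_linear : linear S by rewrite S_def; exact: solution_operator_linear AK AinvK.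
have Sadj_linear : linear Sadj by exact: adjoint_linear S_adj.
have S_ac : absolutely_continuous S.
  by rewrite S_def; exact: solution_operator_absolutely_continuous.
have [C C0 S_le] : exists2 C : R, 0 <= C & forall v, `|S v| <= C * `|v|.
  by rewrite S_def; exact: solution_operator_bounded.
have Sadj_le := adjoint_bounded S_adj C0 S_le.
have Sadj_ac : absolutely_continuous Sadj.
  have [C' C'0 S_le'] : exists2 C' : R, 0 <= C' &
      forall v, `|S v| <= C' * `|L2_to_Hm1 v|.
    by rewrite S_def; exact: solution_operator_le_Hm1.
  exact: (adjoint_absolutely_continuous S_adj C'0 S_le').
have {}alpha_big : alpha > 4^-1 * coupling_sqr S Om by exact: alpha_big.
split=> [ubar nash|u k steps stop]; last first.
  exact: (residual_eq0_of_stopping S_linear Sadj_linear Om_meas ua_le_ub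
    (steps k (leqnn k)) stop).
have ubarE := nash_projection S_linear S_adj Om_meas ua_le_ub alpha_gt0 rho_gt0 nash.
have [d d0 conv] := superlinear_convergence_of_step_o
  (fun e => newton_step_o S_linear Sadj_linear S_adj Om_meas ua_le_ub alpha_gt0 rho_gt0
    C0 S_le Sadj_le S_ac Sadj_ac ubarE alpha_big (e := e)).
exists d => // u0 u0d; split=> [|u u0E]; last by apply: conv; rewrite u0E.
have /choice[next stepP] := newton_step_exists yd ua ub psiL2 mu S_linear Sadj_linear S_adj
  Om_meas alpha_gt0 rho_gt0 C0 S_le Sadj_le alpha_big.
by exists (fun k => iter k next u0); split=> // k; exact: stepP.
Qed.
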